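(* For every simplicial complex $K$, the operation $Sq^1$ acts trivially on all classes of dimension (degree) $\le 7$ in $H^*(\mathcal Z_K)$. This bound is optimal: there exist a simplicial complex $K$ and a class $x\in H^8(\mathcal Z_K)$ with $Sq^1(x)\neq0$.
   Context: $H^*(-)$ denotes cohomology with $\mathbb F_2$ coefficients and $Sq^1$ is the first mod 2 Steenrod square. For a (finite) simplicial complex $K$ with vertex set $[m]=\{1,\dots,m\}$, the moment-angle complex is $\mathcal Z_K=(D^2,S^1)^K=\bigcup_{\sigma\in K}\prod_{i=1}^mY_i^\sigma\subseteq(D^2)^m$ with $Y_i^\sigma=D^2$ if $i\in\sigma$ and $Y_i^\sigma=S^1$ if $i\notin\sigma$. *)

(* Defs.v *)
From HB Require Import structures.
From mathcomp Require Import all_boot all_order all_algebra.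
From mathcomp Require Import zify ring lra.

Set Implicit Arguments.
Unset Strict Implicit.
Unset Printing Implicit Defensive.

Import Order.TTheory GRing.Theory Num.Theory.

Local Open Scope ring_scope.

Definition below N (S : {set 'I_N}) (u : nat) := #|[set s in S | s < u]|%N.
Definition even_part N (S : {set 'I_N}) : {set 'I_N} :=
  [set u : 'I_N | (u \in S) || ~~ odd (below S u)].
Definition odd_part N (S : {set 'I_N}) : {set 'I_N} :=
  [set u : 'I_N | (u \in S) || odd (below S u)].
Definition vertex_enum p N (S : {set 'I_N.+1}) (k : 'I_p.+1) : 'I_N.+1 :=
  nth ord0 (enum S) k.

Lemma vertex_enumC1 n (a : 'I_n.+2) : vertex_enum [set~ a] =1 lift a :> ('I_n.+1 -> _).
Proof.
suff E : enum [set~ a] = map (lift a) (enum 'I_n.+1).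
  by move=> k; rewrite /vertex_enum E (nth_map ord0) ?size_enum_ord // nth_ord_enum.
have lt_trans : transitive (fun i j : 'I_n.+2 => i < j)%N by move=> ? ? ?; apply: ltn_trans.
have lt_irr : irreflexive (fun i j : 'I_n.+2 => i < j)%N by move=> ?; apply: ltnn.
have sorted_ord m : sorted (fun i j : 'I_m => i < j)%N (enum 'I_m).
  by have := iota_ltn_sorted 0 m; rewrite -val_enum_ord sorted_map.
apply: (irr_sorted_eq lt_trans lt_irr).
- by rewrite /enum_mem; apply: (sorted_filter lt_trans); have := sorted_ord n.+2; rewrite enumT.
- rewrite sorted_map (@eq_sorted _ _ (fun i j : 'I_n.+1 => i < j)%N) // => i j /=.
  by rewrite /bump; case: (leqP a i); case: (leqP a j) => /=; lia.
move=> x; rewrite mem_enum !inE; apply/idP/mapP => [xa|[y _ ->]].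
  by case: (unliftP a x) xa => [y ->|->]; rewrite ?eqxx // => _; exists y; rewrite ?mem_enum.
by rewrite eq_sym neq_lift.
Qed.

Lemma bump_bump i j k : (j < i)%N -> bump j (bump i.-1 k) = bump i (bump j k).
Proof.
have B h x : bump h x = if (h <= x)%N then x.+1 else x by rewrite /bump; case: leqP.
by rewrite !B; (do !case: ifP); lia.
Qed.

Lemma card_below N (u : 'I_N) : #|[set s : 'I_N | s < u]%N| = u.
Proof.
rewrite cardsE -sum1_card (eq_bigl (fun s : 'I_N => (s < u)%N)) //.
by rewrite -(big_ord_widen _ (fun=> 1%N)) ?sum1_card ?card_ord // ltnW.
Qed.

Lemma setP' (T : finType) (A B : {set T}) : A = B -> A =i B.
Proof. by move->. Qed.

Section TwoMissing.
Variables (N : nat) (a b : 'I_N).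
Hypothesis ab : (a < b)%N.
Let S := ~: [set a; b].

Lemma below1 : below S a = a.
Proof.
rewrite -[RHS]card_below; apply: eq_card => s; rewrite !inE.
by rewrite -!val_eqE /=; lia.
Qed.
Lemma below2 : below S b = b.-1.
Proof.
rewrite -[in RHS](card_below b) (cardsD1 a) inE ab /=.
apply: eq_card => s; rewrite !inE.
by rewrite -!val_eqE /=; lia.
Qed.

Lemma parts2 : odd a = odd b ->
  even_part S = [set~ if odd a then a else b] /\
  odd_part S = [set~ if odd a then b else a].
Proof.
move=> eo; have ob : odd b.-1 = ~~ odd b by have := ab; case: (nat_of_ord b) => //= k _; rewrite negbK.
have anb : (a == b) = false by have := ab; rewrite -val_eqE; case: eqP => //= ->; rewrite ltnn.
split; apply/setP => u; rewrite !inE.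
- have [->|ua] := eqVneq u a; first by rewrite below1; case: (odd a); rewrite ?eqxx ?anb.
  have [->|ub] := eqVneq u b; last by case: ifP => _ /=; rewrite ?ua ?ub.
  by rewrite below2 ob -eo negbK /=; case: (odd a); rewrite ?eqxx // eq_sym anb.
- have [->|ua] := eqVneq u a; first by rewrite below1; case: (odd a); rewrite ?eqxx ?anb.
  have [->|ub] := eqVneq u b; last by case: ifP => _ /=; rewrite ?ua ?ub.
  by rewrite below2 ob -eo /=; case: (odd a); rewrite ?eqxx // eq_sym anb.
Qed.
End TwoMissing.

Lemma sum_parts n (A : comNzRingType) (c : {set 'I_n.+2} -> A) :
  \sum_(S : {set 'I_n.+2} | (#|even_part S| == n.+1) && (#|odd_part S| == n.+1))
     c (even_part S) * c (odd_part S) =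
  \sum_(p : 'I_n.+2 * 'I_n.+2 | (p.1 < p.2)%N && (odd p.1 == odd p.2))
     c [set~ p.1] * c [set~ p.2].
Proof.
pose Q := [set p : 'I_n.+2 * 'I_n.+2 | (p.1 < p.2)%N && (odd p.1 == odd p.2)].
pose h (p : 'I_n.+2 * 'I_n.+2) := ~: [set p.1; p.2].
have hinj : {in Q &, injective h}.
  move=> [a b] [a' b']; rewrite !inE /= => /andP[ab _] /andP[ab' _] /setC_inj E.
  move/setP: E => E; move: (E a) (E b) (E a') (E b').
  rewrite !inE !eqxx /= !orbT -!val_eqE /=.
  by move=> *; congr (_, _); apply: val_inj => /=; lia.
rewrite [RHS](eq_bigl (fun p => p \in Q)); last by move=> p; rewrite inE.
transitivity (\sum_(p in Q) c (even_part (h p)) * c (odd_part (h p))); last first.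
  apply: eq_bigr => -[a b]; rewrite inE /= => /andP[ab /eqP eo].
  by have [-> ->] := parts2 ab eo; case: ifP => // _; rewrite mulrC.
rewrite -(big_imset (fun S => c (even_part S) * c (odd_part S)) hinj).
apply: eq_bigl => S; apply/idP/imsetP => [/andP[/eqP cA /eqP cB]|[[a b] + ->]]; last first.
  rewrite inE /= => /andP[ab /eqP eo]; have [-> ->] := parts2 ab eo.
  by rewrite !cardsC1 card_ord eqxx.
have : #|~: even_part S| == 1%N.
  by have := cardsC (even_part S); rewrite cA card_ord; lia.
case/cards1P => x Ex; have : #|~: odd_part S| == 1%N.
  by have := cardsC (odd_part S); rewrite cB card_ord; lia.
case/cards1P => y Ey.
have Ax u : (u == x) = (u \notin S) && odd (below S u).
  by have := setP' Ex u; rewrite !inE negb_or negbK => <-.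
have Ay u : (u == y) = (u \notin S) && ~~ odd (below S u).
  by have := setP' Ey u; rewrite !inE negb_or => <-.
have ES : S = ~: [set x; y].
  by apply/setP => u; rewrite !inE Ax Ay -andb_orr orbN andbT negbK.
have := esym (Ax x); rewrite eqxx => /andP[xS ox].
have := esym (Ay y); rewrite eqxx => /andP[yS oy].
have xy : x != y by apply: contraTneq ox => ->.
case: (ltngtP x y) => [lt|lt|/val_inj E]; last by rewrite E eqxx in xy.
- exists (x, y) => //; rewrite inE /= lt /=.
  move: ox oy; rewrite ES below1 // below2 // => -> ob.
  by case: (y : nat) lt ob => //= k _; rewrite ?negbK => ->.
- exists (y, x); last by rewrite /h /= setUC.
  rewrite inE /= lt /=; move: ox oy; rewrite ES setUC below1 // below2 // => ob /negbTE->.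
  by case: (x : nat) lt ob => //= k _ ->.
Qed.

(* parity *)
Section Parity.
Variable b : nat -> bool.
Let e n := (\sum_(0 <= i < n | ~~ odd i) b i)%N.
Let o n := (\sum_(0 <= i < n | odd i) b i)%N.
Let P n := (\sum_(0 <= j < n) \sum_(0 <= i < j | odd i == odd j) b i * b j)%N.

Lemma eS n : (e n.+1 = e n + ~~ odd n * b n)%N.
Proof.
by rewrite /e big_mkcond big_nat_recr //= -big_mkcond; case: (odd n); rewrite ?mul1n ?mul0n.
Qed.

Lemma oS n : (o n.+1 = o n + odd n * b n)%N.
Proof.
by rewrite /o big_mkcond big_nat_recr //= -big_mkcond; case: (odd n); rewrite ?mul1n ?mul0n.
Qed.

Lemma parity_square n : (2 * P n + e n + o n = e n * e n + o n * o n)%N.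
Proof.
elim: n => [|n IH]; first by rewrite /P /e /o !big_nil.
have -> : (P n.+1 = P n + (if odd n then o n else e n) * b n)%N.
  rewrite /P big_nat_recr //= -big_distrl /=; congr (_ + _ * _)%N.
  by rewrite /e /o; case: (odd n); apply: eq_bigl => i; case: (odd i).
rewrite eS oS.
by case: (odd n); case: (b n) => /=; lia.
Qed.

Lemma alt_sum n : \sum_(0 <= i < n) (-1) ^+ i * (b i)%:Z = (e n)%:Z - (o n)%:Z.
Proof.
elim: n => [|n IH]; first by rewrite /e /o !big_nil.
rewrite big_nat_recr //= IH eS oS -signr_odd.
by case: (odd n); case: (b n) => /=; lia.
Qed.

Lemma alt_sum_pairs n k : \sum_(0 <= i < n) (-1) ^+ i * (b i)%:Z = 2 * k ->
  (2 %| k - (P n)%:Z)%Z.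
Proof.
rewrite alt_sum => E; have := parity_square n; move: (P n) (e n) (o n) E => p x y E.
have [t Et] : exists t, (y * y = y + 2 * t)%N.
  exists 'C(y, 2); rewrite mul2n bin2; case: y {E} => // y.
  by have := odd_double_half (y.+1 * y); rewrite oddM /= andNb add0n => ->; rewrite mulnS.
move=> Q; apply/dvdzP; exists (k - t%:Z - y%:Z * k - k * k).
have Ex : x%:Z = y%:Z + 2 * k by lia.
have {}Q : 2 * p%:Z + x%:Z + y%:Z = x%:Z * x%:Z + y%:Z * y%:Z by lia.
have {}Et : y%:Z * y%:Z = y%:Z + 2 * t%:Z by lia.
have Es : (y%:Z + 2 * k) * (y%:Z + 2 * k) = y%:Z * y%:Z + 4 * (y%:Z * k) + 4 * (k * k).
  by ring.
rewrite Ex Es Et in Q; rewrite mulrBl mulrBl mulrBl; lia.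
Qed.
End Parity.

From mathcomp Require Import all_classical reals topology normedtype.

Import numFieldNormedType.Exports.

Local Open Scope classical_set_scope.
Local Open Scope quotient_scope.

Definition std_simplex (R : realType) (n : nat) : set 'rV[R]_n.+1 :=
  [set v | (forall i, 0 <= v ord0 i) /\ \sum_i v ord0 i = 1].
Arguments std_simplex : clear implicits.

(* The standard simplex as a space of its own (subspace topology). *)
Definition simplex (R : realType) (n : nat) : topologicalType :=
  set_type (std_simplex R n).
Arguments simplex : clear implicits.

Section VertexMap.
Variables (R : realType) (m n : nat) (f : 'I_m.+1 -> 'I_n.+1).

Definition push (v : 'rV[R]_m.+1) : 'rV[R]_n.+1 :=
  \row_j \sum_(i | f i == j) v ord0 i.

Lemma push_std v : v \in std_simplex R m -> push v \in std_simplex R n.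
Proof.
rewrite !inE => -[v0 v1]; split=> [j|]; first by rewrite mxE sumr_ge0.
rewrite -v1 [RHS](partition_big f predT)//=.
by apply: eq_bigr => j _; rewrite mxE.
Qed.

(* The affine map of simplices with value f on the vertices. *)
Definition vertex_map (v : simplex R m) : simplex R n :=
  exist _ (push (val v)) (push_std (valP v)).

Lemma push_continuous : continuous push.
Proof.
move=> v B [P Pv PB].
have cP i j : nbhs v (fun w => P i j (push w i j)).
  have cpush : continuous (fun w : 'rV[R]_m.+1 => push w i j).
    have -> : (fun w : 'rV[R]_m.+1 => push w i j) =
              (fun w => \sum_(k | f k == j) w ord0 k).
      by apply/funext => w; rewrite !mxE.
    apply: continuous_big => [|k _]; first exact: add_continuous.
    exact: coord_continuous.
  exact: (cpush v (P i j) (Pv i j)).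
have FF : Filter (nbhs v) by exact: nbhs_filter.
have nP : nbhs v (fun w => forall i j, P i j (push w i j)).
  apply: (@filter_forall _ _ (fun i w => forall j, P i j (push w i j)) _ FF) => i.
  by apply: (@filter_forall _ _ (fun j w => P i j (push w i j)) _ FF) => j; exact: cP.
by move: nP; apply: filterS => w Pw; apply: PB.
Qed.

Lemma vertex_map_continuous : continuous vertex_map.
Proof.
apply: continuous_comp_initial => v.
apply: (@continuous_comp _ _ _ _ push v); last exact: push_continuous.
exact: initial_continuous.
Qed.

HB.instance Definition _ := isContinuous.Build _ _ vertex_map vertex_map_continuous.

End VertexMap.

Section Singular.
Variables (R : realType) (X : topologicalType).

Definition singular n := continuousType (simplex R n) X.

(* The face of s with vertices given by f. *)
Definition face m n (s : singular n) (f : 'I_m.+1 -> 'I_n.+1) : singular m :=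
  s \o vertex_map f.

Section Cohomology.
Variable A : nzRingType.

Definition cochain n := singular n -> A.
HB.instance Definition _ n := GRing.Zmodule.on (cochain n).

Definition delta n (c : cochain n) : cochain n.+1 :=
  fun s => \sum_(i < n.+2) (-1) ^+ i * c (face s (lift i)).

Lemma deltaB n : zmod_morphism (@delta n).
Proof.
move=> c d; apply/funext => s.
have -> : (delta c - delta d) s = delta c s - delta d s by [].
rewrite /delta -sumrB.
by apply: eq_bigr => i _; rewrite -mulrBr.
Qed.
HB.instance Definition _ n := GRing.isZmodMorphism.Build _ _ (@delta n) (@deltaB n).

Definition cocycle_pred n : {pred cochain n} := fun c => delta c == 0.
Lemma cocycle_zmod_closed n : zmod_closed (@cocycle_pred n).
Proof.
split=> [|c d]; rewrite !unfold_in /cocycle_pred ?raddf0 //.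
by move=> /eqP c0 /eqP d0; rewrite raddfB /= c0 d0 subr0.
Qed.
HB.instance Definition _ n :=
  GRing.isZmodClosed.Build _ (@cocycle_pred n) (@cocycle_zmod_closed n).

Definition cocycle n := {c : cochain n | c \in @cocycle_pred n}.
HB.instance Definition _ n := SubChoice.on (cocycle n).
HB.instance Definition _ n := [SubChoice_isSubZmodule of cocycle n by <:].

Definition coboundaries n : set (cochain n) :=
  match n with
  | 0 => [set 0]
  | m.+1 => range (@delta m)
  end.

Definition coboundary_pred n : {pred cocycle n} :=
  fun z => val z \in @coboundaries n.
Lemma coboundary_zmod_closed n : zmod_closed (@coboundary_pred n).
Proof.
case: n => [|n]; split=> [|c d]; rewrite !unfold_in /coboundary_pred ?inE //=.
- by move=> -> ->; rewrite subr0.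
- by exists 0 => //; rewrite raddf0.
- by move=> [b _ <-] [e _ <-]; exists (b - e) => //; rewrite raddfB.
Qed.
HB.instance Definition _ n := GRing.isZmodClosed.Build _
  (@coboundary_pred n) (@coboundary_zmod_closed n).

Definition cohomology n := Quotient.quot (@coboundary_pred n).
HB.instance Definition _ n := GRing.Zmodule.on (cohomology n).

Definition coh_class n (z : cocycle n) : cohomology n :=
  \pi_(Quotient.quot (@coboundary_pred n)) z.
Definition coh_repr n (x : cohomology n) : cocycle n := repr x.

Lemma coh_reprK n : cancel (@coh_repr n) (@coh_class n).
Proof. exact: reprK. Qed.

Lemma coh_classP n (z w : cocycle n) :
  coh_class z = coh_class w <-> coboundaries (val z - val w).
Proof.
have E : coh_class z == coh_class w = (z - w \in @coboundary_pred n).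
  by rewrite Quotient.idealrBE.
rewrite unfold_in /coboundary_pred in E.
by split=> [/eqP|h]; [|apply/eqP]; rewrite E; [rewrite inE|apply/mem_set].
Qed.

End Cohomology.
End Singular.

Section Functoriality.
Variables (R : realType) (X : topologicalType).

Lemma eq_face m n (s : singular R X n) (f g : 'I_m.+1 -> 'I_n.+1) :
  f =1 g -> face s f = face s g.
Proof. by move=> /funext ->. Qed.

Lemma face_face l m n (s : singular R X n) (f : 'I_m.+1 -> 'I_n.+1)
    (g : 'I_l.+1 -> 'I_m.+1) : face (face s f) g = face s (f \o g).
Proof.
apply/continuousEP => v; rewrite /face /=; congr (s _); apply: val_inj => /=.
apply/rowP => j; rewrite !mxE (partition_big g (fun k => f k == j)) //=.
apply: eq_bigr => k /eqP fk; rewrite !mxE; apply: eq_bigl => i.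
by case: eqVneq => [->|]; rewrite ?fk ?eqxx ?andbF.
Qed.

Section DeltaDelta.
Variable A : nzRingType.

Lemma delta_delta n (c : cochain R X A n) : delta (delta c) = 0.
Proof.
apply/funext => s; rewrite /delta.
pose T (p : 'I_n.+3 * 'I_n.+2) : A :=
  (-1) ^+ (p.1 + p.2) * c (face s (lift p.1 \o lift p.2)).
transitivity (\sum_p T p).
  transitivity (\sum_i \sum_j T (i, j)); last by rewrite pair_bigA; apply: eq_bigr => -[].
  apply: eq_bigr => i _; rewrite big_distrr /=.
  by apply: eq_bigr => j _; rewrite /T /= exprD mulrA face_face.
rewrite (bigID (fun p : 'I_n.+3 * 'I_n.+2 => (p.2 < p.1)%N)) /=.
pose h (p : 'I_n.+3 * 'I_n.+2) : 'I_n.+3 * 'I_n.+2 := (inord p.2, inord p.1.-1).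
pose h' (p : 'I_n.+3 * 'I_n.+2) : 'I_n.+3 * 'I_n.+2 := (inord p.2.+1, inord p.1).
rewrite [X in _ + X](reindex_onto h h') /=; last first.
  move=> [i j] /=; rewrite -leqNgt => ij; congr (_, _); apply: val_inj => /=;
  have := ltn_ord i; have := ltn_ord j => ? ?; rewrite !inordK //; lia.
rewrite [X in _ + X](eq_bigl (fun p : 'I_n.+3 * 'I_n.+2 => (p.2 < p.1)%N)).
  rewrite -big_split big1 //= => -[i j] /= ji.
  have := ltn_ord i; have := ltn_ord j => ? ?; rewrite /T /= !inordK; [|lia..].
  have -> : face s (lift (inord j : 'I_n.+3) \o lift (inord i.-1 : 'I_n.+2)) =
            face s (lift i \o lift j).
    apply: eq_face => k; apply: val_inj => /=.
    by rewrite !inordK; [exact: bump_bump|lia..].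
  have -> : (i + j = (j + i.-1).+1)%N by lia.
  by rewrite exprS mulN1r mulNr addNr.
move=> [i j] /=; have := ltn_ord i; have := ltn_ord j => ? ?.
apply/idP/idP => [/andP[]|ji].
  rewrite -leqNgt => l /eqP[] /(congr1 val) /= + _; move: l.
  by rewrite !inordK; lia.
rewrite !inordK; [|lia..]; apply/andP; split; first by lia.
by apply/eqP; congr (_, _); apply: val_inj; rewrite /= !inordK; lia.
Qed.

End DeltaDelta.

Lemma delta_red n (c : cochain R X int n) :
  delta (fun s => (c s)%:~R : 'F_2) = (fun s => (delta c s)%:~R).
Proof.
apply/funext => s; rewrite /delta rmorph_sum; apply: eq_bigr => i _.
by rewrite rmorphM rmorphXn rmorphN1.
Qed.

Lemma delta_mul2 n (c : cochain R X int n) :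
  delta (fun s => 2 * c s) = (fun s => 2 * delta c s).
Proof.
apply/funext => s; rewrite /delta big_distrr /=.
by apply: eq_bigr => i _; rewrite mulrCA.
Qed.

End Functoriality.

Section SteenrodSquares.
Variables (R : realType) (X : topologicalType).

(* Steenrod's cup-i product of a p-cochain and a q-cochain mod 2, in degree
   N = p + q - i.  A set S of i+1 vertices j_0 < ... < j_i of the N-simplex
   determines the faces
     even_part S = [0, j_0] u [j_1, j_2] u [j_3, j_4] u ...
     odd_part S  = [j_0, j_1] u [j_2, j_3] u ...
   and the sum runs over those S for which they have dimension p and q. These
   two conditions force #|S| = p + q + 1 - N, so the product is 0 when
   N > p + q. *)
Definition cup p q N (x : cochain R X 'F_2 p) (y : cochain R X 'F_2 q) :
    cochain R X 'F_2 N :=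
  fun s => \sum_(S : {set 'I_N.+1} |
                 (#|even_part S| == p.+1) && (#|odd_part S| == q.+1))
     x (face s (vertex_enum (even_part S))) * y (face s (vertex_enum (odd_part S))).

Arguments cup {p q} N x y _.

(* Sq^k c is the cup-(n-k) product of c with itself. *)
Definition steenrod_sq k n (c : cochain R X 'F_2 n) : cochain R X 'F_2 (k + n) :=
  cup (k + n) c c.
Arguments steenrod_sq k {n} c _.

Lemma sq1E n (c : cochain R X 'F_2 n) s :
  steenrod_sq 1 c s =
  \sum_(p : 'I_n.+2 * 'I_n.+2 | (p.1 < p.2)%N && (odd p.1 == odd p.2))
     c (face s (lift p.1)) * c (face s (lift p.2)).
Proof.
pose d (S : {set 'I_n.+2}) := c (face s (vertex_enum S)).
rewrite /steenrod_sq /cup (sum_parts d); apply: eq_bigr => p _.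
by rewrite /d !(eq_face s (vertex_enumC1 _)).
Qed.

Lemma F2_bool (x : 'F_2) : x = (x != 0)%:R.
Proof. by case: x => -[|[|]] //= i; apply: val_inj. Qed.

Lemma F2_int (k : int) : (k%:~R == 0 :> 'F_2) = (2 %| k)%Z.
Proof. by rewrite (dvdz_pcharf (pchar_Fp (isT : prime 2))). Qed.

Definition lift01 n (c : cochain R X 'F_2 n) : cochain R X int n :=
  fun s => (c s != 0)%:Z.

Lemma lift01K n (c : cochain R X 'F_2 n) s : (lift01 c s)%:~R = c s.
Proof. by rewrite [RHS]F2_bool. Qed.

(* Sq^1 is the Bockstein of c, already on cochains. *)
Lemma sq1_bockstein n (c : cochain R X 'F_2 n) : delta c = 0 ->
  exists2 a : cochain R X int n.+1,
    delta (lift01 c) = (fun s => 2 * a s) &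
    steenrod_sq 1 c = (fun s => (a s)%:~R).
Proof.
move=> dc.
have d2 s : (2 %| delta (lift01 c) s)%Z.
  rewrite -F2_int -[_%:~R]/((fun s => (delta (lift01 c) s)%:~R : 'F_2) s) -delta_red.
  have -> : (fun s => (lift01 c s)%:~R : 'F_2) = c by apply/funext => t; rewrite lift01K.
  by rewrite dc.
exists (fun s => (delta (lift01 c) s %/ 2)%Z).
  by apply/funext => s; rewrite mulrC divzK.
apply/funext => s; set k := (_ %/ 2)%Z.
have Ek : delta (lift01 c) s = 2 * k by rewrite /k mulrC divzK.
pose b i := c (face s (lift (inord i : 'I_n.+2))) != 0.
have Eb (i : 'I_n.+2) : c (face s (lift i)) = (b i)%:R.
  by rewrite [LHS]F2_bool /b inord_val.
have /alt_sum_pairs : \sum_(0 <= i < n.+2) (-1) ^+ i * (b i)%:Z = 2 * k.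
  rewrite -Ek big_mkord /delta; apply: eq_bigr => i _.
  by rewrite /lift01 /b inord_val.
rewrite -F2_int rmorphB /= subr_eq0 => /eqP->; rewrite sq1E.
rewrite -pmulrn big_mkord natr_sum.
rewrite (eq_bigl (fun p : 'I_n.+2 * 'I_n.+2 => predT p.1 && ((p.1 < p.2)%N && (odd p.1 == odd p.2)))) //.
rewrite -(pair_big_dep predT (fun i j : 'I_n.+2 => (i < j)%N && (odd i == odd j))
  (fun i j : 'I_n.+2 => c (face s (lift i)) * c (face s (lift j)))) /=.
rewrite (exchange_big_dep predT) //=; apply: eq_bigr => j _.
rewrite big_mkord natr_sum (big_ord_widen_cond n.+2 (fun i => odd i == odd j)
   (fun i => (b i * b j)%:R)) 1?ltnW //.
by apply: eq_big => [i|i _]; rewrite ?natrM ?Eb // andbC.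
Qed.

Lemma sq1_cocycle n (z : cocycle R X 'F_2 n) :
  steenrod_sq 1 (val z) \in @cocycle_pred R X 'F_2 n.+1.
Proof.
case: z => c /= /eqP dc; have [a da ->] := sq1_bockstein dc.
have : delta (delta (lift01 c)) = 0 by exact: delta_delta.
rewrite da delta_mul2 => d0; rewrite unfold_in /cocycle_pred delta_red.
apply/eqP/funext => s; have /(congr1 (fun f => f s)) /= := d0.
by move=> /eqP; rewrite mulf_eq0 /= => /eqP ->.
Qed.

Definition Sq1_cocycle n (z : cocycle R X 'F_2 n) : cocycle R X 'F_2 n.+1 :=
  exist _ (steenrod_sq 1 (val z)) (sq1_cocycle z).

(* The operation induced on cohomology classes. It is computed from a chosen
   representing cocycle, but does not depend on it: see Sq1_class. *)
Definition Sq1 n (x : cohomology R X 'F_2 n) : cohomology R X 'F_2 n.+1 :=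
  coh_class (Sq1_cocycle (coh_repr x)).

Lemma sq1_coboundary n (c c' : cochain R X 'F_2 n) :
  delta c = 0 -> coboundaries (c - c') ->
  coboundaries (steenrod_sq 1 c - steenrod_sq 1 c').
Proof.
case: n c c' => [|n] c c' dc.
  by move=> /= /eqP; rewrite subr_eq0 => /eqP->; exists 0; rewrite ?raddf0 ?subrr.
move=> [b _ eb]; have [a da ->] := sq1_bockstein dc.
have dc' : delta c' = 0.
  by have := delta_delta b; rewrite eb raddfB /= dc sub0r => /eqP; rewrite oppr_eq0 => /eqP.
have [a' da' ->] := sq1_bockstein dc'.
pose u : cochain R X int n.+1 := lift01 c - lift01 c' - delta (lift01 b).
have ur s : (u s)%:~R = 0 :> 'F_2.
  have -> : u s = lift01 c s - lift01 c' s - delta (lift01 b) s by [].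
  rewrite !rmorphB /= !lift01K.
  rewrite -[X in _ - X]/((fun s => (delta (lift01 b) s)%:~R : 'F_2) s) -delta_red.
  have -> : (fun s => (lift01 b s)%:~R : 'F_2) = b by apply/funext => t; rewrite lift01K.
  by rewrite eb -[(c - c') s]/(c s - c' s) subrr.
pose v : cochain R X int n.+1 := fun s => (u s %/ 2)%Z.
have uv : u = fun s => 2 * v s.
  by apply/funext => s; rewrite mulrC divzK // -F2_int ur.
exists (fun s => (v s)%:~R) => //; rewrite delta_red; apply/funext => s.
rewrite -[RHS]/((a s)%:~R - (a' s)%:~R) -rmorphB; congr _%:~R.
have : delta u s = 2 * (a s - a' s).
  rewrite /u !raddfB /= delta_delta subr0 da da' mulrBr.
  by [].
by rewrite uv delta_mul2 => /(mulfI (isT : (2 : int) != 0)).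
Qed.

Lemma Sq1_class n (z : cocycle R X 'F_2 n) :
  Sq1 (coh_class z) = coh_class (Sq1_cocycle z).
Proof.
apply/coh_classP/sq1_coboundary; first exact: (eqP (valP (coh_repr _))).
exact/coh_classP/coh_reprK.
Qed.

End SteenrodSquares.

(* An abstract simplicial complex whose vertex set is all of 'I_m. *)
Definition simplicial_complex m (K : {set {set 'I_m}}) : Prop :=
  [/\ finset.set0 \in K,
      forall s t : {set 'I_m}, s \in K -> t \subset s -> t \in K &
      forall i : 'I_m, [set i]%SET \in K].

Section MomentAngle.
Variable R : realType.

(* Row i of a point of (X, Y)^K is its i-th coordinate. *)
Definition polyhedral_product d (X Y : set 'rV[R]_d) m (K : {set {set 'I_m}}) :
    set 'M[R]_(m, d) :=
  \bigcup_(s in [set` K]) [set z | forall i, (if i \in s then X else Y) (row i z)].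

Definition disk2 : set 'rV[R]_2 := [set v | \sum_i v ord0 i ^+ 2 <= 1].
Definition circle : set 'rV[R]_2 := [set v | \sum_i v ord0 i ^+ 2 = 1].

Definition moment_angle m (K : {set {set 'I_m}}) : topologicalType :=
  set_type (polyhedral_product disk2 circle K).

End MomentAngle.
Arguments moment_angle R {m} K.

(* Main.v *)
(* Cover the moment-angle complex by the open sets on which every coordinate outside some face
   lies in one of three open half-planes. Singular simplices subordinate to this cover compute
   the cohomology (iterated barycentric subdivision). Sending a small simplex to the sectors
   containing its vertices, and a tuple of sectors to the affine simplex on fixed
   representatives, retracted back into the complex, gives a homotopy equivalence with the
   ordered simplicial cochains of the polyhedral product of (triangle, boundary). There, one
   coordinate at a time, the cochains reduce to the span of the cup products over a set J of
   coordinates of the winding cochains w_i (i in J \ s) and their coboundaries (i in s), for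
   the faces s contained in J: up to signs and a degree shift by |J|, the augmented simplicial
   cochains of the full subcomplexes K_J.
   Sq^1 is the Bockstein. In total degree at most 7 it starts from simplicial degree 0 or from
   a K_J with at most 5 vertices, where it vanishes by a finite check. For the 6-vertex
   triangulation of the projective plane it is nonzero from degree 1 + 6 + 1 = 8. *)

From HB Require Import structures.
Require Import Defs.
From mathcomp Require Import all_boot all_order all_algebra.
From mathcomp Require Import zify ring lra.
From mathcomp Require Import all_classical reals topology normedtype.
From mathcomp Require Import sequences realfun.

Set Implicit Arguments.
Unset Strict Implicit.
Unset Printing Implicit Defensive.

Import Order.TTheory GRing.Theory Num.Theory.
Import numFieldNormedType.Exports.
Local Open Scope ring_scope.

(** * Ordered simplicial cochains on tuples *)

(** Every comparison holds only locally: for tuples whose set of coordinates showing all three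
    sectors is a face, and for small singular simplices. Hence cochains are functions on all lists,
    identities are guarded by predicates closed under sublists, and a global statement is recovered
    by a correction that vanishes on small simplices. Tuples may repeat vertices, so no order on the
    sectors is chosen and any map of vertices induces a homotopy. The second obstacle is the
    coefficients: the Bockstein needs integral lifts, whereas a cocycle is closed only mod 2. The
    reduction to words is therefore proved over every commutative ring, applied over ['F_2], and its
    output is lifted to integers piece by piece. A mod 2 coboundary lifts to an integral cocycle, so
    only the word part contributes to the Bockstein. *)

Section TupleCochains.
Variables (A : comNzRingType) (V : eqType).
Implicit Types (f g c : seq V -> A) (x y : seq V) (a b : V).

Fixpoint faces x : seq (seq V) :=
  if x is a :: x' then x' :: map (cons a) (faces x') else [::].

(* This coboundary is augmented: [drec f [:: a] = f [::]]. Ordinary cochains are therefore the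
   [f] with [f [::] = 0], a condition carried by many statements below. *)
Fixpoint drec f x : A :=
  if x is a :: x' then f x' - drec (fun y => f (a :: y)) x' else 0.

Lemma mem_facesS a x y : y \in faces x -> a :: y \in faces (a :: x).
Proof. by move=> yx; rewrite inE map_f ?orbT. Qed.

Lemma sub_faces x y : y \in faces x -> {subset y <= x}.
Proof.
elim: x y => [//|a x IH] y; rewrite inE => /orP[/eqP-> z zx|/mapP[y' /IH s ->] z].
  by rewrite inE zx orbT.
by rewrite !inE => /orP[->//|/s ->]; rewrite orbT.
Qed.

Lemma size_faces x y : y \in faces x -> size x = (size y).+1.
Proof.
elim: x y => [//|a x IH] y; rewrite inE => /orP[/eqP->//|/mapP[y' /IH s ->]].
by rewrite /= s.
Qed.

Lemma eq_drec f g x : {in faces x, f =1 g} -> drec f x = drec g x.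
Proof.
elim: x f g => [//|a x IH] f g fg /=; rewrite fg ?mem_head //; congr (_ - _).
by apply: IH => y yx; apply: fg; apply: mem_facesS.
Qed.

Lemma drec0 x : drec (fun=> 0) x = 0.
Proof. by elim: x => //= a x ->; rewrite subrr. Qed.

Lemma drecD f g x : drec (fun y => f y + g y) x = drec f x + drec g x.
Proof. by elim: x f g => [|a x IH] f g /=; rewrite ?addr0 // IH opprD addrACA. Qed.

Lemma drecZ k f x : drec (fun y => k * f y) x = k * drec f x.
Proof. by elim: x f => [|a x IH] f /=; rewrite ?mulr0 // IH mulrBr. Qed.

Lemma drecN f x : drec (fun y => - f y) x = - drec f x.
Proof. by elim: x f => [|a x IH] f /=; rewrite ?oppr0 // IH opprD. Qed.

Lemma drecB f g x : drec (fun y => f y - g y) x = drec f x - drec g x.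
Proof. by rewrite drecD drecN. Qed.

Lemma drec_drec f x : drec (drec f) x = 0.
Proof.
elim: x f => [//|a x IH] f /=.
by rewrite drecB /= IH subr0 subrr.
Qed.

Lemma drec_eq0 f x : {in faces x, forall y, f y = 0} -> drec f x = 0.
Proof. by move=> f0; rewrite -(drec0 x); apply: eq_drec. Qed.

Lemma drecE f x :
  drec f x = \sum_(i < size x) (-1) ^+ i * f (take i x ++ drop i.+1 x).
Proof.
elim: x f => [|a x IH] f; first by rewrite big_ord0.
rewrite /= big_ord_recl expr0 mul1r take0 drop0 /=; congr (_ + _).
rewrite IH -sumrN; apply: eq_bigr => i _; rewrite /= /bump /= add1n exprS.
by rewrite -mulrA mulN1r.
Qed.

Section Cup.
Variables (w : V -> V -> A).

Definition dw a b b' := w b b' - w a b' + w a b.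

Definition cup1 g x : A :=
  if x is a :: ((b :: _) as y) then w a b * g y else 0.

Definition cup2 g x : A :=
  if x is a :: b :: ((b' :: _) as y) then dw a b b' * g y else 0.

(** The Leibniz rule for a first factor of degree one; [g [::] = 0] removes the augmentation term
    that would appear on an edge. *)
Lemma drec_cup1 g x : g [::] = 0 ->
  drec (cup1 g) x = cup2 g x - cup1 (drec g) x.
Proof.
move=> g0; case: x => [|a [|b [|b' x]]] /=; do ?by rewrite ?g0; ring.
rewrite /dw !drecZ; ring.
Qed.

(** Expanding [drec (drec (cup1 g)) = 0] twice by the Leibniz rule leaves exactly this identity. *)
Lemma drec_cup2 g x : g [::] = 0 -> drec (cup2 g) x = cup2 (drec g) x.
Proof.
move=> g0.
have := drec_drec (cup1 g) x; rewrite (eq_drec (fun y _ => drec_cup1 y g0)) drecB.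
rewrite drec_cup1 // => /eqP; rewrite subr_eq0 => /eqP ->.
rewrite -[RHS]subr0; congr (_ - _).
by case: x => [|a [|b x]] //=; rewrite -[drec _ _ - _]/(drec (drec g) (b :: x)) drec_drec mulr0.
Qed.

Lemma cup1D g h x : cup1 (fun y => g y + h y) x = cup1 g x + cup1 h x.
Proof. by case: x => [|a [|b x]] /=; rewrite ?addr0 // mulrDr. Qed.

Lemma cup2D g h x : cup2 (fun y => g y + h y) x = cup2 g x + cup2 h x.
Proof. by case: x => [|a [|b [|b' x]]] /=; rewrite ?addr0 // mulrDr. Qed.

Lemma eq_cup1 g h x : {in faces x, g =1 h} -> cup1 g x = cup1 h x.
Proof. by case: x => [|a [|b x]] //= gh; rewrite gh // !inE eqxx. Qed.

Lemma eq_cup2 g h x :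
  (forall y, size x = (size y).+2 -> {subset y <= x} -> g y = h y) -> cup2 g x = cup2 h x.
Proof.
case: x => [|a [|b [|b' x]]] //= gh; rewrite gh // => z.
by rewrite inE => /orP[/eqP->|zx]; rewrite !inE ?eqxx ?zx ?orbT.
Qed.

End Cup.

(* The product with a 0-cochain [t]; its coboundary is [cup1 (fun a b => t b - t a)]. *)
Definition cup0 (t : V -> A) g x : A := if x is a :: _ then t a * g x else 0.

Lemma drec_cup0 t g x : g [::] = 0 ->
  drec (cup0 t g) x = cup1 (fun a b => t b - t a) g x + cup0 t (drec g) x.
Proof.
move=> g0; case: x => [|a [|b x]] /=; rewrite ?g0 ?subr0 ?mulr0 ?addr0 //.
by rewrite !drecZ; ring.
Qed.
End TupleCochains.

(** * Prism homotopies between vertex maps *)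

Section Prism.
Variables (A : comNzRingType) (U V : eqType) (f g : U -> V).

Fixpoint prism (c : seq V -> A) (x : seq U) : A :=
  if x is a :: x' then c [:: f a, g a & map g x'] - prism (fun y => c (f a :: y)) x'
  else 0.

(** The tuples on which [prism] evaluates its cochain; through them a hypothesis valid only on some
    domain is carried across a homotopy. *)
Fixpoint mixed (x : seq U) : seq (seq V) :=
  if x is a :: x' then [:: f a, g a & map g x'] :: map (cons (f a)) (mixed x') else [::].

Lemma eq_prism c d x : {in mixed x, c =1 d} -> prism c x = prism d x.
Proof.
elim: x c d => //= a x IH c d cd; rewrite cd ?mem_head //; congr (_ - _).
by apply: IH => y yx; apply: cd; rewrite inE map_f ?orbT.
Qed.

Lemma prism_eq0 c x : {in mixed x, forall y, c y = 0} -> prism c x = 0.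
Proof.
elim: x c => //= a x IH c c0; rewrite c0 ?mem_head // IH ?subr0 // => y yx.
by apply: c0; rewrite inE map_f ?orbT.
Qed.

Lemma mixed_sub y x v : y \in mixed x -> v \in y -> exists2 a, a \in x & (v == f a) || (v == g a).
Proof.
elim: x y => //= a x IH y; rewrite inE => /orP[/eqP->|/mapP[y' /IH I ->]].
  rewrite !inE orbA => /orP[h|/mapP[b bx ->]]; first by exists a; rewrite ?mem_head.
  by exists b; rewrite ?inE ?bx ?eqxx ?orbT.
rewrite inE => /orP[/eqP->|/I[b bx h]]; first by exists a; rewrite ?mem_head ?eqxx.
by exists b; rewrite // inE bx orbT.
Qed.

Lemma size_mixed y x : y \in mixed x -> size y = (size x).+1.
Proof.
elim: x y => //= a x IH y; rewrite inE => /orP[/eqP->|/mapP[y' /IH I ->]] /=.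
  by rewrite size_map.
by rewrite I.
Qed.

Lemma prismD c d x : prism (fun y => c y + d y) x = prism c x + prism d x.
Proof. by elim: x c d => [|a x IH] c d /=; rewrite ?addr0 // IH; ring. Qed.
Lemma prismN c x : prism (fun y => - c y) x = - prism c x.
Proof. by elim: x c => [|a x IH] c /=; rewrite ?oppr0 // IH; ring. Qed.
Lemma prismB c d x : prism (fun y => c y - d y) x = prism c x - prism d x.
Proof. by rewrite prismD prismN. Qed.

Lemma drec_map (h : U -> V) c x : drec c (map h x) = drec (fun y => c (map h y)) x :> A.
Proof. by elim: x c => //= a x IH c; rewrite IH. Qed.

Lemma drec_prism c x :
  drec (prism c) x + prism (drec c) x = c (map g x) - c (map f x).
Proof.
elim: x c => [|a x IH] c /=; first by rewrite subrr addr0.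
have IH1 := IH (fun y => c (f a :: y)).
rewrite drecB prismB drec_map /=.
have -> (p q r s t : A) : p - (q - r) + (s - (t - q) - (p - prism (drec (fun y => c (f a :: y))) x)) =
   s - t + (r + prism (drec (fun y => c (f a :: y))) x) by ring.
rewrite IH1; ring.
Qed.

End Prism.

(** * The circle and the disk *)

(** The form a subcomplex takes here: neither order nor repetition in a tuple matters. *)
Definition sub_closed (V : eqType) (Y : pred (seq V)) :=
  forall x y, {subset y <= x} -> Y x -> Y y.

Notation o0 := (@Ordinal 3 0 isT).
Notation o1 := (@Ordinal 3 1 isT).
Notation o2 := (@Ordinal 3 2 isT).

Lemma ord3P (a : 'I_3) : [\/ a = o0, a = o1 | a = o2].
Proof.
by case: a => [[|[|[|]]]] // i; [constructor 1|constructor 2|constructor 3]; apply: val_inj.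
Qed.

(** The triangle models the disk: a column lies over the boundary circle exactly when it misses a
    vertex. *)
Definition full (l : seq 'I_3) := [&& o0 \in l, o1 \in l & o2 \in l].

Lemma full_sub l l' : {subset l' <= l} -> full l' -> full l.
Proof. by move=> s /and3P[a b c]; apply/and3P; split; apply: s. Qed.

Section CircleDisk.
Variables (A : comNzRingType) (V : eqType).
Implicit Types (x : seq ('I_3 * V)).

(* Restricted to tuples missing one of the three values, [wind] generates the first
   cohomology of the boundary of the triangle. *)
Definition wind (p q : 'I_3 * V) : A :=
  if (p.1 == o0) && (q.1 == o1) then 1
  else if (p.1 == o1) && (q.1 == o0) then -1 else 0.

Lemma dw_full p q r : ~~ full [:: p.1; q.1; r.1] -> dw wind p q r = 0.
Proof.
rewrite /dw /wind.
by case: (ord3P p.1) => ->; case: (ord3P q.1) => ->; case: (ord3P r.1) => -> //= _; ring.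
Qed.

Lemma cup2_nfull (g : seq ('I_3 * V) -> A) x : ~~ full (unzip1 x) -> cup2 wind g x = 0.
Proof.
case: x => [|p [|q [|r x]]] //= nf; rewrite dw_full ?mul0r //.
apply: contra nf; apply: full_sub => i; rewrite !inE.
by case/or3P => ->; rewrite ?orbT.
Qed.

Definition pull (b : seq V -> A) x := b (unzip2 x).

Lemma drec_pull b x : drec (pull b) x = drec b (unzip2 x).
Proof. by rewrite /unzip2 (drec_map snd b). Qed.

Definition setc (i : 'I_3) (y : seq V) : seq ('I_3 * V) := map (pair i) y.
Lemma unzip2_setc i y : unzip2 (setc i y) = y.
Proof. by rewrite /unzip2 -map_comp map_id. Qed.
Lemma unzip1_setc i y : unzip1 (setc i y) = nseq (size y) i.
Proof. by elim: y => //= a y ->. Qed.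

Lemma sub_unzip1 x (y : seq ('I_3 * V)) : {subset y <= x} -> {subset unzip1 y <= unzip1 x}.
Proof. by move=> s i /mapP[p py ->]; apply: map_f; apply: s. Qed.
Lemma sub_unzip2 x (y : seq ('I_3 * V)) : {subset y <= x} -> {subset unzip2 y <= unzip2 x}.
Proof. by move=> s i /mapP[p py ->]; apply: map_f; apply: s. Qed.

Lemma setcK i x : all (pred1 i) (unzip1 x) -> x = setc i (unzip2 x).
Proof. by elim: x => //= -[j v] x IH /= /andP[/eqP-> h]; rewrite -IH. Qed.

Definition onfst (f : 'I_3 -> 'I_3) (p : 'I_3 * V) := (f p.1, p.2).

Lemma unzip2_onfst f x : unzip2 (map (onfst f) x) = unzip2 x.
Proof. by rewrite /unzip2 -map_comp. Qed.
Lemma unzip1_onfst f x : unzip1 (map (onfst f) x) = map f (unzip1 x).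
Proof. by rewrite /unzip1 -!map_comp. Qed.
Lemma onfst_cst i x : map (onfst (fun=> i)) x = setc i (unzip2 x).
Proof. by elim: x => //= -[j v] x ->. Qed.

Section Y.
Variable (Y : pred (seq V)).
Hypothesis Yc : sub_closed Y.
Let dom (S : pred 'I_3) x := all S (unzip1 x) && Y (unzip2 x).

Let dom_closed S : sub_closed (dom S).
Proof.
move=> x y s /andP[/allP aS yY]; apply/andP; split; last exact: Yc (sub_unzip2 s) yY.
by apply/allP => i /(sub_unzip1 s)/aS.
Qed.

(** The prism between the identity and a self-map of [S] never leaves the tuples over [S]. There [c]
    is closed, so only the coboundary term of the homotopy formula survives. *)
Lemma contig (S : pred 'I_3) f (c : seq ('I_3 * V) -> A) x :
  {homo f : i / S i} -> (forall z, dom S z -> drec c z = 0) ->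
  dom S x -> c (map (onfst f) x) - c x = drec (prism id (onfst f) c) x.
Proof.
move=> fS c0 dx; have := drec_prism id (onfst f) c x; rewrite map_id => <-.
rewrite [X in _ + X]prism_eq0 ?addr0 // => y yx.
have h v : v \in y -> exists2 a, a \in x & (v == a) || (v == onfst f a).
  exact: mixed_sub.
have /andP[/allP Sx Yx] := dx.
apply: c0; apply/andP; split.
  apply/allP => i /mapP[p /h[a ax /orP[]/eqP-> ->]]; last apply: fS; apply: Sx; exact: (map_f fst ax).
apply: Yc Yx => i /mapP[p /h[a ax /orP[]/eqP-> ->]]; exact: (map_f snd ax).
Qed.

Let S02 := [pred i : 'I_3 | i != o1].
Let S12 := [pred i : 'I_3 | i != o0].
Let S01 := [pred i : 'I_3 | i != o2].

Lemma nfull_dom x : ~~ full (unzip1 x) =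
  [|| all S02 (unzip1 x), all S12 (unzip1 x) | all S01 (unzip1 x)].
Proof.
have H j : (j \notin unzip1 x) = all (fun i => i != j) (unzip1 x).
  apply/idP/allP => [nj i ix|h]; first by apply: contraNneq nj => <-.
  by apply/negP => /h; rewrite eqxx.
by rewrite /full !negb_and !H orbCA.
Qed.

(** The path consists of the two edges at [o2]. Folding [o1] onto [o2] preserves each of them, and
    the remaining edge contracts to [o0], where [c] vanishes. *)
Lemma path_contract (c : seq ('I_3 * V) -> A) :
  (forall x, dom S02 x || dom S12 x -> drec c x = 0) ->
  (forall y, Y y -> c (setc o0 y) = 0) ->
  exists2 u, u [::] = 0 & forall x, dom S02 x || dom S12 x -> c x = drec u x.
Proof.
move=> c0 cz; pose f (i : 'I_3) := if i == o1 then o2 else i.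
pose P1 := prism id (onfst f) c; pose P2 := prism id (onfst (fun=> o0)) c.
exists (fun x => - (P2 (map (onfst f) x) + P1 x)); first by rewrite /= addr0 oppr0.
move=> x dx; rewrite drecN drecD.
have E1 : c (map (onfst f) x) - c x = drec P1 x.
  case/orP: dx => dx.
  - by apply: (contig _ _ dx) => [i h|z dz]; [rewrite /f /=; case: ifP => //|rewrite c0 ?dz].
  - by apply: (contig _ _ dx) => [i h|z dz]; [rewrite /f /=; case: ifP => //|rewrite c0 ?dz ?orbT].
have dfx : dom S02 (map (onfst f) x).
  rewrite /dom unzip2_onfst unzip1_onfst; apply/andP; split; last by case/orP: dx => /andP[].
  by apply/allP => i /mapP[j _ ->]; rewrite /f /=; case: ifP => // ->.
have E2 : c (map (onfst (fun=> o0)) (map (onfst f) x)) - c (map (onfst f) x) =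
   drec (fun y => P2 (map (onfst f) y)) x.
  rewrite -drec_map.
  by apply: (contig _ _ dfx) => // z dz; rewrite c0 ?dz.
rewrite -E2 -E1 onfst_cst cz; first by ring.
by case/andP: dfx.
Qed.

(* [c] is first made to vanish over the contractible path through [o2], where [wind] is 0;
   on the remaining edge the winding cochain has the primitive [theta]. *)
Lemma circle_acyclic (a b : seq V -> A) (c : seq ('I_3 * V) -> A) :
  a [::] = 0 -> b [::] = 0 -> c [::] = 0 ->
  (forall y, Y y -> drec a y = 0) -> (forall y, Y y -> drec b y = 0) ->
  (forall x, ~~ full (unzip1 x) -> Y (unzip2 x) ->
     pull a x + cup1 wind (pull b) x = drec c x) ->
  exists a' b' c',
    [/\ [/\ a' [::] = 0, b' [::] = 0 & c' [::] = 0 :> A],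
        (forall y, Y y -> a y = drec a' y), (forall y, Y y -> b y = - drec b' y) &
        forall x, ~~ full (unzip1 x) -> Y (unzip2 x) ->
         c x = pull a' x + cup1 wind (pull b') x + drec c' x].
Proof.
move=> a0 b0 c0 da db E.
pose dI x := dom S02 x || dom S12 x.
have w0 g x : dI x -> cup1 wind g x = 0 :> A.
  case: x => [|p [|q x]] //= /orP[] /andP[/= /and3P[Sp Sq _] _]; rewrite /wind;
  by case: (ord3P p.1) Sp => ->; case: (ord3P q.1) Sq => -> //=; rewrite mul0r.
have E' x : dI x || dom S01 x -> pull a x + cup1 wind (pull b) x = drec c x.
  by rewrite -orbA => /or3P[] /andP[d y]; apply: E; rewrite // nfull_dom d ?orbT.
have dI0 y : Y y -> dI (setc o0 y).
  move=> yY; rewrite /dI /dom unzip1_setc unzip2_setc yY andbT.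
  by rewrite (_ : all S02 _) //; apply/allP => i /nseqP[->].
have d010 y : Y y -> dom S01 (setc o0 y).
  by move=> yY; rewrite /dom unzip1_setc unzip2_setc yY andbT; apply/allP => i /nseqP[->].
have d011 y : Y y -> dom S01 (setc o1 y).
  by move=> yY; rewrite /dom unzip1_setc unzip2_setc yY andbT; apply/allP => i /nseqP[->].
have dI1 y : Y y -> dI (setc o1 y).
  move=> yY; rewrite /dI /dom unzip1_setc unzip2_setc yY !andbT.
  by apply/orP; right; apply/allP => i /nseqP[->].
have dIC : sub_closed dI.
  by move=> x y s /orP[]/(dom_closed s) d; rewrite /dI d ?orbT.
pose a' y := c (setc o0 y).
have Da y : Y y -> a y = drec a' y.
  move=> yY; rewrite -drec_map -E' ?dI0 // w0 ?dI0 // addr0.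
  by rewrite /pull unzip2_setc.
pose c1 x := c x - pull a' x.
have Dc1 x : dI x || dom S01 x -> drec c1 x = cup1 wind (pull b) x.
  move=> dx; rewrite drecB -E' // drec_pull -Da; first by rewrite /pull; ring.
  by move: dx => /orP[/orP[]|] /andP[].
have [u u0 Eu] : exists2 u, u [::] = 0 & forall x, dI x -> c1 x = drec u x.
  apply: (@path_contract c1) => [x dx|y yY]; first by rewrite Dc1 ?w0 // /dI dx.
  by rewrite /c1 /pull unzip2_setc /a' subrr.
pose c2 x := c1 x - drec u x.
have c2I x : dI x -> c2 x = 0 by move=> dx; rewrite /c2 Eu ?subrr.
pose theta (p : 'I_3 * V) : A := if p.1 == o1 then 1 else 0.
have Ew g x : dom S01 x -> cup1 (fun p q => theta q - theta p) g x = cup1 wind g x.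
  case: x => [|p [|q x]] //= /andP[/= /and3P[Sp Sq _] _]; congr (_ * _); rewrite /wind /theta.
  by case: (ord3P p.1) Sp => ->; case: (ord3P q.1) Sq => -> //= _ _; ring.
pose g x := c2 x - cup0 theta (pull b) x.
have Dg x : dom S01 x -> drec g x = 0.
  move=> dx; rewrite drecB [X in X - _](drecB c1) drec_drec subr0 Dc1 ?dx ?orbT // drec_cup0 // Ew //.
  rewrite opprD addrA subrr sub0r.
  case: x dx => [|p x] dx; rewrite /= ?oppr0 // -[pull b x - _]/(drec (pull b) (p :: x)).
  by rewrite drec_pull db ?mulr0 ?oppr0 //; case/andP: dx.
pose v := prism id (onfst (fun=> o0)) g.
have g00 y : Y y -> g (setc o0 y) = 0.
  move=> yY; rewrite /g c2I ?dI0 // sub0r.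
  by case: y yY => [|p y] yY; rewrite /= ?mul0r oppr0.
have Ev x : dom S01 x -> g x = - drec v x.
  move=> dx; rewrite -(contig (f := fun=> o0) _ Dg dx) // onfst_cst g00 ?sub0r ?opprK //.
  by case/andP: dx.
(* Over [o1] the function [theta] is 1 and [c2] is 0, so there [v] is a primitive of [b]. *)
pose b' y := - v (setc o1 y).
have v0 y : Y y -> v (setc o0 y) = 0.
  move=> yY; apply: prism_eq0 => z zm.
  have h p : p \in z -> exists2 q, q \in y & p = (o0, q).
    by move=> /(mixed_sub zm)[q /mapP[r ry ->]] /orP[]/eqP->; exists r.
  have -> : z = setc o0 (unzip2 z).
    by apply: setcK; apply/allP => i /mapP[p /h[q _ ->] ->].
  by apply: g00; apply: Yc yY => q /mapP[p /h[r ry ->] ->].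
have Db y : Y y -> b y = - drec b' y.
  move=> yY; rewrite /b' drecN opprK.
  have := Ev _ (d011 _ yY); rewrite drec_map /g c2I ?dI1 // sub0r => /oppr_inj <-.
  case: y yY => [|p y] yY //=; rewrite mul1r.
  by rewrite /pull /= unzip2_setc.
(* This vanishes over both ends of the edge, which is why extending it by zero to the other two
   edges is compatible with [drec]. *)
pose c3 x := if all S01 (unzip1 x) then - v x - cup0 theta (pull b') x else 0.
have c3I x : dI x -> c3 x = 0.
  rewrite /c3; case: ifP => // h dx.
  have /orP[] : all (pred1 o0) (unzip1 x) || all (pred1 o1) (unzip1 x).
    apply/orP; case/orP: dx => /andP[/allP k _]; [left|right]; apply/allP => i ix;
    by have := allP h i ix; have := k i ix; case: (ord3P i) => ->.
  - move=> /setcK->; rewrite v0; last by case/orP: dx => /andP[].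
    by case: (unzip2 x) => [|p y] /=; rewrite ?mul0r ?subr0 ?oppr0.
  - move=> /setcK->; case: (unzip2 x) => [|p y] /=; first by rewrite !subr0 ?oppr0.
    by rewrite mul1r /pull /= unzip2_setc /b' /= opprK addNr.
have Y0 x : dI x || dom S01 x -> Y (unzip2 x) by move=> /orP[/orP[]|] /andP[].
exists a', b', (fun x => u x + c3 x); split=> //.
  split; rewrite /a' /b' //= ?oppr0 // u0 add0r /c3 /=.
  by rewrite ?oppr0 ?addr0.
move=> x nf Yx.
have -> : c x = pull a' x + drec u x + c2 x by rewrite /c2 /c1; ring.
have dx : dI x || dom S01 x by move: nf; rewrite nfull_dom /dI /dom Yx !andbT orbA.
rewrite drecD -!addrA; congr (_ + _); rewrite [RHS]addrCA; congr (_ + _).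
case/orP: dx => dx.
  rewrite c2I // w0 // add0r drec_eq0 // => z /sub_faces s; apply: c3I; exact: dIC dx.
have -> : drec c3 x = drec (fun x => - v x - cup0 theta (pull b') x) x.
  apply: eq_drec => z /sub_faces s; rewrite /c3.
  by have /andP[->] := dom_closed s dx.
rewrite drecB drecN -Ev // /g drec_cup0 ?Ew //; last by rewrite /pull /b' /= oppr0.
have -> : cup0 theta (drec (pull b')) x = - cup0 theta (pull b) x.
  case: x dx {nf Yx} => [|p x] dx; rewrite /= ?oppr0 // -[pull b' x - _]/(drec (pull b') (p :: x)).
  rewrite drec_pull -mulrN; congr (_ * _).
  by rewrite /pull Db ?opprK //; case/andP: dx.
ring.
Qed.

(* The pair (disk, circle) is a suspension of the circle, since the disk is contractible. *)
Lemma disk_acyclic (b : seq V -> A) (c : seq ('I_3 * V) -> A) :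
  b [::] = 0 -> c [::] = 0 ->
  (forall y, Y y -> drec b y = 0) ->
  (forall x, ~~ full (unzip1 x) -> Y (unzip2 x) -> c x = 0) ->
  (forall x, Y (unzip2 x) -> cup2 wind (pull b) x = drec c x) ->
  exists b' c',
    [/\ b' [::] = 0 /\ c' [::] = 0 :> A,
        (forall y, Y y -> b y = drec b' y),
        (forall x, ~~ full (unzip1 x) -> Y (unzip2 x) -> c' x = 0) &
        forall x, Y (unzip2 x) -> c x = cup2 wind (pull b') x + drec c' x].
Proof.
move=> b0 c0 db cC E.
have YC x y : {subset y <= x} -> Y (unzip2 x) -> Y (unzip2 y).
  by move=> s; apply: Yc; apply: sub_unzip2.
have cupd g h x : (forall y, Y y -> drec g y = h y) -> Y (unzip2 x) ->
    cup1 wind (drec (pull g)) x = cup1 wind (pull h) x.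
  move=> gh yx; apply: eq_cup1 => z /sub_faces s; rewrite drec_pull gh //; exact: YC yx.
pose g x := c x - cup1 wind (pull b) x.
have Dg x : Y (unzip2 x) -> drec g x = 0.
  move=> yx; rewrite drecB drec_cup1 // (cupd _ (fun=> 0)) // -E // opprB addrC subrK.
  by case: x {yx} => [|p [|q x]] //=; rewrite /pull mulr0.
pose u := prism id (onfst (fun=> o0)) g.
have Eu x : Y (unzip2 x) -> g x = - drec u x.
  move=> yx; have := contig (S := predT) (f := fun=> o0) (c := g) (x := x).
  rewrite -/u => <- //; last by rewrite /dom all_predT.
    rewrite onfst_cst (_ : g (setc _ _) = 0) ?sub0r ?opprK // /g cC ?unzip2_setc //; last first.
      by rewrite unzip1_setc; apply/negP => /and3P[_ /nseqP[]].
    by case: (unzip2 x) => [|p [|q y]] /=; rewrite ?mul0r subr0.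
  by move=> z /andP[_ yz]; apply: Dg.
(* On the circle [c] vanishes, so the product of [wind] and [b] equals the coboundary of [u] there:
   the hypothesis of [circle_acyclic] with [a] zero. *)
have [|||y _|//||a' [b' [c' [[a'0 b'0 c'0] Ea Eb Ec]]]] :=
    @circle_acyclic (fun=> 0) b u; rewrite ?drec0 //.
  move=> x nf yx; rewrite -[RHS]opprK -Eu // /g cC // sub0r opprK.
  by rewrite /pull add0r.
exists (fun y => - b' y), (fun x => - (u x - pull a' x - cup1 wind (pull b') x - drec c' x)).
split.
- by split; rewrite ?b'0 ?oppr0 // /u /pull /= a'0 ?(subr0, oppr0, addr0).
- by move=> y yY; rewrite drecN Eb.
- by move=> x nf yx; rewrite Ec //; ring.
move=> x yx; rewrite drecN !drecB drec_drec subr0 drec_pull -Ea // subr0.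
rewrite drec_cup1 // (cupd _ (fun y => - b y)); last 2 first.
- by move=> y yY; rewrite Eb ?opprK.
- by [].
have -> : drec u x = - g x by rewrite Eu ?opprK.
have -> : cup2 wind (pull (fun y => - b' y)) x = - cup2 wind (pull b') x.
  by case: x {yx} => [|p [|q [|r x]]] /=; rewrite ?oppr0 // /pull mulrN.
have -> : cup1 wind (pull (fun y => - b y)) x = - cup1 wind (pull b) x.
  by case: x {yx} => [|p [|q x]] /=; rewrite ?oppr0 // /pull mulrN.
rewrite /g; ring.
Qed.
End Y.
End CircleDisk.

(** * Reduction to words of cup products *)

Fixpoint row3 (m : nat) : eqType :=
  if m is m'.+1 then ('I_3 * row3 m')%type else unit.

Arguments row3 : simpl never.

(* The head of the result describes the last coordinate [m.-1]. *)
Fixpoint full_cols m : seq (row3 m) -> seq bool :=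
  if m is m'.+1 then fun x => full (unzip1 x) :: @full_cols m' (unzip2 x) else fun=> [::].

(** A simplicial complex, its faces written as indicator words. *)
Definition monotone (K : pred (seq bool)) :=
  forall l l', all2 implb l' l -> K l -> K l'.

Lemma implb_refl l : all2 implb l l.
Proof. by elim: l => //= -[] l ->. Qed.

Lemma monotone_cons K i : monotone K -> monotone (fun l => K (i :: l)).
Proof. by move=> Km l l' h; apply: Km; rewrite /= h; case: i. Qed.

Lemma monotone_head K l : monotone K -> K (true :: l) -> K (false :: l).
Proof. by move=> Km; apply: Km; rewrite /= implb_refl. Qed.

Lemma full_cols_sub m K (x y : seq (row3 m)) : monotone K -> {subset y <= x} ->
  K (full_cols x) -> K (full_cols y).
Proof.
move=> Km s; apply: Km; elim: m x y s => //= m IH x y s.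
rewrite IH ?andbT; last by apply: sub_unzip2.
by apply/implyP; apply: full_sub; apply: sub_unzip1.
Qed.

Definition twos (k : seq (option bool)) := map (pred1 (Some true)) k.

(** The degree of the cup product: 1 for a winding cochain, 2 for its coboundary. *)
Definition wdeg (k : seq (option bool)) := (count isSome k + count id (twos k))%N.

Section Words.
Variable A : comNzRingType.
Implicit Types (b : seq (option bool) -> A) (k : seq (option bool)).

Fixpoint dM b k : A :=
  match k with
  | [::] => 0
  | None :: k' => dM (fun k => b (None :: k)) k'
  | Some false :: k' => - dM (fun k => b (Some false :: k)) k'
  | Some true :: k' => b (Some false :: k') + dM (fun k => b (Some true :: k)) k'
  end.

Lemma eq_dM b b' k : b =1 b' -> dM b k = dM b' k.
Proof.
elim: k b b' => // -[[]|] k IH b b' h /=; first congr (_ + _); last 2 first.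
all: by rewrite ?h // (IH _ _ (fun k => h _)).
Qed.

Lemma dM0 k : dM (fun=> 0) k = 0.
Proof. by elim: k => // -[[]|] k /= ->; rewrite ?oppr0 ?addr0. Qed.

Lemma dMD b b' k : dM (fun k => b k + b' k) k = dM b k + dM b' k.
Proof. by elim: k b b' => [|[[]|] k IH] b b' /=; rewrite ?addr0 ?IH //; ring. Qed.

Lemma dMN b k : dM (fun k => - b k) k = - dM b k.
Proof. by elim: k b => [|[[]|] k IH] b /=; rewrite ?oppr0 ?IH //; ring. Qed.

(* A letter of a word stands for 1 ([None]), the winding cochain of its coordinate
   ([Some false]) or the coboundary of that cochain ([Some true]); a word stands for the
   cup product of its letters and [dM] for the resulting differential. *)
Fixpoint Psi m : (seq (option bool) -> A) -> seq (row3 m) -> A :=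
  if m is m'.+1 then fun b x =>
    pull (Psi (m := m') (fun k => b (None :: k))) x
    + cup1 (@wind _ _) (pull (Psi (m := m') (fun k => b (Some false :: k)))) x
    + cup2 (@wind _ _) (pull (Psi (m := m') (fun k => b (Some true :: k)))) x
  else fun b x => if size x == 1%N then b [::] else 0.

Lemma Psi_nil m b : @Psi m b [::] = 0.
Proof. by elim: m b => //= m IH b; rewrite /pull IH !addr0. Qed.

(** Only words of degree [(size x).-1] contribute, and the letter [Some true] contributes only where
    the column is full. So [b] matters only on words whose [twos] form a face. *)
Lemma eq_Psi_deg m K b b' (x : seq (row3 m)) : monotone K ->
  (forall k, size k = m -> K (twos k) -> (wdeg k).+1 = size x -> b k = b' k) ->
  K (full_cols x) -> Psi b x = Psi b' x.
Proof.
elim: m K b b' x => [|m IH] K b b' x Km h /= Kx.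
  by case: eqP => // sx; rewrite h.
have Kx0 y : {subset y <= x} -> K (false :: full_cols (unzip2 y)).
  move=> s; apply: (full_cols_sub (monotone_cons (i := false) Km) (sub_unzip2 s)).
  by move: Kx; case: full => // /(monotone_head Km).
congr (_ + _ + _).
- apply: (IH (fun l => K (false :: l))) (Kx0 x _) => // [|k sk kK].
    exact: monotone_cons.
  by rewrite size_map => dk; apply: h; rewrite /= ?sk.
- apply: eq_cup1 => y yx; have s := sub_faces yx; have sy := size_faces yx.
  apply: (IH (fun l => K (false :: l))) (Kx0 y s) => // [|k sk kK].
    exact: monotone_cons.
  by rewrite size_map => dk; apply: h; rewrite /= ?sk // sy -dk /wdeg /=; lia.
case fx : (full (unzip1 x)); last by rewrite !cup2_nfull ?fx.
apply: eq_cup2 => y sy s; rewrite fx in Kx.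
have {}Kx : K (true :: full_cols (unzip2 y)).
  by apply: (full_cols_sub (monotone_cons (i := true) Km) (sub_unzip2 s)).
apply: (IH (fun l => K (true :: l))) Kx => // [|k sk kK]; first exact: monotone_cons.
by rewrite size_map => dk; apply: h; rewrite /= ?sk // sy -dk /wdeg /=; lia.
Qed.

Lemma eq_Psi m K b b' (x : seq (row3 m)) : monotone K ->
  (forall k, size k = m -> K (twos k) -> b k = b' k) ->
  K (full_cols x) -> Psi b x = Psi b' x.
Proof. by move=> Km h; apply: eq_Psi_deg => // k sk kK _; apply: h. Qed.

Lemma PsiZ m c b (x : seq (row3 m)) : Psi (fun k => c * b k) x = c * Psi b x.
Proof.
elim: m b x => [|m IH] b x /=; first by case: ifP; rewrite ?mulr0.
rewrite {1}/pull IH.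
by case: x => [|p [|q [|r x]]] /=; rewrite /pull ?IH; ring.
Qed.

Lemma Psi0 m (x : seq (row3 m)) : Psi (fun=> 0) x = 0.
Proof.
elim: m x => [|m IH] x /=; first by case: ifP.
rewrite {1}/pull IH add0r.
by case: x => [|p [|q [|r x]]] /=; rewrite ?add0r // /pull !IH !mulr0 ?addr0.
Qed.

Lemma PsiN m b (x : seq (row3 m)) : Psi (fun k => - b k) x = - Psi b x.
Proof.
elim: m b x => [|m IH] b x /=; first by case: ifP; rewrite ?oppr0.
rewrite {1}/pull IH.
by case: x => [|p [|q [|r x]]] /=; rewrite /pull ?IH; ring.
Qed.

Lemma PsiD m b b' (x : seq (row3 m)) : Psi (fun k => b k + b' k) x = Psi b x + Psi b' x.
Proof.
elim: m b b' x => [|m IH] b b' x /=; first by case: ifP; rewrite ?addr0.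
rewrite {1}/pull IH.
by case: x => [|p [|q [|r x]]] /=; rewrite /pull ?IH; ring.
Qed.

(** The Leibniz rule, letter by letter: differentiating [wind] gives the letter [Some true], and
    passing a letter of odd degree costs a sign. *)
Lemma drec_Psi m b (x : seq (row3 m)) : drec (Psi b) x = Psi (dM b) x.
Proof.
elim: m b x => [|m IH] b x.
  by case: x => [|p [|q [|r x]]] //=; rewrite ?drec0 ?subr0 ?subrr.
rewrite /= !drecD drec_pull IH drec_cup1 ?drec_cup2; try by rewrite /pull /= Psi_nil.
have Ep b' : drec (pull (Psi b')) =1 pull (Psi (dM b')) :> (seq ('I_3 * row3 m) -> A).
  by move=> y; rewrite drec_pull IH.
rewrite (eq_cup1 _ (fun y _ => Ep _ y)) (eq_cup2 _ (fun y _ _ => Ep _ y)).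
have -> : cup1 (@wind A (row3 m)) (pull (Psi (fun k => - dM (fun k0 => b (Some false :: k0)) k))) x =
    - cup1 (@wind A (row3 m)) (pull (Psi (dM (fun k0 => b (Some false :: k0))))) x.
  by case: x => [|p [|q x]] /=; rewrite ?oppr0 // /pull PsiN mulrN.
have -> : cup2 (@wind A (row3 m))
     (pull (Psi (fun k => b (Some false :: k) + dM (fun k0 => b (Some true :: k0)) k))) x =
   cup2 (@wind A (row3 m)) (pull (Psi (fun k0 => b (Some false :: k0)))) x +
   cup2 (@wind A (row3 m)) (pull (Psi (dM (fun k0 => b (Some true :: k0))))) x.
  by case: x => [|p [|q [|r x]]] /=; rewrite ?addr0 // /pull PsiD mulrDr.
by rewrite /pull; ring.
Qed.

(* Acyclicity of the mapping cone of [Psi], i.e. [Psi] is bijective on cohomology. *)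
Lemma Psi_quasi_iso m K b (c : seq (row3 m) -> A) : monotone K -> c [::] = 0 ->
  (forall k, size k = m -> K (twos k) -> dM b k = 0) ->
  (forall x, K (full_cols x) -> Psi b x = drec c x) ->
  exists b' c', [/\ c' [::] = 0,
    (forall k, size k = m -> K (twos k) -> b k = dM b' k) &
    (forall x, K (full_cols x) -> c x = Psi b' x + drec c' x)].
Proof.
elim: m K b c => [|m IH] K b c Km c0 db E.
  have [K0|K0] := boolP (K [::]); last first.
    by exists b, c; split=> //; case=> // _; rewrite /= (negbTE K0).
  (* With no coordinates the space is a point, and prepending [tt] is the cone homotopy. Subtracting
     the value at the point makes the new primitive vanish on the empty tuple. *)
  pose b' (k : seq (option bool)) := c [:: tt].
  pose g x := c x - @Psi 0 b' x.
  exists b', (fun x => g (tt :: x)); split.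
  - by rewrite /g /= subrr.
  - by case=> // _ _ /=; have := E [:: tt] K0; rewrite /= c0 subr0.
  move=> x _; have : drec g (tt :: x) = 0.
    rewrite drecB drec_Psi -E // [Psi b _]/= [Psi (dM b') _]/=.
    have -> : b [::] = 0 by have := E [:: tt] K0; rewrite /= c0 subr0.
    by rewrite subrr.
  by move=> /eqP; rewrite /= subr_eq0 => /eqP <-; rewrite /g addrC subrK.
(* [K0] is the complex with this vertex deleted and [K1] is its link: the space is the circle over
   [K0] glued to the disk over [K1]. *)
pose K0 l := K (false :: l); pose K1 l := K (true :: l).
have K0m : monotone K0 by exact: monotone_cons.
have K1m : monotone K1 by exact: monotone_cons.
have K10 l : K1 l -> K0 l by apply: monotone_head.
pose b0 k := b (None :: k); pose b1 k := b (Some false :: k); pose b2 k := b (Some true :: k).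
have db0 k : size k = m -> K0 (twos k) -> dM b0 k = 0.
  by move=> sk kK; apply: (db (None :: k)) => //=; rewrite sk.
have db1 k : size k = m -> K0 (twos k) -> dM b1 k = 0.
  move=> sk kK; apply/eqP; rewrite -oppr_eq0; apply/eqP.
  by apply: (db (Some false :: k)) => //=; rewrite sk.
have db2 k : size k = m -> K1 (twos k) -> b1 k + dM b2 k = 0.
  by move=> sk kK; apply: (db (Some true :: k)) => //=; rewrite sk.
pose Y0 (y : seq (row3 m)) := K0 (full_cols y).
pose Y1 (y : seq (row3 m)) := K1 (full_cols y).
have Y0c : sub_closed Y0 by move=> x y; apply: full_cols_sub.
have Y1c : sub_closed Y1 by move=> x y; apply: full_cols_sub.
have cocy (KK : pred (seq bool)) b' y : monotone KK ->
    (forall k, size k = m -> KK (twos k) -> dM b' k = 0) -> KK (full_cols y) ->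
    drec (@Psi m b') y = 0.
  by move=> KKm b'0 yK; rewrite drec_Psi (eq_Psi KKm b'0 yK) Psi0.
have E0 x : ~~ full (unzip1 x) -> Y0 (unzip2 x) ->
    pull (Psi b0) x + cup1 (@wind _ _) (pull (Psi b1)) x = drec c x.
  move=> nf yx; rewrite -E /=; first by rewrite cup2_nfull // addr0.
  by rewrite (negbTE nf).
have [|||y yY|y yY|a' [b' [c' [[a'0 b'0 c'0] Ea Eb Ec]]]] :=
    circle_acyclic Y0c _ _ _ _ _ E0; rewrite ?Psi_nil //.
- exact: cocy yY.
- exact: cocy yY.
have [b0' [a3 [a30 Eb0 Ea3]]] := IH K0 b0 a' K0m a'0 db0 Ea.
have [|y yY|b1' [b3 [b30 Eb1 Eb3]]] := IH K0 (fun k => - b1 k) b' K0m b'0.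
- by move=> k sk kK; rewrite dMN db1 ?oppr0.
- by rewrite PsiN Eb ?opprK.
pose t x := pull a3 x + c' x - cup1 (@wind _ _) (pull b3) x.
have Dt x : drec t x = pull (drec a3) x + drec c' x
     - cup2 (@wind _ _) (pull b3) x + cup1 (@wind _ _) (pull (drec b3)) x.
  rewrite drecB drecD drec_pull drec_cup1 //.
  rewrite (eq_cup1 _ (fun y _ => drec_pull _ y)) /pull; ring.
have sub_pull g h x (Y : pred (seq (row3 m))) : sub_closed Y -> (forall y, Y y -> g y = h y) ->
    Y (unzip2 x) -> cup1 (@wind A (row3 m)) (pull g) x = cup1 (@wind A (row3 m)) (pull h) x.
  move=> Yc gh Yx; apply: eq_cup1 => y /sub_faces s.
  by rewrite /pull gh //; apply: Yc (sub_unzip2 s) _.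
(* The part of [c] not yet explained vanishes over the circle, so over the link it falls under
   [disk_acyclic]. *)
pose c4 x := c x - pull (Psi b0') x - cup1 (@wind _ _) (pull (Psi b1')) x - drec t x.
have c4C x : ~~ full (unzip1 x) -> Y0 (unzip2 x) -> c4 x = 0.
  move=> nf Yx; rewrite /c4 Ec // Dt cup2_nfull // {1}/pull Ea3 //.
  rewrite (sub_pull _ _ _ _ Y0c Eb3 Yx) [cup1 _ (pull (fun _ => _)) x]cup1D /pull; ring.
have EY x i : Y1 (unzip2 x) -> K (i :: full_cols (unzip2 x)).
  by case: i => // /K10.
have db21 k : size k = m -> K1 (twos k) -> dM (fun k => b2 k - b1' k) k = 0.
  move=> sk kK; rewrite dMD dMN -Eb1 ?opprK ?[_ + b1 k]addrC ?db2 //; exact: K10.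
have [|||||g [c5 [[g0 c50] Eg Ec5C Ec5]]] :=
    @disk_acyclic _ _ _ Y1c (Psi (fun k => b2 k - b1' k)) c4.
- by rewrite Psi_nil.
- by rewrite /c4 c0 /pull Psi_nil /= !subr0.
- by move=> y; apply: cocy.
- by move=> x nf yx; apply: c4C; rewrite //; apply: K10.
- move=> x Yx; have Y0x : Y0 (unzip2 x) by exact: K10.
  rewrite drecB drec_drec subr0 !drecB drec_pull drec_cup1 /pull ?Psi_nil // -E /= ?EY //.
  rewrite -!/(pull _) drec_Psi -(eq_Psi K0m Eb0) //.
  have P1 y : Y0 y -> drec (Psi b1') y = - Psi b1 y.
    by move=> yY; rewrite drec_Psi -(eq_Psi K0m Eb1) // PsiN.
  have -> : cup1 (@wind A _) (drec (fun y : seq ('I_3 * row3 m) => Psi b1' (unzip2 y))) x =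
     - cup1 (@wind _ _) (pull (Psi b1)) x.
    rewrite (eq_cup1 _ (fun y _ => drec_pull _ y)).
    have := sub_pull _ _ _ _ Y0c P1 Y0x; rewrite /pull => ->.
    by case: x {Yx Y0x} => [|p [|q x]] /=; rewrite ?oppr0 // mulrN.
  have -> : cup2 (@wind A _) (pull (Psi (fun k => b2 k - b1' k))) x =
      cup2 (@wind A _) (pull (Psi b2)) x - cup2 (@wind A _) (pull (Psi b1')) x.
    by case: x {Yx Y0x} => [|p [|q [|r x]]] /=; rewrite ?subr0 // /pull PsiD PsiN mulrBr.
  by rewrite /pull /b0 /b1 /b2; ring.
have [b2' [g' [g'0 Eb2 Eg']]] := IH K1 _ g K1m g0 db21 Eg.
pose b'' k := match k with
  | None :: k => b0' k | Some false :: k => b1' k | Some true :: k => b2' k | _ => 0 end.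
pose c6 x := cup2 (@wind _ _) (pull g') x + c5 x.
(* [c6] is controlled only over the link. There it already vanishes on tuples that are not full, so
   cutting it off changes nothing, while over the circle the cut-off term has no coboundary. *)
exists b'', (fun x => t x + if full (unzip1 x) then c6 x else 0); split.
- by rewrite /t /pull /= a30 c'0 !addr0 subr0.
- case=> [//|[[]|] k] /= [sk] kK.
  + have := Eb2 k sk kK; rewrite -/(b2 k) => /eqP; rewrite subr_eq => /eqP->.
    by rewrite addrC.
  + by rewrite -[dM _ k]/(dM b1' k) -Eb1 // opprK.
  + by rewrite -[dM _ k]/(dM b0' k) -Eb0.
move=> x /= Kx; rewrite drecD.
have -> : c x = pull (Psi b0') x + cup1 (@wind _ _) (pull (Psi b1')) x + drec t x + c4 x.
  by rewrite /c4; ring.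
suff -> : c4 x = cup2 (@wind _ _) (pull (Psi b2')) x +
    drec (fun y => if full (unzip1 y) then c6 y else 0) x by rewrite /b''; ring.
case fx : (full (unzip1 x)) Kx => Kx; last first.
  rewrite c4C ?fx // cup2_nfull ?fx // add0r drec_eq0 // => y /sub_faces s.
  case: ifP => // fy; move: fx; rewrite (full_sub _ fy) //; exact: sub_unzip1.
have Yx : Y1 (unzip2 x) by [].
have E6 y : Y1 (unzip2 y) -> (if full (unzip1 y) then c6 y else 0) = c6 y.
  case: ifP => // fy Yy; rewrite /c6 cup2_nfull ?fy // add0r Ec5C ?fy //.
rewrite (eq_drec (g := c6)); last by move=> y /sub_faces s; apply: E6; apply: Y1c (sub_unzip2 s) _.
rewrite drecD drec_cup2 // Ec5 // addrA; congr (_ + _).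
rewrite -cup2D; apply: eq_cup2 => y _ s; rewrite drec_pull /pull Eg' //.
exact: Y1c (sub_unzip2 s) _.
Qed.
End Words.

Section WordsMorphism.
Variables (A B : comNzRingType) (f : {rmorphism A -> B}).

Lemma dM_rmorph (b : seq (option bool) -> A) k : f (dM b k) = dM (fun k => f (b k)) k.
Proof.
by elim: k b => [|[[]|] k IH] b /=; rewrite ?rmorph0 ?rmorphD ?rmorphN ?IH.
Qed.

Lemma Psi_rmorph m (b : seq (option bool) -> A) (x : seq (row3 m)) :
  f (Psi b x) = Psi (fun k => f (b k)) x.
Proof.
have fw (V : eqType) p q : f (@wind A V p q) = wind B p q.
  by rewrite /wind; case: ifP => _; [|case: ifP => _]; rewrite ?rmorphN ?rmorph1 ?rmorph0.
elim: m b x => [|m IH] b x /=; first by case: ifP; rewrite ?rmorph0.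
rewrite !rmorphD /= {1}/pull IH.
case: x => [|p [|q [|r x]]] //=; rewrite ?rmorph0 // rmorphM /= ?fw /pull ?IH ?rmorph0 //.
by congr (_ + _); rewrite rmorphM /= IH /dw rmorphD rmorphB /= !fw.
Qed.
End WordsMorphism.

(** * The Bockstein of complexes with few vertices *)

Section SimplicialCochains.
Variable A : comNzRingType.
Implicit Types (c : seq bool -> A) (t : seq bool).

(** The sign counts the absent vertices preceding the removed one, to agree with [dM]; the empty
    face is included. *)
Fixpoint dS c t : A :=
  match t with
  | [::] => 0
  | false :: t' => - dS (fun s => c (false :: s)) t'
  | true :: t' => c (false :: t') + dS (fun s => c (true :: s)) t'
  end.

Lemma eq_dS c c' t :
  (forall s, size s = size t -> (count id s).+1 = count id t -> c s = c' s) ->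
  dS c t = dS c' t.
Proof.
elim: t c c' => // -[] t IH c c' h /=; last first.
  by congr (- _); apply: IH => s ss st; apply: h => /=; rewrite ?ss.
congr (_ + _); first by apply: h => /=; rewrite ?add0n.
by apply: IH => s ss st; apply: h => /=; rewrite ?ss // -st.
Qed.

Lemma dSD c c' t : dS (fun s => c s + c' s) t = dS c t + dS c' t.
Proof. by elim: t c c' => [|[] t IH] c c' /=; rewrite ?addr0 ?IH //; ring. Qed.

Lemma dSZ k c t : dS (fun s => k * c s) t = k * dS c t.
Proof. by elim: t c => [|[] t IH] c /=; rewrite ?mulr0 ?IH //; ring. Qed.

Lemma dS_count0 c t : count id t = 0%N -> dS c t = 0.
Proof. by elim: t c => // -[] t IH c //= h; rewrite IH ?oppr0. Qed.

End SimplicialCochains.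

Lemma dS_count1 (c : seq bool -> int) t : count id t = 1%N ->
  dS c t = (-1) ^+ index true t * c (nseq (size t) false).
Proof.
elim: t c => // -[] t IH c /= h.
  have h0 : count id t = 0%N by case: h.
  rewrite dS_count0 // mul1r addr0; congr (c (false :: _)).
  by elim: t h0 {IH h} => //= -[] t IHt //= /IHt {1}->.
by rewrite (IH (fun s => c (false :: s)) h) exprS; lia.
Qed.

(* The signs turn [dS] on [0]-simplices into differences of values. *)
Definition vsign (s : seq bool) : int := (-1) ^+ index true s.

Lemma dS_vsign1 (r : seq bool -> bool) t : count id t = 1%N ->
  (absz (dS (fun s => vsign s * (r s)%:Z) t)%R <= 1)%N.
Proof.
move=> h; rewrite dS_count1 // /vsign !abszM !abszX /= !exp1n !mul1n.
by case: (r _).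
Qed.

(** On an edge the value is, up to sign, a difference of two elements of {0, 1}. With the case of a
    single vertex this makes the Bockstein vanish in the two lowest degrees: an even integer of
    absolute value at most 1 is 0. *)
Lemma dS_vsign2 (r : seq bool -> bool) t : count id t = 2%N ->
  (absz (dS (fun s => vsign s * (r s)%:Z) t)%R <= 1)%N.
Proof.
rewrite /vsign => h.
(* The shift [e] records the absent vertices already skipped, which change the exponent in the
   sign. *)
suff /(_ 0%N) : forall e : nat, (absz (dS (fun s => (-1) ^+ (e + index true s) * (r s)%:Z) t)%R <= 1)%N.
  by under [fun s => _]funext do rewrite add0n.
elim: t r h => // -[] t IH r /= h e; last first.
  rewrite abszN; have := IH (fun s => r (false :: s)) h e.+1.
  by under [fun s => _]funext do rewrite addSnnS.
rewrite dS_count1; last by case: h.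
rewrite addn0 mulrA -exprD addnS exprS mulN1r mulNr addrC [(e + _)%N]addnC.
rewrite -mulrBr abszM abszX /= exp1n mul1n.
by case: (r _); case: (r _).
Qed.

(** [vm_compute] evaluates both arguments of [||]; the conditional stops the search at the first
    success. *)
Fixpoint lazy_has T (p : T -> bool) (s : seq T) :=
  if s is x :: s' then if p x then true else lazy_has p s' else false.

Lemma lazy_hasE T (p : T -> bool) s : lazy_has p s = has p s.
Proof. by elim: s => //= x s ->; case: (p x). Qed.

Fixpoint allwords k : seq (seq bool) :=
  if k is k'.+1 then map (cons false) (allwords k') ++ map (cons true) (allwords k')
  else [:: [::]].

Lemma mem_allwords t : t \in allwords (size t).
Proof. by elim: t => //= -[] t IH; rewrite mem_cat map_f ?orbT. Qed.

Definition faces_of k j := seq.filter (fun t => count id t == j) (allwords k).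

Lemma mem_faces_of t k j : size t = k -> count id t = j -> t \in faces_of k j.
Proof. by move=> <- <-; rewrite mem_filter eqxx mem_allwords. Qed.

(** A 0/1 cochain is stored as the list of its values on the faces with [j] vertices, so that all of
    them can be enumerated. *)
Definition lookup k j (l : seq bool) t := nth false l (index t (faces_of k j)).

Lemma lookup_map k j (r : seq bool -> bool) t : t \in faces_of k j ->
  lookup k j (map r (faces_of k j)) t = r t.
Proof. by move=> h; rewrite /lookup (nth_map t) ?index_mem // nth_index. Qed.

(** The first bit marks the faces where the coboundary is odd and cannot be halved; elsewhere the
    second is the Bockstein mod 2, which the absolute value does not affect. *)
Definition bock_bits k j (l : seq bool) : seq (bool * bool) :=
  [seq (let x := absz (dS (fun s => vsign s * (lookup k j l s)%:Z) t) in (odd x, odd x./2)) |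
     t <- faces_of k j.+1].

Definition cob_bits k j (l : seq bool) : seq bool :=
  [seq odd (absz (dS (fun s => (lookup k j l s)%:Z) t)) | t <- faces_of k j.+1].

(* For every 0/1 cochain some coboundary agrees mod 2 with its Bockstein on all the faces where
   the Bockstein is defined, so that all complexes with [k] vertices are treated at once. *)
Definition bock_check k j :=
  let us := map (cob_bits k j) (allwords (size (faces_of k j))) in
  all (fun l => let q := bock_bits k j l in
         lazy_has (all2 (fun (p : bool * bool) b => if p.1 then true else p.2 == b) q) us)
      (allwords (size (faces_of k j))).

(** These four checks cover all pairs with 2 <= j < k and k + j <= 7. The projective plane realises
    the pair k = 6, j = 2, of sum 8. *)
Lemma bock_check52 : bock_check 5 2. Proof. by vm_compute. Qed.
Lemma bock_check42 : bock_check 4 2. Proof. by vm_compute. Qed.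
Lemma bock_check43 : bock_check 4 3. Proof. by vm_compute. Qed.
Lemma bock_check32 : bock_check 3 2. Proof. by vm_compute. Qed.

Lemma all2_map2 (S T U : Type) (p : T -> U -> bool) (f : S -> T) (g : S -> U) s :
  all2 p (map f s) (map g s) = all (fun x => p (f x) (g x)) s.
Proof. by elim: s => //= x s ->. Qed.

Lemma bock_checkP k j (r : seq bool -> bool) : bock_check k j ->
  exists u : seq bool -> int, forall t, size t = k -> count id t = j.+1 ->
    forall y, dS (fun s => vsign s * (r s)%:Z) t = 2 * y ->
    exists v, y = dS u t + 2 * v.
Proof.
rewrite /bock_check => /allP/(_ (map r (faces_of k j))).
have -> : size (faces_of k j) = size (map r (faces_of k j)) by rewrite size_map.
rewrite lazy_hasE mem_allwords => /(_ isT)/hasP[_ /mapP[l _ ->] H].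
exists (fun s => (lookup k j l s)%:Z) => t st ct y E.
have tf : t \in faces_of k j.+1 by apply: mem_faces_of.
have dE : dS (fun s => vsign s * (lookup k j (map r (faces_of k j)) s)%:Z) t = 2 * y.
  rewrite -E; apply: eq_dS => s ss cs; rewrite lookup_map //.
  by apply: mem_faces_of; [rewrite ss|rewrite ct in cs; case: cs].
move: H; rewrite /bock_bits /cob_bits all2_map2 => /allP/(_ t tf) /=.
rewrite dE abszM /= mul2n odd_double doubleK /= => /eqP H.
set d := dS _ t in H *.
have [v] : exists v, (y - d = 2 * v)%R.
  exists ((y - d) %/ 2)%Z; rewrite mulrC divzK //.
  by rewrite dvdzE /= dvdn2; move: H; lia.
by exists v; lia.
Qed.

(** Replacing [c] by a signed 0/1 cochain of the same parity changes [a] by the coboundary [dS q].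
    This leaves finitely many cochains, on a simplex of bounded size. *)
Lemma dS_bockstein K k j (c a : seq bool -> int) : monotone K ->
  (forall t, size t = k -> count id t = 1%N -> K t) -> (k + j <= 7)%N ->
  (forall t, size t = k -> K t -> count id t = j.+1 -> dS c t = 2 * a t) ->
  exists u v, forall t, size t = k -> K t -> count id t = j.+1 -> a t = dS u t + 2 * v t.
Proof.
move=> Km K1 kj E.
pose r t := (c t %% 2)%Z == 1; pose q t := ((c t - vsign t * (r t)%:Z) %/ 2)%Z.
have vs t : vsign t = 1 \/ vsign t = -1.
  by rewrite /vsign -signr_odd; case: odd; [right|left].
have Ec t : c t = vsign t * (r t)%:Z + 2 * q t.
  have h : (2 %| c t - vsign t * (r t)%:Z)%Z.
    by rewrite /r; case: (vs t) => ->; case: eqP; lia.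
  by rewrite /q [2 * _]mulrC divzK //; ring.
suff [u [v H]] : exists u v, forall t, size t = k -> K t -> count id t = j.+1 ->
    a t - dS q t = dS u t + 2 * v t.
  exists (fun s => u s + q s), v => t st tK ct; rewrite dSD.
  by have := H t st tK ct; lia.
have {}E t : size t = k -> K t -> count id t = j.+1 ->
    dS (fun s => vsign s * (r s)%:Z) t = 2 * (a t - dS q t).
  move=> st tK ct; rewrite mulrBr -E // -dSZ.
  have -> : dS c t = dS (fun s => vsign s * (r s)%:Z + 2 * q s) t by apply: eq_dS.
  by rewrite dSD addrK.
have low : (forall t, count id t = j.+1 ->
       (absz (dS (fun s => vsign s * (r s)%:Z) t)%R <= 1)%N) ->
    exists u v, forall t, size t = k -> K t -> count id t = j.+1 ->
     a t - dS q t = dS u t + 2 * v t.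
  move=> h; exists (fun=> 0), (fun=> 0) => t st tK ct.
  have -> : dS (fun=> 0) t = 0 :> int.
    by elim: t {st tK ct} => // -[] t /= ->.
  by have := h t ct; rewrite E //; lia.
case: j kj E low => [|[|j]] kj E low; [apply: low => t; exact: dS_vsign1|apply: low => t; exact: dS_vsign2|].
have chk : bock_check k j.+2 -> exists u v, forall t, size t = k -> K t -> count id t = j.+3 ->
    a t - dS q t = dS u t + 2 * v t.
  move=> /(bock_checkP r)[u H].
  pose v t := ((a t - dS q t - dS u t) %/ 2)%Z.
  exists u, v => t st tK ct; have [v' Ev] := H t st ct _ (E t st tK ct).
  suff -> : v t = v' by [].
  by rewrite /v Ev (_ : _ - _ = v' * 2) ?mulzK //; ring.
have [jk|kj'] := leqP k j.+2.
  by exists (fun=> 0), (fun=> 0) => t st _ ct; have := count_size id t; rewrite st ct; lia.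
have : [\/ (k, j) = (5, 0), (k, j) = (4, 0), (k, j) = (4, 1) | (k, j) = (3, 0)]%N.
  have : (k <= 5)%N by lia.
  case: k j kj kj' {E low chk K1} => [|[|[|[|[|[|k]]]]]] [|[|[|[|j]]]] //; try lia; move=> _ _ _.
  - by constructor 4.
  - by constructor 2.
  - by constructor 3.
  - by constructor 1.
case=> -[Ek Ej]; apply: chk; rewrite Ek Ej.
- exact: bock_check52.
- exact: bock_check42.
- exact: bock_check43.
- exact: bock_check32.
Qed.

(** Here [z] is the set J of coordinates carrying a letter and [t] is a subset of J. Words with
    support J thus become faces of the simplex on J, and [dM] becomes [dS]. *)
Fixpoint insert_word (z t : seq bool) : seq (option bool) :=
  match z, t with
  | true :: z', i :: t' => Some i :: insert_word z' t'
  | false :: z', _ => None :: insert_word z' t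
  | _, _ => [::]
  end.

Section InsertWord.
Implicit Types (z t : seq bool) (k : seq (option bool)).

Lemma insert_wordK k : insert_word (map isSome k) (pmap id k) = k.
Proof. by elim: k => // -[i|] k /= ->. Qed.

Lemma size_pmap_id k : size (pmap id k) = count id (map isSome k).
Proof. by elim: k => // -[i|] k /= ->. Qed.

Lemma count_pmap_id k : count id (pmap id k) = count id (twos k).
Proof. by elim: k => // -[[]|] k /= ->. Qed.

Lemma count_isSome k : count isSome k = count id (map isSome k).
Proof. by elim: k => // -[i|] k /= ->. Qed.

Lemma dM_insert_word (A : comNzRingType) (b : seq (option bool) -> A) z t :
  size t = count id z -> dM b (insert_word z t) = dS (fun s => b (insert_word z s)) t.
Proof.
elim: z t b => [|[] z IH] t b; first by case: t.
  case: t => [|[] t] //= [st]; rewrite (IH t) //.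
move=> st /=; rewrite (IH _ (fun k => b (None :: k)) st); case: t st => //.
Qed.

Lemma size_insert_word z t : size t = count id z -> size (insert_word z t) = size z.
Proof.
elim: z t => [|[] z IH] [|i t] //= st; first by case: st => /IH ->.
all: by rewrite IH.
Qed.

Lemma count_insert_word z t : size t = count id z ->
  count id (twos (insert_word z t)) = count id t.
Proof.
elim: z t => [|[] z IH] [|i t] //= st; first by case: st => /IH ->; case: i.
all: by rewrite IH.
Qed.

Lemma isSome_insert_word z t : size t = count id z -> map isSome (insert_word z t) = z.
Proof.
elim: z t => [|[] z IH] [|i t] //= st; first by case: st => /IH ->.
all: by rewrite IH.
Qed.

Lemma pmap_insert_word z t : size t = count id z -> pmap id (insert_word z t) = t.
Proof.
elim: z t => [|[] z IH] [|i t] //= st; first by case: st => /IH ->.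
all: by rewrite IH.
Qed.

Lemma twos_insert_mono z t t' : size t = size t' -> all2 implb t' t ->
  all2 implb (twos (insert_word z t')) (twos (insert_word z t)).
Proof.
elim: z t t' => [|[] z IH] t t' st h //=.
  case: t t' st h => [|i t] [|i' t'] //= [st] /andP[h h'].
  by rewrite IH // andbT; move: h; case: i; case: i'.
by rewrite IH.
Qed.
End InsertWord.

Lemma size_all2 (S T : Type) (p : S -> T -> bool) s t : all2 p s t -> size s = size t.
Proof. by elim: s t => [|x s IH] [|y t] //= /andP[_ /IH->]. Qed.

(** [dM] preserves the support of a word, so the problem splits into one full subcomplex per
    support, and the solutions are assembled by choice. *)
Lemma dM_bockstein K m n (c a : seq (option bool) -> int) : monotone K ->
  (forall t, size t = m -> count id t = 1%N -> K t) -> (n <= 7)%N ->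
  (forall k, size k = m -> K (twos k) -> wdeg k = n.+1 -> dM c k = 2 * a k) ->
  exists u v, forall k, size k = m -> K (twos k) -> wdeg k = n.+1 ->
    a k = dM u k + 2 * v k.
Proof.
move=> Km K1 n7 E.
suff /choice[uv H] : forall z, exists uv : (seq bool -> int) * (seq bool -> int),
    size z = m -> forall t, size t = count id z -> K (twos (insert_word z t)) ->
    (count id z + count id t = n.+1)%N ->
    a (insert_word z t) = dS uv.1 t + 2 * uv.2 t.
  exists (fun k => (uv (map isSome k)).1 (pmap id k)), (fun k => (uv (map isSome k)).2 (pmap id k)).
  move=> k sk kK dk; have sp := size_pmap_id k.
  rewrite -{1 2}[k]insert_wordK dM_insert_word // H ?size_map ?insert_wordK //; last first.
    by rewrite -count_isSome count_pmap_id.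
  congr (_ + _); apply: eq_dS => s ss _; set z := map isSome k.
  have sz : size s = count id z by rewrite ss sp.
  rewrite isSome_insert_word //; congr (_ _).
  by rewrite pmap_insert_word.
move=> z; have [sz|] := eqVneq (size z) m; last by move=> /eqP nz; exists (fun=> 0, fun=> 0) => /nz.
pose Kz := [pred t | (size t == count id z) && K (twos (insert_word z t))].
have Kzm : monotone Kz.
  move=> l l' h /andP[/eqP sl lK]; have s' := size_all2 h.
  rewrite /= s' sl eqxx; apply: Km lK; exact: twos_insert_mono.
have Edz t : size t = count id z -> K (twos (insert_word z t)) ->
    (count id z + count id t = n.+1)%N ->
    dS (fun s => c (insert_word z s)) t = 2 * a (insert_word z t).
  move=> st tK dt; rewrite -dM_insert_word // E ?size_insert_word //.
  by rewrite /wdeg count_isSome isSome_insert_word // count_insert_word.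
have dS00 t : dS (fun=> 0) t = 0 :> int by elim: t => // -[] t /= ->.
(* A word of degree [n.+1] with more than [n] letters has no letter [Some true]; [dS] vanishes on
   it, hence so does [a]. *)
have [kn|nk] := leqP (count id z) n; last first.
  exists (fun=> 0, fun=> 0) => _ t st tK dt /=.
  by have := Edz t st tK dt; rewrite dS_count0 ?dS00; lia.
have [|||u [v H]] := @dS_bockstein Kz (count id z) (n - count id z)
    (fun s => c (insert_word z s)) (fun s => a (insert_word z s)) Kzm.
- move=> t st ct; rewrite /Kz /= st eqxx /=; apply: K1; rewrite ?count_insert_word //.
  by rewrite size_map size_insert_word.
- by lia.
- by move=> t st /andP[_ tK] ct; apply: Edz => //; lia.
exists (u, v) => _ t st tK dt; apply: H => //; last by lia.
by rewrite /Kz /= st eqxx.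
Qed.

(** * The projective plane *)

Definition indic6 (l : seq nat) : seq bool := [seq i \in l | i <- iota 0 6].

Definition rp2_facets : seq (seq bool) := map indic6
  [:: [:: 0; 1; 2]; [:: 0; 2; 3]; [:: 0; 3; 4]; [:: 0; 4; 5]; [:: 0; 1; 5];
      [:: 1; 2; 4]; [:: 2; 3; 5]; [:: 1; 3; 4]; [:: 2; 4; 5]; [:: 1; 3; 5]]%N.

Definition rp2 : pred (seq bool) := fun t => has (all2 implb t) rp2_facets.

(** The five facets avoiding vertex 5 form a Moebius band, and these are the edges crossed by its
    core. Each facet contains none or two of them, so their indicator is a mod 2 cocycle. *)
Definition rp2_edges : seq (seq bool) := map indic6
  [:: [:: 0; 2]; [:: 0; 3]; [:: 1; 2]; [:: 1; 4]; [:: 3; 4]]%N.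

Definition rp2_cochain (k : seq (option bool)) : int :=
  (all isSome k && (twos k \in rp2_edges))%:Z.

Definition rp2_bockstein k : int := (dM rp2_cochain k %/ 2)%Z.

Lemma rp2_monotone : monotone rp2.
Proof.
move=> l l' h /hasP[f fF lf]; apply/hasP; exists f => //.
elim: l l' f h lf {fF} => [|i l IH] [|i' l'] [|j f] //= /andP[h1 h2] /andP[h3 h4].
by rewrite (IH _ _ h2 h4) andbT; move: h1 h3; case: i; case: i'.
Qed.

Fixpoint all3words m : seq (seq (option bool)) :=
  if m is m'.+1 then
    flatten [seq map (cons i) (all3words m') | i <- [:: None; Some false; Some true]]
  else [:: [::]].

Lemma mem_all3words k : k \in all3words (size k).
Proof.
elim: k => // i k IH; apply/flattenP; exists (map (cons i) (all3words (size k))).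
  by apply/mapP; exists i => //; case: i => [[]|].
exact: map_f.
Qed.

Lemma rp2_bocksteinE k : size k = 6%N -> rp2 (twos k) ->
  dM rp2_cochain k = 2 * rp2_bockstein k.
Proof.
move=> sk kK; rewrite /rp2_bockstein mulrC divzK // dvdzE dvdn2.
have : all (fun k => if rp2 (twos k) then ~~ odd `|dM rp2_cochain k|%N else true) (all3words 6).
  by vm_compute.
by move=> /allP/(_ k); rewrite kK; apply; rewrite -sk mem_all3words.
Qed.

(** The restriction to degree 9 matches the coboundary of an 8-cochain extended by zero to tuples of
    all sizes. *)
Definition rp2_bockstein9 k : int := if wdeg k == 9%N then rp2_bockstein k else 0.

Lemma rp2_bockstein9_cocycle k : size k = 6%N -> rp2 (twos k) ->
  dM (fun k => (rp2_bockstein9 k)%:~R : 'F_2) k = 0.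
Proof.
move=> sk kK; rewrite -(dM_rmorph intr); apply/eqP; rewrite F2_int dvdzE dvdn2.
have : all (fun k => if rp2 (twos k) then ~~ odd `|dM rp2_bockstein9 k|%N else true) (all3words 6).
  by vm_compute.
by move=> /allP/(_ k); rewrite kK; apply; rewrite -sk mem_all3words.
Qed.

Lemma F2_addrr (x : 'F_2) : x + x = 0.
Proof. exact: (addrr_pchar2 (pchar_Fp (isT : prime 2))). Qed.

Lemma F2_oppr (x : 'F_2) : - x = x.
Proof. exact: (oppr_pchar2 (pchar_Fp (isT : prime 2))). Qed.

(* Every edge of the triangulation lies in exactly two facets, so the sum over all facets
   is a mod 2 cycle. *)
Lemma rp2_bockstein_neq (u : seq (option bool) -> 'F_2) :
  ~ (forall k, size k = 6%N -> rp2 (twos k) -> wdeg k = 9%N ->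
     (rp2_bockstein k)%:~R = dM u k :> 'F_2).
Proof.
move=> H; set F := map (map Some) rp2_facets.
have : \sum_(k <- F) ((rp2_bockstein k)%:~R : 'F_2) = \sum_(k <- F) dM u k.
  rewrite !big_seq; apply: eq_bigr => k kF.
  have : all (fun k => [&& size k == 6%N, rp2 (twos k) & wdeg k == 9%N]) F by vm_compute.
  by move=> /allP/(_ _ kF)/and3P[/eqP ? ? /eqP ?]; apply: H.
rewrite -rmorph_sum (_ : \sum_(k <- F) rp2_bockstein k = foldr +%R 0 (map rp2_bockstein F));
  last by elim: (F) => [|k s IH]; rewrite ?big_nil ?big_cons //= IH.
have -> : \sum_(k <- F) dM u k = 0; last first.
  move=> /eqP; rewrite F2_int; apply/negP; by vm_compute.
pose edges := map (map Some) (seq.filter (fun t => count id t == 2%N) (allwords 6)).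
(* Zero is written as twice the sum over all 15 edges, which is what the facets produce once
   expanded. *)
rewrite -[RHS](F2_addrr (\sum_(k <- edges) u k)).
let F' := eval vm_compute in F in rewrite (_ : F = F') //.
let E' := eval vm_compute in edges in rewrite (_ : edges = E') //.
rewrite !big_cons !big_nil /= !F2_oppr; ring.
Qed.

(** * Barycentric subdivision and small simplices *)

Local Open Scope classical_set_scope.

Section Subdivision.
Variables (A : comNzRingType).

Section Operators.
Variables (V : eqType) (bary : seq V -> V).
Implicit Types (f g : seq V -> A) (x y : seq V).

(* The barycentric subdivision of [x] is the cone from the barycenter of [x] over the
   subdivision of its boundary, and [sdh] is the analogous homotopy; both act on cochains
   and [n] is the number of vertices. *)
Fixpoint sd n f x : A :=
  if n is n'.+1 then drec (sd n' (fun z => f (bary x :: z))) x else f x.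

Fixpoint sdh n f x : A :=
  if n is n'.+1 then f (bary x :: x) - drec (sdh n' (fun z => f (bary x :: z))) x else 0.

Lemma eq_sd n f g x : size x = n -> (forall y, size y = n -> f y = g y) ->
  sd n f x = sd n g x.
Proof.
elim: n f g x => [|n IH] f g x sx fg /=; first by rewrite fg.
apply: eq_drec => y /size_faces; rewrite sx => -[sy]; apply: IH => // z sz.
by apply: fg; rewrite /= sz.
Qed.

Lemma eq_sdh n f g x : size x = n -> (forall y, size y = n.+1 -> f y = g y) ->
  sdh n f x = sdh n g x.
Proof.
elim: n f g x => [|n IH] f g x sx fg //=; rewrite fg ?sx //=; last by rewrite sx.
congr (_ - _); apply: eq_drec => y /size_faces; rewrite sx => -[sy]; apply: IH => // z sz.
by apply: fg; rewrite /= sz.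
Qed.

Lemma sd0 n x : sd n (fun=> 0) x = 0.
Proof. by elim: n x => //= n IH x; apply: drec_eq0 => y _; apply: IH. Qed.

Lemma sdB n f g x : sd n (fun y => f y - g y) x = sd n f x - sd n g x.
Proof.
elim: n f g x => [|n IH] f g x //=; rewrite -drecB; apply: eq_drec => y _; exact: IH.
Qed.

Lemma sdhB n f g x : sdh n (fun y => f y - g y) x = sdh n f x - sdh n g x.
Proof.
elim: n f g x => [|n IH] f g x /=; first by rewrite subrr.
rewrite (eq_drec (fun y _ => IH _ _ y)) drecB; ring.
Qed.

Lemma sdh_eq0 n f x : (forall y, size y = (size x).+1 -> f y = 0) -> size x = n -> sdh n f x = 0.
Proof.
elim: n f x => [|n IH] f x f0 sx //=; rewrite f0 // sub0r drec_eq0 ?oppr0 // => y /size_faces sy.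
apply: IH; last by rewrite -(eq_add_S _ _ (etrans (esym sy) sx)).
by move=> z sz; apply: f0; rewrite /= sz -sy.
Qed.

(** On a cone, [drec f] splits into the value on the base and the coboundary along the base. The
    first part gives the left side; the second vanishes by induction and [drec_drec]. *)
Lemma drec_sd n f x : size x = n.+1 -> drec (sd n f) x = sd n.+1 (drec f) x.
Proof.
have E k g y : sd k.+1 (drec g) y =
    drec (sd k g) y - drec (sd k (drec (fun z => g (bary y :: z)))) y.
  by rewrite -drecB; apply: eq_drec => z _; exact: sdB.
elim: n f x => [|n IH] f x sx; rewrite E.
  rewrite [X in _ - X]drec_eq0 ?subr0 // => y /size_faces; rewrite sx => -[].
  by move=> /esym/size0nil->.
rewrite -[LHS]subr0 -(drec_drec (sd n (fun y => f (bary x :: y))) x); congr (_ - _).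
by apply: eq_drec => y /size_faces; rewrite sx => -[sy]; apply: IH.
Qed.

Lemma drec_sdh n f x : size x = n.+1 ->
  drec (sdh n f) x + sdh n.+1 (drec f) x = f x - sd n.+1 f x.
Proof.
elim: n f x => [|n IH] f x sx.
  case: x sx => [|a [|//]] //= _; ring.
pose fb y := f (bary x :: y).
have -> : sdh n.+2 (drec f) x = f x - drec fb x - drec (sdh n.+1 (fun z => f z - drec fb z)) x by [].
have -> : drec (sdh n.+1 (fun z => f z - drec fb z)) x =
    drec (sdh n.+1 f) x - drec (sdh n.+1 (drec fb)) x.
  by rewrite -drecB; apply: eq_drec => y _; exact: sdhB.
have -> : drec (sdh n.+1 (drec fb)) x =
    drec (fun y => fb y - sd n.+1 fb y - drec (sdh n fb) y) x.
  apply: eq_drec => y /size_faces; rewrite sx => -[sy].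
  by rewrite -IH // addrAC subrr add0r.
rewrite 2!drecB drec_drec subr0 [sd n.+2 f x]/=; rewrite /fb; ring.
Qed.
End Operators.

Lemma sd_map (V W : eqType) (bV : seq V -> V) (bW : seq W -> W) (h : V -> W) n
    (f : seq W -> A) x :
  (forall y, size y != 0%N -> bW (map h y) = h (bV y)) ->
  size x = n -> sd bW n f (map h x) = sd bV n (fun y => f (map h y)) x.
Proof.
move=> bh; elim: n f x => [//|n IH] f x sx /=.
rewrite drec_map; apply: eq_drec => y /size_faces; rewrite sx => -[sy].
by rewrite IH // bh ?sx.
Qed.

Lemma sdh_map (V W : eqType) (bV : seq V -> V) (bW : seq W -> W) (h : V -> W) n
    (f : seq W -> A) x :
  (forall y, size y != 0%N -> bW (map h y) = h (bV y)) ->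
  size x = n -> sdh bW n f (map h x) = sdh bV n (fun y => f (map h y)) x.
Proof.
move=> bh; elim: n f x => [//|n IH] f x sx /=.
rewrite drec_map bh ?sx //; congr (_ - _); apply: eq_drec => y /size_faces; rewrite sx => -[sy].
by rewrite IH.
Qed.

Section Shrink.
Variables (R : realType) (V : eqType) (bary : seq V -> V) (d : V -> V -> R) (N : nat).

Definition mesh_le (M : R) (x : seq V) := {in x &, forall a b, d a b <= M}.
Let rho : R := N%:R / N.+1%:R.

Hypothesis ball_convex : forall p M x, x != [::] ->
  {in x, forall v, d p v <= M} -> d p (bary x) <= M.
Hypothesis dC : forall p q, d p q = d q p.
Hypothesis d0 : forall p, d p p = 0.
Hypothesis bary_close : forall M x v, 0 <= M -> (size x <= N.+1)%N -> mesh_le M x -> v \in x ->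
  d (bary x) v <= rho * M.

(** The recursion passes from a barycenter to a facet and forgets where it came from. The convex
    predicate [H] remembers it, and is strengthened at each level by closeness to the barycenter
    just left. *)
Lemma sd_mesh0 n M (H : set V) (f : seq V -> A) x :
  0 <= M -> (forall y, y != [::] -> {in y, forall v, H v} -> H (bary y)) ->
  size x = n -> (n <= N.+1)%N -> mesh_le M x -> {in x, forall v, H v} ->
  (forall y, size y = n -> mesh_le (rho * M) y -> {in y, forall v, H v} -> f y = 0) ->
  sd bary n f x = 0.
Proof.
move=> M0; elim: n H f x => [|n IH] H f x Hc sx nN cx Hx f0 /=.
  by apply: f0 => //; rewrite (size0nil sx).
have xn : x != [::] by rewrite -size_eq0 sx.
apply: drec_eq0 => y yx; have sy := size_faces yx; have yS := sub_faces yx.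
apply: (IH (fun v => H v /\ d (bary x) v <= rho * M)).
- move=> z zn zH; split; first by apply: Hc => // v /zH[].
  by apply: ball_convex => // v /zH[].
- by move: sy; rewrite sx => -[].
- exact: ltnW.
- by move=> a b ay b_y; apply: cx; apply: yS.
- move=> v /yS vx; split; first exact: Hx.
  by apply: bary_close; rewrite ?sx.
move=> z sz cz zH; apply: f0; first by rewrite /= sz.
- have r0 : 0 <= rho * M by rewrite mulr_ge0 // divr_ge0.
  move=> a b; rewrite !inE => /orP[/eqP->|az] /orP[/eqP->|bz]; first by rewrite d0.
  + by have [] := zH _ bz.
  + by rewrite dC; have [] := zH _ az.
  + exact: cz.
- by move=> v; rewrite inE => /orP[/eqP->|/zH[]//]; apply: Hc.
Qed.

Lemma iter_sd_mesh0 n k M (f : seq V -> A) x :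
  0 <= M -> size x = n -> (n <= N.+1)%N -> mesh_le M x ->
  (forall y, size y = n -> mesh_le (rho ^+ k * M) y -> f y = 0) ->
  iter k (sd bary n) f x = 0.
Proof.
elim: k M x => [|k IH] M x M0 sx nN cx f0 /=; first by apply: f0; rewrite // mul1r.
apply: (sd_mesh0 (M := M) (H := setT)) => // y sy cy _.
apply: (IH (rho * M)) => //; first by rewrite mulr_ge0 // divr_ge0.
by move=> z sz; rewrite mulrA -exprSr; apply: f0.
Qed.
End Shrink.
End Subdivision.

(** * Affine simplices and their continuity *)

Section MatrixContinuity.
Variables (R : realType) (T : topologicalType).

Lemma continuous_mx m n (g : T -> 'M[R]_(m, n)) :
  (forall i j, continuous (fun t => g t i j)) -> continuous g.
Proof.
move=> cg v B [P Pv PB].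
have nP : nbhs v (fun w => forall i j, P i j (g w i j)).
  apply: filter_forall => i; apply: filter_forall => j; exact: (cg i j v (P i j) (Pv i j)).
by move: nP; apply: filterS => w Pw; apply: PB.
Qed.

Lemma continuous_bigsum (I : finType) (P : pred I) (F : I -> T -> R) :
  (forall i, P i -> continuous (F i)) -> continuous (fun t => \sum_(i | P i) F i t).
Proof.
by move=> cF; apply: continuous_big => [|k /cF//]; exact: add_continuous.
Qed.

Lemma continuous_setT (V : topologicalType) (Y : set V) (g : T -> set_type Y) :
  continuous (fun t => val (g t)) -> continuous g.
Proof. by move=> cg; apply: continuous_comp_initial. Qed.

Lemma continuous_set_val (V : topologicalType) (Y : set V) (g : T -> set_type Y) :
  continuous g -> continuous (fun t => val (g t)).
Proof.
by move=> cg v; apply: (@continuous_comp _ _ _ g val v (cg v)); exact: initial_continuous.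
Qed.
End MatrixContinuity.

Section AffineSimplices.
Variables (R : realType).

Lemma simplex_ge0 n (v : simplex R n) i : 0 <= val v ord0 i.
Proof. by have := valP v; rewrite inE => -[]. Qed.

Lemma simplex_sum n (v : simplex R n) : \sum_i val v ord0 i = 1.
Proof. by have := valP v; rewrite inE => -[]. Qed.

Lemma simplexP n (v w : simplex R n) : (forall i, val v ord0 i = val w ord0 i) -> v = w.
Proof. by move=> h; apply: val_inj; apply/rowP. Qed.

Lemma coord_simplex_continuous n i : continuous (fun v : simplex R n => val v ord0 i).
Proof.
move=> v; apply: (@continuous_comp _ _ _ (val : simplex R n -> 'rV[R]_n.+1) (fun w => w ord0 i)).
  exact: initial_continuous.
exact: coord_continuous.
Qed.

Lemma vtx_std n (i : 'I_n.+1) : (delta_mx ord0 i : 'rV[R]_n.+1) \in std_simplex R n.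
Proof.
rewrite inE; split=> [j|]; first by rewrite mxE; case: (_ && _).
rewrite (bigD1 i) //= mxE !eqxx big1 ?addr0 // => j ji.
by rewrite mxE eqxx (negbTE ji).
Qed.

Definition vtx n (i : 'I_n.+1) : simplex R n :=
  exist (fun x => x \in std_simplex R n) _ (vtx_std i).

Lemma vtxE n (i j : 'I_n.+1) : val (vtx i) ord0 j = (j == i)%:R.
Proof. by rewrite mxE. Qed.

Section Aff.
Variables (n N : nat) (p : seq (simplex R N)).

Definition aff_row (v : simplex R n) : 'rV[R]_N.+1 :=
  \row_i \sum_(j < n.+1) val v ord0 j * val (nth (vtx ord0) p j) ord0 i.

Lemma aff_row_std v : aff_row v \in std_simplex R N.
Proof.
rewrite inE; split=> [i|].
  by rewrite mxE sumr_ge0 // => j _; rewrite mulr_ge0 ?simplex_ge0.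
rewrite (eq_bigr (fun i => \sum_(j < n.+1) val v ord0 j * val (nth (vtx ord0) p j) ord0 i)).
  rewrite exchange_big /= -[RHS](simplex_sum v); apply: eq_bigr => j _.
  by rewrite -mulr_sumr simplex_sum mulr1.
by move=> i _; rewrite mxE.
Qed.

Definition aff (v : simplex R n) : simplex R N :=
  exist (fun x => x \in std_simplex R N) _ (aff_row_std v).

Lemma affE v i : val (aff v) ord0 i = \sum_(j < n.+1) val v ord0 j * val (nth (vtx ord0) p j) ord0 i.
Proof. by rewrite mxE. Qed.

Lemma aff_continuous : continuous aff.
Proof.
apply: continuous_setT; apply: continuous_mx => i j; rewrite (ord1 i).
under [fun t => _]funext do rewrite affE.
apply: continuous_bigsum => k _ v; apply: continuousM; last exact: cst_continuous.
exact: coord_simplex_continuous.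
Qed.

HB.instance Definition _ := isContinuous.Build _ _ aff aff_continuous.
End Aff.

Definition vertices n : seq (simplex R n) := map (@vtx n) (enum 'I_n.+1).

Lemma size_vertices n : size (vertices n) = n.+1.
Proof. by rewrite size_map size_enum_ord. Qed.

Lemma nth_vertices n (j : 'I_n.+1) : nth (vtx ord0) (vertices n) j = vtx j.
Proof. by rewrite (nth_map ord0) ?size_enum_ord // nth_ord_enum. Qed.

Lemma aff_vertices n v : aff (vertices n) v = v.
Proof.
apply: simplexP => i; rewrite affE (bigD1 i) //= big1 ?addr0 => [|j ji].
  by rewrite nth_vertices vtxE eqxx mulr1.
by rewrite nth_vertices vtxE eq_sym (negbTE ji) mulr0.
Qed.

Lemma aff_aff k n N (p : seq (simplex R N)) (q : seq (simplex R n)) (v : simplex R k) :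
  size q = k.+1 -> aff (map (aff p) q) v = aff p (aff q v).
Proof.
move=> sq; apply: simplexP => i; rewrite !affE.
under eq_bigr => j _.
  rewrite (nth_map (vtx ord0)) ?sq // affE mulr_sumr.
  under eq_bigr => l _ do rewrite mulrA.
  over.
rewrite exchange_big /=; apply: eq_bigr => l _.
by rewrite affE mulr_suml.
Qed.

Lemma vertex_map_aff m n (f : 'I_m.+1 -> 'I_n.+1) (v : simplex R m) :
  vertex_map f v = aff [seq vtx (f j) | j <- enum 'I_m.+1] v.
Proof.
apply: simplexP => i; rewrite affE /= mxE big_mkcond /=.
apply: eq_bigr => j _; rewrite (nth_map ord0) ?size_enum_ord // nth_ord_enum vtxE eq_sym.
by case: ifP => _; rewrite ?mulr1 ?mulr0.
Qed.

Lemma vertex_map_vtx m n (f : 'I_m.+1 -> 'I_n.+1) j : vertex_map f (vtx j) = vtx (f j).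
Proof.
apply: simplexP => i; rewrite vtxE [LHS]mxE big_mkcond (bigD1 j) //= big1 => [|k kj].
  by rewrite vtxE eqxx addr0 eq_sym; case: ifP.
by rewrite vtxE (negbTE kj); case: ifP.
Qed.

Lemma aff_vtx n N (p : seq (simplex R N)) (j : 'I_n.+1) :
  aff p (vtx j) = nth (vtx ord0) p j.
Proof.
apply: simplexP => i; rewrite affE (bigD1 j) //= big1 ?addr0 => [|k kj].
  by rewrite vtxE eqxx mul1r.
by rewrite vtxE (negbTE kj) mul0r.
Qed.

Lemma map_aff_vertices n N (p : seq (simplex R N)) : size p = n.+1 ->
  map (aff (n := n) p) (vertices n) = p.
Proof.
move=> sp; apply: (@eq_from_nth _ (vtx ord0)); rewrite size_map size_vertices // => i ilt.
by rewrite (nth_map (vtx ord0)) ?size_vertices // (nth_vertices (Ordinal ilt)) aff_vtx.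
Qed.
End AffineSimplices.

(** * Barycenters and the contraction of the mesh *)

Section Barycenter.
Variables (R : realType).

Lemma uniform_std n : (\row__ n.+1%:R^-1 : 'rV[R]_n.+1) \in std_simplex R n.
Proof.
rewrite inE; split=> [i|]; first by rewrite mxE invr_ge0.
under eq_bigr do rewrite mxE.
by rewrite sumr_const card_ord -[LHS]mulr_natr mulVf ?pnatr_eq0.
Qed.

Definition uniform n : simplex R n := exist (fun x => x \in std_simplex R n) _ (uniform_std n).

Definition barycenter N (x : seq (simplex R N)) : simplex R N :=
  aff x (uniform (size x).-1).

Lemma barycenter_aff n N (p : seq (simplex R N)) (x : seq (simplex R n)) :
  size x != 0%N -> barycenter (map (aff p) x) = aff p (barycenter x).
Proof.
by move=> sx; rewrite /barycenter size_map aff_aff // prednK // lt0n.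
Qed.

Definition dist N (p q : simplex R N) : R := `|val p - val q|.

Lemma val_aff n N (p : seq (simplex R N)) (v : simplex R n) :
  val (aff p v) = \sum_(j < n.+1) val v ord0 j *: val (nth (vtx R ord0) p j).
Proof.
by apply/rowP => i; rewrite [LHS]mxE summxE; apply: eq_bigr => j _; rewrite mxE.
Qed.

Lemma sub_aff n N (p : seq (simplex R N)) (v : simplex R n) (q : simplex R N) :
  val q - val (aff p v) = \sum_(j < n.+1) val v ord0 j *: (val q - val (nth (vtx R ord0) p j)).
Proof.
rewrite val_aff -{1}[val q]scale1r -(simplex_sum v) scaler_suml -sumrB.
by apply: eq_bigr => j _; rewrite scalerBr.
Qed.

Lemma dist_aff n N (p : seq (simplex R N)) (v : simplex R n) (q : simplex R N) M :
  size p = n.+1 -> {in p, forall a, dist q a <= M} -> dist q (aff p v) <= M.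
Proof.
move=> sp qp; rewrite /dist sub_aff; apply: le_trans (ler_norm_sum _ _ _) _.
rewrite -[M]mul1r -(simplex_sum v) mulr_suml; apply: ler_sum => j _.
rewrite normrZ ger0_norm ?simplex_ge0 // ler_wpM2l ?simplex_ge0 //.
by apply: qp; rewrite mem_nth // sp.
Qed.

Lemma dist_barycenter N (q : simplex R N) M x : x != [::] ->
  {in x, forall v, dist q v <= M} -> dist q (barycenter x) <= M.
Proof. by move=> xn; apply: dist_aff; case: x xn. Qed.

Lemma distC N (p q : simplex R N) : dist p q = dist q p.
Proof. by rewrite /dist distrC. Qed.

Lemma distxx N (p : simplex R N) : dist p p = 0.
Proof. by rewrite /dist subrr normr0. Qed.

(** In the average of the differences to [v] the term of [v] itself is zero. At most [k] of [k.+1]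
    terms remain, each bounded by [M]. *)
Lemma barycenter_close N k M (x : seq (simplex R N)) v : 0 <= M -> (size x <= k.+1)%N ->
  mesh_le (@dist N) M x -> v \in x -> dist (barycenter x) v <= k%:R / k.+1%:R * M.
Proof.
move=> M0 sx cx vx; rewrite distC /dist sub_aff.
have s0 : (0 < size x)%N by case: x vx {sx cx}.
apply: le_trans (ler_norm_sum _ _ _) _.
have iv : (index v x < (size x).-1.+1)%N by rewrite prednK // index_mem.
rewrite (bigD1 (Ordinal iv)) //= nth_index // subrr scaler0 normr0 add0r.
apply: (@le_trans _ _ (\sum_(i < (size x).-1.+1 | i != Ordinal iv) (size x).-1.+1%:R^-1 * M)).
  apply: ler_sum => j _; rewrite mxE normrZ ger0_norm ?invr_ge0 //.
  rewrite ler_wpM2l ?invr_ge0 //; apply: cx => //; apply: mem_nth.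
  by rewrite -[X in (_ < X)%N](prednK s0).
rewrite sumr_const cardC1 card_ord /= -[leLHS]mulr_natl mulrA ler_wpM2r //.
have : ((size x).-1 <= k)%N by lia.
move: ((size x).-1) => j jk.
rewrite ler_pdivrMr // mulrAC ler_pdivlMr //.
by rewrite -!natrM ler_nat; lia.
Qed.

Definition unit_bound N : R := \sum_(j < N.+1) `|delta_mx ord0 j : 'rV[R]_N.+1|.

Lemma dist_bound N (p q : simplex R N) : dist p q <= 2 * unit_bound N.
Proof.
have B (v : simplex R N) : `|val v| <= unit_bound N.
  rewrite -[v]aff_vertices val_aff; apply: le_trans (ler_norm_sum _ _ _) _.
  apply: ler_sum => j _; rewrite nth_vertices normrZ ger0_norm ?simplex_ge0 //.
  rewrite -[leRHS]mul1r ler_wpM2r // -(simplex_sum v) (bigD1 j) //= lerDl.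
  by apply: sumr_ge0 => i _; apply: simplex_ge0.
by apply: le_trans (ler_normB _ _) _; rewrite mulr2n mulrDl mul1r lerD.
Qed.

Lemma geometric_small (r e M : R) : 0 <= r < 1 -> 0 < e -> 0 <= M ->
  exists k0, forall k, (k0 <= k)%N -> r ^+ k * M < e.
Proof.
move=> /andP[r0 r1] e0 M0.
have M1 : 0 < M + 1 by rewrite ltr_wpDl.
have c : (fun k => r ^+ k) @ \oo --> (0 : R) by apply: cvg_expr; rewrite ger0_norm.
have [k0 _ H] := cvgr0_norm_lt _ c (e / (M + 1)) (divr_gt0 e0 M1).
exists k0 => k kk; have := H k kk; rewrite /= ger0_norm ?exprn_ge0 // ltr_pdivlMr //.
by apply: le_lt_trans; rewrite ler_wpM2l ?exprn_ge0 // lerDl.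
Qed.
End Barycenter.

Section Lebesgue.
Variables (R : realType) (X : topologicalType).

Lemma std_simplex_compact n : compact (std_simplex R n).
Proof.
have c01 : compact [set v : 'rV[R]_n.+1 | forall i, `[0, 1]%classic (v ord0 i)].
  by apply: (@rV_compact R n.+1 (fun=> `[0, 1]%classic)) => i; apply: segment_compact.
apply: (subclosed_compact _ c01); last first.
  move=> v [v0 v1] i; rewrite /= in_itv /= v0 -v1 (bigD1 i) //= lerDl.
  by apply: sumr_ge0 => j _.
have -> : std_simplex R n = (\bigcap_(i in [set: 'I_n.+1]) [set v : 'rV[R]_n.+1 | 0 <= v ord0 i])
    `&` [set v : 'rV[R]_n.+1 | \sum_i v ord0 i = 1].
  apply/seteqP; split=> v [v0 v1]; split=> //; first by move=> i _; apply: v0.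
  by move=> i; apply: v0.
apply: closedI.
  apply: closed_bigI => i _.
  apply: (@preimage_closed _ _ (fun v : 'rV[R]_n.+1 => v ord0 i) [set x | 0 <= x]).
    by move=> v _; apply: coord_continuous.
  exact: closed_ge.
apply: (@preimage_closed _ _ (fun v : 'rV[R]_n.+1 => \sum_i v ord0 i) [set x | x = 1]).
  move=> v _; apply: continuous_bigsum => i _; exact: coord_continuous.
exact: closed_eq.
Qed.

(** Compactness is used in its near-covering form along the filter of positive radii tending to 0,
    which yields one radius for all points. *)
Lemma lebesgue_number n (s : simplex R n -> X) (O : set (set X)) : continuous s ->
  (forall v, exists2 U, O U & nbhs (s v) U) ->
  exists2 e : R, 0 < e & forall v, exists2 U, O U & forall w, dist v w < e -> U (s w).
Proof.
move=> cs cov.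
have := (@compact_near_coveringP _ (std_simplex R n)).1 (@std_simplex_compact n).
pose P (e : R) (x : 'rV[R]_n.+1) := exists2 U, O U & forall w : simplex R n, `|x - val w| < e -> U (s w).
move=> /(_ R (0 : R)^'+ P _)[x /mem_set xs|e0 /= e0_gt H]; last first.
  exists (e0 / 2); first by rewrite divr_gt0.
  move=> v; have vs : std_simplex R n (val v) by apply: set_mem; exact: valP.
  have [||U OU UH] := H (e0 / 2) _ _ (val v) vs; last by exists U.
    by rewrite /= sub0r normrN ger0_norm ?divr_ge0 ?ltW // ltr_pdivrMr // ltr_pMr // ltr1n.
  by rewrite divr_gt0.
pose v : simplex R n := exist (fun x => x \in std_simplex R n) x xs.
have [U OU] := cov v; move=> /(cs v) [W' [[W Wo WW'] /= xW WU]].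
have xW' : nbhs x W by apply: open_nbhs_nbhs; split=> //; move: xW; rewrite -WW'.
have [r r0 rW] := (nbhs_ballP _ _).1 xW'.
exists (ball x (r / 2), [set e | e < r / 2]).
  split; first by apply: nbhsx_ballx; rewrite divr_gt0.
  by apply: nbhs_right_lt; rewrite divr_gt0.
move=> [y e] [/= xy er]; exists U => // w yw; apply: WU; rewrite -WW'; apply: rW.
rewrite -ball_normE /= in xy *.
rewrite (splitr r) -(subrKA y) (le_lt_trans (ler_normD _ _)) // ltrD //.
exact: lt_trans yw er.
Qed.
End Lebesgue.

Lemma map_nth_lift (T : Type) (x0 : T) n (p : seq T) (i : 'I_n.+2) : size p = n.+2 ->
  [seq nth x0 p (lift i j) | j <- enum 'I_n.+1] = take i p ++ drop i.+1 p.
Proof.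
move=> sp; have := ltn_ord i => i_n.
apply: (@eq_from_nth _ x0); rewrite size_map size_enum_ord.
  by rewrite size_cat size_drop size_takel sp; lia.
move=> k kn; rewrite (nth_map ord0) ?size_enum_ord // nth_cat size_takel ?sp; last by lia.
rewrite -[k]/(nat_of_ord (Ordinal kn)) nth_ord_enum /= /bump.
case: ltnP => ki; first by rewrite nth_take // leqNgt ki.
by rewrite nth_drop; congr (nth _ _ _); lia.
Qed.

(** * Singular cochains and small simplices *)

Section SmallSimplices.
Variables (R : realType) (X : topologicalType) (A : comNzRingType).
Implicit Types (N n : nat).

Lemma singularP N (s t : singular R X N) : (forall v, s v = t v) -> s = t.
Proof. by move=> h; apply/continuousEP. Qed.

Definition reparam n N (s : singular R X N) (p : seq (simplex R N)) : singular R X n := s \o aff p.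

Lemma reparam_reparam k n N (s : singular R X N) p q : size q = k.+1 ->
  reparam k (reparam n s p) q = reparam k s (map (aff (n := n) p) q).
Proof. by move=> sq; apply: singularP => v; rewrite /= aff_aff. Qed.

Lemma reparam_vertices N (s : singular R X N) : reparam N s (vertices R N) = s.
Proof. by apply: singularP => v; rewrite /= aff_vertices. Qed.

Lemma face_reparam m n (s : singular R X n) (f : 'I_m.+1 -> 'I_n.+1) :
  face s f = reparam m s [seq vtx R (f j) | j <- enum 'I_m.+1].
Proof. by apply: singularP => v; rewrite /= vertex_map_aff. Qed.

Lemma face_lift_reparam n N (s : singular R X N) p (i : 'I_n.+2) : size p = n.+2 ->
  face (reparam n.+1 s p) (lift i) = reparam n s (take i p ++ drop i.+1 p).
Proof.
move=> sp; rewrite face_reparam reparam_reparam; last by rewrite size_map size_enum_ord.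
rewrite -(map_nth_lift (vtx R ord0)) // -map_comp; congr (reparam n s _).
by apply: eq_map => j /=; rewrite aff_vtx.
Qed.

Definition ev n N (c : cochain R X A n) (s : singular R X N) (p : seq (simplex R N)) : A :=
  c (reparam n s p).

(* A simplicial object indexed by lists turns [delta] into [drec]. *)
Lemma delta_drec (V : eqType) (h : forall n, seq V -> singular R X n) n (c : cochain R X A n) p :
  (forall i : 'I_n.+2, face (h n.+1 p) (lift i) = h n (take i p ++ drop i.+1 p)) ->
  size p = n.+2 -> delta c (h n.+1 p) = drec (fun q => c (h n q)) p.
Proof.
by move=> hF sp; rewrite drecE sp; apply: eq_bigr => i _; rewrite hF.
Qed.

Lemma delta_ev n N (c : cochain R X A n) (s : singular R X N) p : size p = n.+2 ->
  ev (delta c) s p = drec (ev c s) p.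
Proof.
move=> sp; apply: (delta_drec (h := fun k q => reparam k s q)) => // i.
exact: face_lift_reparam.
Qed.

(** For operators natural under affine maps, this replaces [delta] by [drec] on the vertices of one
    fixed simplex, where the list identities apply. *)
Lemma delta_vertices n (c : cochain R X A n)
    (h : seq (simplex R n.+1) -> A) (s : singular R X n.+1) :
  (forall i : 'I_n.+2, c (face s (lift i)) =
     h [seq aff [seq vtx R (lift i j) | j <- enum 'I_n.+1] v | v <- vertices R n]) ->
  delta c s = drec h (vertices R n.+1).
Proof.
move=> hc; rewrite drecE size_vertices; apply: eq_bigr => i _; rewrite hc; congr (_ * h _).
rewrite map_aff_vertices; last by rewrite size_map size_enum_ord.
rewrite -(map_nth_lift (vtx R ord0)) ?size_vertices //.
by apply: eq_map => j; rewrite nth_vertices.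
Qed.

Definition Sd n (c : cochain R X A n) : cochain R X A n :=
  fun s => sd (@barycenter R n) n.+1 (ev c s) (vertices R n).

Definition Sdh n (c : cochain R X A n.+1) : cochain R X A n :=
  fun s => sdh (@barycenter R n) n.+1 (ev c s) (vertices R n).

Lemma sd_ev_map k n N (c : cochain R X A k) (s : singular R X N) (p : seq (simplex R N))
    (x : seq (simplex R n)) : size x = k.+1 ->
  sd (@barycenter R n) k.+1 (ev c (reparam n s p)) x =
  sd (@barycenter R N) k.+1 (ev c s) (map (aff p) x).
Proof.
move=> sx; rewrite (sd_map _ (bV := @barycenter R n)) // => [|y sy]; last exact: barycenter_aff.
by apply: eq_sd => // y sy; rewrite /ev reparam_reparam.
Qed.

Lemma sdh_ev_map k n N (c : cochain R X A k.+1) (s : singular R X N) (p : seq (simplex R N))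
    (x : seq (simplex R n)) : size x = k.+1 ->
  sdh (@barycenter R n) k.+1 (ev c (reparam n s p)) x =
  sdh (@barycenter R N) k.+1 (ev c s) (map (aff p) x).
Proof.
move=> sx; rewrite (sdh_map _ (bV := @barycenter R n)) // => [|y sy]; last exact: barycenter_aff.
by apply: eq_sdh => // y sy; rewrite /ev reparam_reparam.
Qed.

Lemma ev_Sd n N (c : cochain R X A n) (s : singular R X N) p : size p = n.+1 ->
  ev (Sd c) s p = sd (@barycenter R N) n.+1 (ev c s) p.
Proof. by move=> sp; rewrite /ev /Sd sd_ev_map ?size_vertices // map_aff_vertices. Qed.

Lemma delta_Sd n (c : cochain R X A n) : delta (Sd c) = Sd (delta c).
Proof.
apply/funext => s.
rewrite (delta_vertices (h := sd (@barycenter R n.+1) n.+1 (ev c s))); last first.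
  by move=> i; rewrite face_reparam /Sd sd_ev_map ?size_vertices.
rewrite drec_sd ?size_vertices //; apply: eq_sd; rewrite ?size_vertices // => y sy.
by rewrite delta_ev.
Qed.

Lemma delta_Sdh n (c : cochain R X A n.+1) s : delta c = 0 ->
  delta (Sdh c) s = c s - Sd c s.
Proof.
move=> dc.
rewrite (delta_vertices (h := sdh (@barycenter R n.+1) n.+1 (ev c s))); last first.
  by move=> i; rewrite face_reparam /Sdh sdh_ev_map ?size_vertices.
have := drec_sdh (@barycenter R n.+1) (ev c s) (size_vertices R n.+1).
rewrite [X in _ + X](_ : _ = 0) ?addr0 => [->|].
  by rewrite /Sd /ev reparam_vertices.
apply: sdh_eq0; last exact: size_vertices.
by move=> y; rewrite size_vertices => sy; rewrite -delta_ev // dc.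
Qed.

Lemma ev_iter_Sd k n N (c : cochain R X A n) (s : singular R X N) p : size p = n.+1 ->
  ev (iter k (@Sd n) c) s p = iter k (sd (@barycenter R N) n.+1) (ev c s) p.
Proof.
elim: k p => //= k IH p sp; rewrite ev_Sd //.
by apply: eq_sd => // y sy; apply: IH.
Qed.

Variable small : forall n, set (singular R X n).
Hypothesis small_reparam : forall n N (s : singular R X N) p, small s -> small (reparam n s p).
Hypothesis small_mesh : forall N (s : singular R X N), exists2 e, 0 < e &
  forall n p, size p = n.+1 -> mesh_le (@dist R N) e p -> small (reparam n s p).

(* Cochains vanishing on small simplices form an acyclic complex: iterated subdivision
   eventually makes any given simplex small, so the homotopies sum up pointwise. *)
Theorem small_acyclic n (e : cochain R X A n.+1) :
  (forall s, small s -> e s = 0) -> delta e = 0 ->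
  exists2 h : cochain R X A n, forall s, small s -> h s = 0 & delta h = e.
Proof.
move=> e0 de; pose E k := iter k (@Sd n.+1) e.
have dE k : delta (E k) = 0.
  elim: k => [//|k IH]; rewrite [E _]/= delta_Sd.
  by apply/funext => s; rewrite -/(E k) IH; exact: sd0.
have Esmall N (s : singular R X N) : exists k0, forall k, (k0 <= k)%N ->
    forall p, size p = n.+2 -> ev (E k) s p = 0.
  have [eps eps0 H] := small_mesh s.
  pose M := 2 * unit_bound R N.
  have M0 : 0 <= M by rewrite mulr_ge0 // sumr_ge0.
  have [|k0 Hk] := @geometric_small R (n.+1%:R / n.+2%:R) eps M _ eps0 M0.
    by rewrite divr_ge0 // ltr_pdivrMr // mul1r ltr_nat ltnSn.
  exists k0 => k kk p sp; rewrite ev_iter_Sd //.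
  apply: (iter_sd_mesh0 (d := @dist R N) (N := n.+1) _ _ _ _ (M := M)) => //.
  - exact: dist_barycenter.
  - exact: distC.
  - exact: distxx.
  - by move=> L x v; apply: barycenter_close.
  - by move=> a b _ _; apply: dist_bound.
  move=> y sy cy; apply: e0; apply: H => // a b ay b_y.
  by apply: le_trans (cy a b ay b_y) _; apply: ltW; apply: Hk.
have /choice[K HK] : forall s : singular R X n, exists k0, forall k, (k0 <= k)%N ->
    Sdh (E k) s = 0.
  move=> s; have [k0 H] := Esmall n s; exists k0 => k kk.
  by apply: sdh_eq0; rewrite size_vertices // => y; apply: H.
(* A finite sum for each simplex, although the number of terms depends on it. *)
pose h s := \sum_(k < K s) Sdh (E k) s.
have hE L s : (K s <= L)%N -> h s = \sum_(k < L) Sdh (E k) s.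
  move=> KL; rewrite /h (big_ord_widen L (fun k => Sdh (E k) s)) // big_mkcond /=.
  apply: eq_bigr => k _; case: ltnP => // kK; by rewrite HK.
exists h.
  move=> s ss; apply: big1 => k _.
  have E0 i N (t : singular R X N) p : size p = n.+2 -> small t -> ev (E i) t p = 0.
    elim: i N t p => [|i IH] N t p sp st; first by apply: e0; apply: small_reparam.
    rewrite [E _]/= ev_Sd // -(@sd0 A _ (@barycenter R N) n.+2 p).
    by apply: eq_sd => // y sy; apply: IH.
  by apply: sdh_eq0; rewrite size_vertices // => y sy; apply: E0.
apply/funext => s; have [k1 H1] := Esmall n.+1 s.
(* A common bound for [s] and all its faces, so that the coboundary of [h] telescopes and its last
   term vanishes. *)
pose L := maxn k1 (\max_(i < n.+2) K (face s (lift i))).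
rewrite /delta.
under eq_bigr => i _.
  rewrite (hE L); first rewrite mulr_sumr.
    over.
  by rewrite leq_max (leq_bigmax (F := fun i : 'I_n.+2 => K (face s (lift i : 'I_n.+1 -> _)))) orbT.
rewrite exchange_big /=.
rewrite (eq_bigr (fun k : 'I_L => E k s - Sd (E k) s)); last first.
  by move=> k _; rewrite -delta_Sdh.
have T L' : \sum_(k < L') (E k s - Sd (E k) s) = e s - E L' s.
  elim: L' => [|L' IH]; first by rewrite big_ord0 subrr.
  by rewrite big_ord_recr /= IH addrA subrK.
rewrite T -[X in E L X]reparam_vertices.
by rewrite -/(ev (E L) s _) H1 ?subr0 ?size_vertices // leq_maxl.
Qed.
End SmallSimplices.

(** * Sectors and the retraction *)

Section PlaneSectors.
Variables (R : realType) (m : nat).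
Implicit Types (z : 'M[R]_(m, 2)) (i : 'I_m) (k : 'I_3).

(** Three linear forms of sum zero: away from the origin at least one is positive, so the
    half-planes where they are positive cover the punctured plane. *)
Definition ell k z i : R :=
  match val k with
  | 0 => z i ord0 | 1 => z i ord_max | _ => - z i ord0 - z i ord_max end.

(** A label whose form is nonpositive: a simplex lying where [ell k] is positive has no vertex in
    sector [k]. *)
Definition sector z i : 'I_3 :=
  if ell o0 z i <= 0 then o0 else if ell o1 z i <= 0 then o1 else o2.

Lemma ell_sector z i : ell (sector z i) z i <= 0.
Proof.
rewrite /sector; case: ifP => // h0; case: ifP => // h1.
by move: h0 h1; rewrite /ell /= => /negbT + /negbT; rewrite -!ltNge; lra.
Qed.

Lemma ell_pos_exists z i : (z i ord0 != 0) || (z i ord_max != 0) -> exists k, 0 < ell k z i.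
Proof.
move=> h; have [h0|h0] := ltP 0 (ell o0 z i); first by exists o0.
have [h1|h1] := ltP 0 (ell o1 z i); first by exists o1.
exists o2; move: h h0 h1; rewrite /ell /= => /orP[] /lt_total/orP[]; lra.
Qed.

Lemma ell_pos_neq0 k z i : 0 < ell k z i -> (z i ord0 != 0) || (z i ord_max != 0).
Proof.
move=> h; rewrite -negb_and; apply: contraL h => /andP[/eqP a /eqP b].
by rewrite /ell; case: (val k) => [|[|j]]; rewrite ?a ?b ?subr0 ?oppr0 ltxx.
Qed.

Lemma ell_continuous k i : continuous (fun z => ell k z i).
Proof.
have cc j : continuous (fun z => z i j) by exact: coord_continuous.
case: (ord3P k) => ->; rewrite /ell /= => z; try exact: cc.
exact: (cvgB (cvgN (cc ord0 z)) (cc ord_max z)).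
Qed.

(* The representative of a sector: the unique negative [ell] is the one of that sector. *)
Definition rep (k : 'I_3) (j : 'I_2) : R :=
  match val k, val j with 0, 0 => - 2 | 1, 1 => - 2 | _, _ => 1 end.

Definition rep_mx (f : nat -> 'I_3) : 'M[R]_(m, 2) := \matrix_(i, j) rep (f i) j.

Lemma ell_rep_pos k (f : nat -> 'I_3) i : f i != k -> 0 < ell k (rep_mx f) i.
Proof.
rewrite /ell !mxE /rep /=.
by case: (ord3P k) => ->; case: (ord3P (f i)) => -> //= _; lra.
Qed.

Lemma sector_eq z j i : (forall k, k != j -> 0 < ell k z i) -> sector z i = j.
Proof.
move=> h; apply/eqP; apply: contraT => /h; rewrite ltNge.
by rewrite ell_sector.
Qed.
End PlaneSectors.

(** * Retraction onto the moment-angle complex *)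

Section Retraction.
Variables (R : realType) (m : nat) (K : {set {set 'I_m}}).
Hypothesis Ksc : simplicial_complex K.
Implicit Types (z : 'M[R]_(m, 2)) (i : 'I_m).

Definition nrm z i : R := Num.sqrt (z i ord0 ^+ 2 + z i ord_max ^+ 2).

Lemma nrm_ge0 z i : 0 <= nrm z i. Proof. exact: sqrtr_ge0. Qed.

Lemma nrm2 z i : nrm z i ^+ 2 = z i ord0 ^+ 2 + z i ord_max ^+ 2.
Proof. by rewrite sqr_sqrtr // addr_ge0 // sqr_ge0. Qed.

Lemma nrm_eq0 z i : (nrm z i == 0) = (z i ord0 == 0) && (z i ord_max == 0).
Proof.
by rewrite -(sqrf_eq0 (nrm z i)) nrm2 paddr_eq0 ?sqr_ge0 // !sqrf_eq0.
Qed.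

Lemma nrm_gt0 z i : (0 < nrm z i) = (z i ord0 != 0) || (z i ord_max != 0).
Proof. by rewrite lt0r nrm_ge0 andbT nrm_eq0 negb_and. Qed.

Lemma row_sqr z i : \sum_j row i z ord0 j ^+ 2 = nrm z i ^+ 2.
Proof.
by rewrite nrm2 !big_ord_recl big_ord0 !mxE addr0; do !congr (_ + z _ _ ^+ 2); apply: val_inj.
Qed.

Lemma circle_row z i : circle (row i z) <-> nrm z i = 1.
Proof.
rewrite /circle /= row_sqr; split=> [h|->]; last by rewrite expr1n.
by apply/eqP; rewrite -(eqrXn2 (n := 2)) ?nrm_ge0 // h expr1n.
Qed.

Lemma disk_row z i : disk2 (row i z) <-> nrm z i <= 1.
Proof.
rewrite /disk2 /= row_sqr -[X in _ <= X](expr1n _ 2).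
by rewrite ler_pXn2r ?nnegrE ?nrm_ge0.
Qed.

Lemma nrm_continuous i : continuous (fun z => nrm z i).
Proof.
move=> z; apply: (@continuous_comp _ _ _ (fun z => z i ord0 ^+ 2 + z i ord_max ^+ 2) Num.sqrt).
  have cc j : continuous (fun z => z i j) by exact: coord_continuous.
  exact: (cvgD (cvgM (cc ord0 z) (cc ord0 z)) (cvgM (cc ord_max z) (cc ord_max z))).
exact: sqrt_continuous.
Qed.

(** Positive on good points and equal to 1 on the moment-angle complex, where the starting value 1
    of the minimum caps it. *)
Definition mu z : R :=
  \big[Num.max/0]_(s in K) \big[Num.min/1]_(i | i \notin s) nrm z i.

Lemma mu_continuous : continuous mu.
Proof.
apply: continuous_big => [p|s _].
  by apply: (@continuous_max _ _ fst snd); [exact: cvg_fst|exact: cvg_snd].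
apply: continuous_big => [p|i _]; last exact: nrm_continuous.
by apply: (@continuous_min _ _ fst snd); [exact: cvg_fst|exact: cvg_snd].
Qed.

Definition good z := exists2 s, s \in K & forall i, i \notin s -> 0 < nrm z i.

Lemma mu_gt0 z : good z -> 0 < mu z.
Proof.
move=> [s sK h].
have p : 0 < \big[Num.min/1]_(i | i \notin s) nrm z i.
  by elim/big_ind: _ => // x y x0 y0; rewrite lt_min x0.
apply: lt_le_trans p _.
exact: (le_bigmax_cond (P := fun s => s \in K) 0 (fun s => \big[Num.min/1]_(i | i \notin s) nrm z i) sK).
Qed.

Lemma mu_face z : exists2 s, s \in K & forall i, i \notin s -> mu z <= nrm z i.
Proof.
have [K0 _ _] := Ksc.
have [s sK E] := eq_bigmax (x := 0) finset.set0 (fun s => s \in K)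
   (fun s => \big[Num.min/1]_(i | i \notin s) nrm z i) K0
   (fun s _ => le_bigmin _ ler01 (fun i _ => nrm_ge0 z i)).
exists s => // i si; rewrite /mu E.
exact: bigmin_le_cond.
Qed.

(** Some face contains every coordinate of norm below [mu]. Those are scaled into the disk and all
    others are normalised to the circle; where [mu] is 1 and no norm exceeds 1, nothing moves. *)
Definition ret z : 'M[R]_(m, 2) := \matrix_(i, j) (z i j / Num.max (nrm z i) (mu z)).

Lemma ell_ret k z i : ell k (ret z) i = ell k z i / Num.max (nrm z i) (mu z).
Proof.
by rewrite /ell; case: (val k) => [|[|j]]; rewrite !mxE ?mulrDl ?mulNr.
Qed.

Lemma max_gt0 z i : good z -> 0 < Num.max (nrm z i) (mu z).
Proof. by move=> /mu_gt0 h; rewrite lt_max h orbT. Qed.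

Lemma nrm_ret z i : good z -> nrm (ret z) i = nrm z i / Num.max (nrm z i) (mu z).
Proof.
move=> gz; apply/eqP; have M0 := max_gt0 i gz.
rewrite -(eqrXn2 (n := 2)) ?divr_ge0 ?nrm_ge0 ?ltW //.
by rewrite nrm2 !mxE !expr_div_n nrm2 mulrDl.
Qed.

Lemma ret_in z : good z -> ret z \in polyhedral_product (@disk2 R) (@circle R) K.
Proof.
move=> gz; have [_ Kd _] := Ksc; have [s sK h] := mu_face z.
rewrite inE; exists s => //= i; case: ifP => [_|/negbT/h hi]; [apply/disk_row|apply/circle_row];
  rewrite nrm_ret // /Num.max.
  by rewrite ler_pdivrMr ?max_gt0 // mul1r le_max lexx.
rewrite ltNge hi /= divff // gt_eqF //.
by apply: lt_le_trans hi; apply: mu_gt0.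
Qed.

Lemma nrm_MA (z : moment_angle R K) :
  exists2 s, s \in K & forall i, if i \in s then is_true (nrm (val z) i <= 1) else nrm (val z) i = 1.
Proof.
have := valP z; rewrite inE => -[s sK h]; exists s => // i.
by have := h i; case: ifP => _; [move=> /disk_row|move=> /circle_row].
Qed.

Lemma good_MA (z : moment_angle R K) : good (val z).
Proof.
have [s sK h] := nrm_MA z; exists s => // i si.
by have := h i; rewrite (negbTE si) => ->.
Qed.

Lemma ret_MA (z : moment_angle R K) : ret (val z) = val z.
Proof.
have [s sK h] := nrm_MA z.
have mu1 : mu (val z) = 1.
  apply/eqP; rewrite eq_le; apply/andP; split.
    by apply: bigmax_le => // t _; apply: bigmin_le_id.
  apply: (le_trans _ (le_bigmax_cond (P := fun s => s \in K) 0 (fun s => \big[Num.min/1]_(i | i \notin s) nrm (val z) i) sK)).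
  by apply: le_bigmin => // i si; have := h i; rewrite (negbTE si) => ->.
apply/matrixP => i j; rewrite mxE mu1 (_ : Num.max _ _ = 1) ?divr1 //.
by apply: max_r; have := h i; case: ifP => // _ ->.
Qed.

Definition retMA z (gz : good z) : moment_angle R K :=
  exist (fun x => x \in polyhedral_product (@disk2 R) (@circle R) K) (ret z) (ret_in gz).

Lemma retMA_continuous (T : topologicalType) (y : T -> 'M[R]_(m, 2)) (gy : forall t, good (y t)) :
  continuous y -> continuous (fun t => retMA (gy t)).
Proof.
move=> cy; apply: continuous_setT => /=; apply: continuous_mx => i j.
have -> : (fun t => ret (y t) i j) = (fun t => y t i j / Num.max (nrm (y t) i) (mu (y t))).
  by apply/funext => t; rewrite mxE.
have cn : continuous (fun t => nrm (y t) i).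
  by move=> t; apply: (@continuous_comp _ _ _ y (fun z => nrm z i) t (cy t)); exact: nrm_continuous.
have cm : continuous (fun t => mu (y t)).
  by move=> t; apply: (@continuous_comp _ _ _ y mu t (cy t)); exact: mu_continuous.
have cij : continuous (fun t => y t i j).
  by move=> t; apply: (@continuous_comp _ _ _ y (fun z => z i j) t (cy t)); exact: coord_continuous.
move=> t; have cM : {for t, continuous (fun t => Num.max (nrm (y t) i) (mu (y t)))}.
  exact: (@continuous_max _ _ (fun t => nrm (y t) i) (fun t => mu (y t)) t (cn t) (cm t)).
by apply: (cvgM (cij t)); apply: continuousV cM; rewrite gt_eqF // max_gt0.
Qed.
End Retraction.

(** * Tuples of sectors and faces *)

Fixpoint mkrow m (f : nat -> 'I_3) : row3 m :=
  if m is m'.+1 then (f m', mkrow m' f) else tt.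

Fixpoint coord m : row3 m -> nat -> 'I_3 :=
  if m is m'.+1 then fun v i => if i == m' then v.1 else coord v.2 i else fun _ _ => o0.

Lemma coord_mkrow m f i : (i < m)%N -> coord (mkrow m f) i = f i.
Proof.
elim: m => //= m IH im; case: eqVneq => [->//|ni]; apply: IH.
by rewrite ltn_neqAle ni -ltnS.
Qed.

Lemma mkrow_eq m f g : (forall i, (i < m)%N -> f i = g i) -> mkrow m f = mkrow m g.
Proof. by elim: m => //= m IH h; rewrite h // IH // => i im; apply: h; apply: ltnW. Qed.

Lemma mkrow_coord m (v : row3 m) : mkrow m (coord v) = v.
Proof.
elim: m v => [[]//|m IH] [a v] /=; rewrite eqxx; congr (_, _).
rewrite -[RHS]IH; apply: mkrow_eq => i im; case: eqVneq => // E.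
by rewrite E ltnn in im.
Qed.

Lemma nth_full_cols m (x : seq (row3 m)) i : (i < m)%N ->
  nth false (full_cols x) (m - i.+1) = full [seq coord v i | v <- x].
Proof.
elim: m x => //= m IH x; rewrite ltnS leq_eqVlt => /orP[/eqP->|im].
  by rewrite subSS subnn /= eqxx.
have -> : (m.+1 - i.+1 = (m - i.+1).+1)%N by lia.
rewrite /= IH // /unzip2 -map_comp; congr full.
by apply: eq_map => v /=; rewrite ltn_eqF.
Qed.

Section Face.
Variables (m : nat) (K : {set {set 'I_m}}).
Hypothesis Ksc : simplicial_complex K.

(** The index is reversed because the head of [full_cols] describes the last coordinate. *)
Definition face_of (l : seq bool) : {set 'I_m} := [set i : 'I_m | nth false l (m - i.+1)].
Definition is_face (l : seq bool) := face_of l \in K.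

Lemma is_face_monotone : monotone is_face.
Proof.
have [_ Kd _] := Ksc.
move=> l l' h lK; apply: Kd lK _; apply/fintype.subsetP => i; rewrite !inE.
move: (m - i.+1)%N; elim: l l' h => [|a l IH] [|a' l'] //= /andP[h1 h2] [|j] /=.
  by move: h1; case: a; case: a'.
exact: IH.
Qed.

Lemma nth_count0 t p : count id t = 0%N -> nth false t p = false.
Proof. by elim: t p => [|[] t IH] [|p] //= /IH. Qed.

Lemma nth_count1 t p : count id t = 1%N -> nth false t p = (p == index true t).
Proof.
elim: t p => [|[] t IH] //= p ct; case: p => [|p] //=; last exact: IH.
by rewrite nth_count0 //; case: ct.
Qed.

Lemma is_face_vertex t : size t = m -> count id t = 1%N -> is_face t.
Proof.
have [_ Kd K1] := Ksc; move=> st ct.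
have im : (index true t < m)%N.
  have /hasP[[] //] : has id t by rewrite has_count ct.
  by rewrite -st index_mem.
pose i0 : 'I_m := Ordinal (rev_ord_proof (Ordinal im)).
apply: Kd (K1 i0) _; apply/fintype.subsetP => i; rewrite !inE nth_count1 // => /eqP ii.
by apply/eqP; apply: val_inj => /=; rewrite -ii; have := ltn_ord i; lia.
Qed.
End Face.

(** * Small simplices and convex combinations *)

Section SmallMA.
Variables (R : realType) (m : nat) (K : {set {set 'I_m}}).
Hypothesis Ksc : simplicial_complex K.
Local Notation X := (moment_angle R K).
Implicit Types (n : nat).

Definition small n : set (singular R X n) :=
  [set s | exists2 t, t \in K &
     forall i, i \notin t -> exists k, forall v, 0 < ell k (val (s v)) i].

Lemma small_reparam n N (s : singular R X N) p : small s -> small (reparam n s p).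
Proof.
move=> [t tK h]; exists t => // i it; have [k hk] := h i it.
by exists k => v; apply: hk.
Qed.

Lemma small_mesh N (s : singular R X N) : exists2 e : R, 0 < e &
  forall n p, size p = n.+1 -> mesh_le (@dist R N) e p -> small (reparam n s p).
Proof.
pose O : set (set X) := [set U | exists2 t, t \in K & exists f : 'I_m -> 'I_3,
   U = [set z | forall i, i \notin t -> 0 < ell (f i) (val z) i]].
have [|e e0 H] := lebesgue_number (O := O) (@cts_fun _ _ s).
  move=> v; have [t tK ht] := good_MA (s v).
  have /choice[f hf] : forall i, exists k, i \notin t -> 0 < ell k (val (s v)) i.
    move=> i; have [it|it] := boolP (i \in t); first by exists o0.
    by have [k hk] := ell_pos_exists (etrans (esym (nrm_gt0 _ _)) (ht i it)); exists k.
  exists [set z : X | forall i, i \notin t -> 0 < ell (f i) (val z) i].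
    by exists t => //; exists f.
  apply: (@filter_forall _ _ (fun i (z : X) => i \notin t -> 0 < ell (f i) (val z) i) _
    (nbhs_filter (s v))) => i; have [it|it] := boolP (i \in t).
    by apply: filterE => z /negP.
  have c : continuous (fun z : X => ell (f i) (val z) i).
    move=> z; apply: (@continuous_comp _ _ _ (val : X -> 'M[R]_(m, 2)) (fun z => ell (f i) z i)).
      exact: initial_continuous.
    exact: ell_continuous.
  have nb := @cvgr_gt _ _ _ (nbhs_filter (s v)) _ _ (c (s v)) _ (hf i it).
  by apply: (@filterS _ _ (nbhs_filter (s v)) _ _ _ nb) => z hz _.
(* The mesh bound is weak while the Lebesgue number requires a strict inequality; halving bridges
   the two. *)
exists (e / 2); first by rewrite divr_gt0.
move=> n p sp cp; have p0 : nth (vtx R ord0) p 0 \in p by rewrite mem_nth // sp.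
have [_ [t tK [f ->]] Hf] := H (nth (vtx R ord0) p 0).
exists t => // i it; exists (f i) => v; apply: Hf => //.
apply: (@le_lt_trans _ _ (e / 2)); last by rewrite ltr_pdivrMr // ltr_pMr // ltr1n.
by apply: dist_aff => // a ap; apply: cp.
Qed.

(* Convex combinations of maps [C k], retracted to the moment-angle complex; the condition
   [comb_ok] makes them land in the domain of the retraction. *)
Definition comb n (C : 'I_n.+1 -> simplex R n -> 'M[R]_(m, 2)) (v : simplex R n) : 'M[R]_(m, 2) :=
  \sum_k val v ord0 k *: C k v.

Definition comb_ok n (C : 'I_n.+1 -> simplex R n -> 'M[R]_(m, 2)) :=
  (forall k, continuous (C k)) /\
  exists2 t, t \in K & forall i, i \notin t -> exists j, forall k v, 0 < ell j (C k v) i.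

Lemma ell_comb n (C : 'I_n.+1 -> simplex R n -> 'M[R]_(m, 2)) j i v :
  ell j (comb C v) i = \sum_k val v ord0 k * ell j (C k v) i.
Proof.
rewrite /ell /comb; case: (val j) => [|[|l]]; rewrite !summxE.
- by apply: eq_bigr => k _; rewrite mxE.
- by apply: eq_bigr => k _; rewrite mxE.
- by rewrite -sumrN -sumrB; apply: eq_bigr => k _; rewrite !mxE mulrBr mulrN.
Qed.

Lemma ell_comb_pos n (C : 'I_n.+1 -> simplex R n -> 'M[R]_(m, 2)) j i v :
  (forall k, 0 < ell j (C k v) i) -> 0 < ell j (comb C v) i.
Proof.
move=> h; rewrite ell_comb lt0r sumr_ge0 ?andbT; last first.
  by move=> k _; rewrite mulr_ge0 ?simplex_ge0 ?ltW.
apply/negP => /eqP/psumr_eq0P E.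
have /eqP := simplex_sum v; rewrite big1 ?(eq_sym 0) ?oner_eq0 // => k _.
have /eqP := E (fun k _ => mulr_ge0 (simplex_ge0 v k) (ltW (h k))) k isT.
by rewrite mulf_eq0 (gt_eqF (h k)) orbF => /eqP.
Qed.

Lemma comb_good n C (ok : @comb_ok n C) v : good K (comb C v).
Proof.
have [_ [t tK h]] := ok; exists t => // i it; have [j hj] := h i it.
by rewrite nrm_gt0; apply: (ell_pos_neq0 (k := j)); apply: ell_comb_pos.
Qed.

Lemma comb_continuous n C (ok : @comb_ok n C) : continuous (comb C).
Proof.
have [cC _] := ok; apply: continuous_mx => i j.
have -> : (fun v => comb C v i j) = (fun v => \sum_k val v ord0 k * C k v i j).
  by apply/funext => v; rewrite summxE; apply: eq_bigr => k _; rewrite mxE.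
apply: continuous_bigsum => k _ v.
have cC' : {for v, continuous (fun v => C k v i j)}.
  by apply: (@continuous_comp _ _ _ (C k) (fun z => z i j) v (cC k v)); exact: coord_continuous.
exact: (cvgM (@coord_simplex_continuous R n k v) cC').
Qed.

Definition comb_map n C (ok : @comb_ok n C) (v : simplex R n) : X :=
  retMA Ksc (comb_good ok v).

Lemma comb_map_continuous n C (ok : @comb_ok n C) : continuous (comb_map ok).
Proof. by apply: retMA_continuous; apply: comb_continuous. Qed.

HB.instance Definition _ n C (ok : @comb_ok n C) :=
  isContinuous.Build _ _ (comb_map ok) (@comb_map_continuous _ _ ok).

Definition comb_simplex n C (ok : @comb_ok n C) : singular R X n := comb_map ok.

Lemma comb_simplexE n C (ok : @comb_ok n C) v : val (comb_simplex ok v) = ret K (comb C v).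
Proof. by []. Qed.

Lemma small_comb n C (ok : @comb_ok n C) : small (comb_simplex ok).
Proof.
have [_ [t tK h]] := ok; exists t => // i it; have [j hj] := h i it.
exists j => v; rewrite comb_simplexE ell_ret divr_gt0 ?ell_comb_pos //.
by apply: max_gt0 => //; apply: comb_good.
Qed.
End SmallMA.

(** * Comparison of small simplices with tuples of sectors *)

Section Comparison.
Variables (R : realType) (m : nat) (K : {set {set 'I_m}}).
Hypothesis Ksc : simplicial_complex K.
Local Notation X := (moment_angle R K).
Implicit Types (n : nat).

Definition sectors (z : 'M[R]_(m, 2)) : row3 m :=
  mkrow m (fun i => oapp (sector z) o0 (insub i)).

Definition rep_pt (v : row3 m) : 'M[R]_(m, 2) := rep_mx R m (coord v).

Lemma coord_sectors z (i : 'I_m) : coord (sectors z) i = sector z i.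
Proof. by rewrite coord_mkrow // valK. Qed.

Lemma sectors_eq z v : (forall i : 'I_m, sector z i = coord v i) -> sectors z = v.
Proof.
move=> h; rewrite -[RHS]mkrow_coord; apply: mkrow_eq => i im.
by rewrite -[i]/(val (Ordinal im)) valK -h.
Qed.

Definition types n (s : singular R X n) : seq (row3 m) :=
  [seq sectors (val (s (vtx R j))) | j <- enum 'I_n.+1].

Lemma size_types n (s : singular R X n) : size (types s) = n.+1.
Proof. by rewrite size_map size_enum_ord. Qed.

Definition row0 : row3 m := mkrow m (fun=> o0).

Lemma nth_types n (s : singular R X n) (j : 'I_n.+1) :
  nth row0 (types s) j = sectors (val (s (vtx R j))).
Proof. by rewrite (nth_map ord0) ?size_enum_ord // nth_ord_enum. Qed.

Lemma types_face n (s : singular R X n.+1) (i : 'I_n.+2) :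
  types (face s (lift i)) = take i (types s) ++ drop i.+1 (types s).
Proof.
rewrite -(map_nth_lift row0) ?size_types //; apply: eq_map => j.
by rewrite nth_types /= vertex_map_vtx.
Qed.

Lemma not_full (l : seq 'I_3) : ~~ full l -> exists j, j \notin l.
Proof. by rewrite /full !negb_and => /or3P[] h; [exists o0|exists o1|exists o2]. Qed.

Lemma is_face_types n (s : singular R X n) : small s -> is_face K (full_cols (types s)).
Proof.
have [_ Kd _] := Ksc; move=> [t tK h]; apply: Kd tK _; apply/fintype.subsetP => i.
rewrite inE nth_full_cols //; apply: contraLR => /h[k hk].
have : k \notin [seq coord v i | v <- types s].
  apply/mapP => -[_ /mapP[j _ ->] E]; move: (hk (vtx R j)).
  by rewrite E coord_sectors ltNge ell_sector.
by apply: contra => /and3P[a b c]; case: (ord3P k) => ->.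
Qed.

Lemma const_ok n (x : seq (row3 m)) : size x = n.+1 -> is_face K (full_cols x) ->
  comb_ok K (fun (k : 'I_n.+1) (_ : simplex R n) => rep_pt (nth row0 x k)).
Proof.
move=> sx xK; split=> [k|]; first exact: cst_continuous.
exists (face_of m (full_cols x)) => // i; rewrite inE nth_full_cols // => /not_full[j jx].
exists j => k _; apply: ell_rep_pos; apply: contraNneq jx => <-.
by apply: map_f; rewrite mem_nth // sx.
Qed.

Lemma default_ok n : comb_ok K (fun (k : 'I_n.+1) (_ : simplex R n) => rep_pt row0).
Proof.
have [K0 _ _] := Ksc.
split=> [k|]; first exact: cst_continuous.
exists finset.set0 => // i _; exists o1 => k _.
by apply: ell_rep_pos; rewrite coord_mkrow.
Qed.

(** Made total, so that simplices are compared without carrying proofs of [comb_ok]. The default is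
    small as well, hence [small_simplex_of] is unconditional. *)
Definition simplex_of n (C : 'I_n.+1 -> simplex R n -> 'M[R]_(m, 2)) : singular R X n :=
  match pselect (comb_ok K C) with
  | left ok => comb_simplex Ksc ok
  | right _ => comb_simplex Ksc (default_ok n)
  end.

Lemma simplex_ofE n C v : comb_ok K C -> val (@simplex_of n C v) = ret K (comb C v).
Proof. by move=> ok; rewrite /simplex_of; case: pselect. Qed.

Lemma small_simplex_of n C : small (@simplex_of n C).
Proof. by rewrite /simplex_of; case: pselect => ok; apply: small_comb. Qed.

Lemma comb_face k n (f : 'I_k.+1 -> 'I_n.+1) (C : 'I_n.+1 -> simplex R n -> 'M[R]_(m, 2))
    (v : simplex R k) :
  comb C (vertex_map f v) = comb (fun j w => C (f j) (vertex_map f w)) v.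
Proof.
rewrite /comb [RHS](partition_big f predT) //=; apply: eq_bigr => i _.
rewrite [X in X *: _]mxE scaler_suml; apply: eq_bigr => j /eqP ji.
by rewrite ji.
Qed.

Definition rep_simplex n (x : seq (row3 m)) : singular R X n :=
  simplex_of (fun k _ => rep_pt (nth row0 x k)).

Lemma rep_simplex_face n x (i : 'I_n.+2) : size x = n.+2 -> is_face K (full_cols x) ->
  face (rep_simplex n.+1 x) (lift i) = rep_simplex n (take i x ++ drop i.+1 x).
Proof.
move=> sx xK; apply: singularP => v; apply: val_inj => /=.
have sub : {subset take i x ++ drop i.+1 x <= x}.
  by move=> y; rewrite mem_cat => /orP[/mem_take|/mem_drop].
rewrite !simplex_ofE; last first.
- exact: const_ok.
- apply: const_ok; first by rewrite -(map_nth_lift row0) // size_map size_enum_ord.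
  exact: (full_cols_sub (is_face_monotone Ksc) sub).
rewrite comb_face; congr (ret K _); apply: eq_bigr => j _; congr (_ *: rep_pt _).
by rewrite -(map_nth_lift row0) // (nth_map ord0) ?size_enum_ord // nth_ord_enum.
Qed.

Lemma comb_vtx n (C : 'I_n.+1 -> simplex R n -> 'M[R]_(m, 2)) j :
  comb C (vtx R j) = C j (vtx R j).
Proof.
rewrite /comb (bigD1 j) //= big1 ?addr0 => [|k kj]; first by rewrite vtxE eqxx scale1r.
by rewrite vtxE (negbTE kj) scale0r.
Qed.

(** At a representative every form except that of its own sector is positive, and the retraction
    divides each form by a positive number. *)
Lemma types_rep_simplex n x : size x = n.+1 -> is_face K (full_cols x) ->
  types (rep_simplex n x) = x.
Proof.
move=> sx xK; have ok := const_ok sx xK.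
apply: (@eq_from_nth _ row0); rewrite size_types // => j jn.
rewrite (nth_types _ (Ordinal jn)) simplex_ofE // comb_vtx /=.
apply: sectors_eq => i; apply: sector_eq => k kj.
rewrite ell_ret divr_gt0 //; first by apply: ell_rep_pos; rewrite eq_sym.
apply: max_gt0 => //; have := comb_good ok (vtx R (Ordinal jn)).
by rewrite comb_vtx.
Qed.

(** ['I_(n + n.+1).+1] is convertible to ['I_(n.+1 + n.+1)]; writing the dimension this way lets
    [split] serve as the projection of the join to its two ends. *)
Definition fold_ord n (k : 'I_(n + n.+1).+1) : 'I_n.+1 :=
  match @fintype.split n.+1 n.+1 k with inl j => j | inr j => j end.

(* The join of two copies of the simplex: [s] on the first, the representatives of the
   sectors of the vertices of [s] on the second. *)
Definition join_maps n (s : singular R X n) (k : 'I_(n + n.+1).+1) (v : simplex R (n + n.+1)) :=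
  match @fintype.split n.+1 n.+1 k with
  | inl _ => val (s (vertex_map (@fold_ord n) v))
  | inr j => rep_pt (sectors (val (s (vtx R j))))
  end.

(** If [ell k] is positive on all of [s], no vertex has sector [k], so the representatives lie in
    the same half-plane and the straight join stays inside it. *)
Lemma join_ok n (s : singular R X n) : small s -> comb_ok K (join_maps s).
Proof.
move=> [t tK h]; split=> [k|].
  rewrite /join_maps; case: fintype.split => j; last exact: cst_continuous.
  apply: continuous_set_val => v; apply: continuous_comp; first exact: vertex_map_continuous.
  exact: cts_fun.
exists t => // i /h[k hk]; exists k => l v; rewrite /join_maps; case: fintype.split => j; first exact: hk.
apply: ell_rep_pos; rewrite coord_sectors; apply: contraTneq (hk (vtx R j)) => <-.
by rewrite -leNgt ell_sector.
Qed.

Definition join_simplex n (s : singular R X n) : singular R X (n + n.+1) :=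
  simplex_of (join_maps s).

Definition ldup n (j : 'I_n.+1) : 'I_(n + n.+1).+1 := lshift n.+1 j.
Definition rdup n (j : 'I_n.+1) : 'I_(n + n.+1).+1 := @rshift n.+1 n.+1 j.

Lemma split_ldup n (j : 'I_n.+1) : @fintype.split n.+1 n.+1 (ldup j) = inl j.
Proof. exact: (unsplitK (inl j)). Qed.
Lemma split_rdup n (j : 'I_n.+1) : @fintype.split n.+1 n.+1 (rdup j) = inr j.
Proof. exact: (unsplitK (inr j)). Qed.

Lemma vertex_map_comp k l n (g : 'I_l.+1 -> 'I_n.+1) (f : 'I_k.+1 -> 'I_l.+1) (v : simplex R k) :
  vertex_map g (vertex_map f v) = vertex_map (g \o f) v.
Proof.
rewrite [LHS]vertex_map_aff [X in aff _ X]vertex_map_aff -aff_aff; last first.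
  by rewrite size_map size_enum_ord.
rewrite vertex_map_aff -map_comp; congr (aff _ v); apply: eq_map => j /=.
by rewrite aff_vtx (nth_map ord0) ?size_enum_ord // nth_ord_enum.
Qed.

Lemma vertex_map_id n (v : simplex R n) : vertex_map id v = v.
Proof. by rewrite vertex_map_aff aff_vertices. Qed.

Lemma face_ldup n (s : singular R X n) : small s -> face (join_simplex s) (@ldup n) = s.
Proof.
move=> ss; apply: singularP => v; apply: val_inj => /=.
rewrite simplex_ofE; last exact: join_ok.
rewrite comb_face -[RHS]ret_MA; congr (ret K _).
rewrite /comb /join_maps; under eq_bigr => j _.
  rewrite split_ldup vertex_map_comp (_ : _ \o _ = id).
    rewrite vertex_map_id.
    over.
  by apply/funext => i /=; rewrite /fold_ord split_ldup.
by rewrite -scaler_suml simplex_sum scale1r.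
Qed.

Lemma face_rdup n (s : singular R X n) : small s ->
  face (join_simplex s) (@rdup n) = rep_simplex n (types s).
Proof.
move=> ss; apply: singularP => v; apply: val_inj => /=.
rewrite !simplex_ofE; last first.
- exact: join_ok.
- by apply: const_ok; [exact: size_types|exact: is_face_types].
rewrite comb_face; congr (ret K _); apply: eq_bigr => j _; congr (_ *: _).
by rewrite /join_maps split_rdup nth_types.
Qed.

Definition dup_lift n (i : 'I_n.+2) (k : 'I_(n + n.+1).+1) : 'I_(n.+1 + n.+2).+1 :=
  match @fintype.split n.+1 n.+1 k with inl j => ldup (lift i j) | inr j => rdup (lift i j) end.

Lemma fold_dup_lift n (i : 'I_n.+2) k : fold_ord (dup_lift i k) = lift i (fold_ord k).
Proof.
by rewrite /dup_lift /fold_ord; case: (@fintype.split n.+1 n.+1 k) => j; rewrite ?split_ldup ?split_rdup.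
Qed.

Lemma join_simplex_face n (s : singular R X n.+1) (i : 'I_n.+2) : small s ->
  face (join_simplex s) (dup_lift i) = join_simplex (face s (lift i)).
Proof.
move=> ss; apply: singularP => v; apply: val_inj => /=.
rewrite !simplex_ofE; last first.
- exact: join_ok.
- by apply: join_ok; rewrite face_reparam; exact: small_reparam.
rewrite comb_face; congr (ret K _); apply: eq_bigr => k _; congr (_ *: _).
rewrite /join_maps {1}/dup_lift; case: (@fintype.split n.+1 n.+1 k) => j; rewrite ?split_ldup ?split_rdup.
  rewrite /= !vertex_map_comp (_ : @fold_ord n.+1 \o dup_lift i = lift i \o @fold_ord n) //.
  by apply/funext => l /=; apply: fold_dup_lift.
by rewrite /= vertex_map_vtx.
Qed.

Section Homotopy.
Variable (A : comNzRingType).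

Definition pull_types (f : seq (row3 m) -> A) n : cochain R X A n := fun s => f (types s).
Arguments pull_types : clear implicits.

(** Zero on tuples of other sizes, in particular on the empty one, as the augmented [drec]
    demands. *)
Definition eval_rep n (c : cochain R X A n) (x : seq (row3 m)) : A :=
  if size x == n.+1 then c (rep_simplex n x) else 0.

Lemma delta_pull_types f n : delta (pull_types f n) = pull_types (drec f) n.+1.
Proof.
apply/funext => s; rewrite [RHS]drecE size_types; apply: eq_bigr => i _.
by rewrite /pull_types types_face.
Qed.

Lemma drec_eval_rep n (c : cochain R X A n) x : is_face K (full_cols x) ->
  drec (eval_rep c) x = if size x == n.+2 then delta c (rep_simplex n.+1 x) else 0.
Proof.
move=> xK; case: eqVneq => sx; last first.
  apply: drec_eq0 => y /size_faces E; rewrite /eval_rep; case: eqP => // sy.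
  by rewrite E sy eqxx in sx.
transitivity (drec (fun q => c (rep_simplex n q)) x).
  by apply: eq_drec => y /size_faces; rewrite sx /eval_rep => -[<-]; rewrite eqxx.
rewrite -(delta_drec (h := rep_simplex)) // => i.
exact: rep_simplex_face.
Qed.

Lemma prism_map (U U' V V' : eqType) (f g : U -> V) (f' g' : U' -> V') (p : U -> U') (q : V -> V')
    (c : seq V' -> A) x : (forall a, f' (p a) = q (f a)) -> (forall a, g' (p a) = q (g a)) ->
  prism f' g' c (map p x) = prism f g (fun y => c (map q y)) x.
Proof.
move=> hf hg; elim: x c => //= a x IH c; rewrite IH hf hg -!map_comp /=.
by congr (c (_ :: _ :: _) - _); apply: eq_map.
Qed.

Definition join_face n (s : singular R X n) k (y : seq 'I_(n + n.+1).+1) : singular R X k :=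
  face (join_simplex s) (fun j : 'I_k.+1 => nth ord0 y j).

Lemma join_face_face n (s : singular R X n) k y (i : 'I_k.+2) : size y = k.+2 ->
  face (join_face s k.+1 y) (lift i) = join_face s k (take i y ++ drop i.+1 y).
Proof.
move=> sy; rewrite /join_face face_face; apply: eq_face => j /=.
by rewrite -(map_nth_lift ord0) // (nth_map ord0) ?size_enum_ord // nth_ord_enum.
Qed.

Definition join_prism k (c : cochain R X A k) n (s : singular R X n) : seq 'I_n.+1 -> A :=
  prism (@ldup n) (@rdup n) (fun y => c (join_face s k y)).

Lemma drec_join_prism n (c : cochain R X A n) (s : singular R X n) : delta c = 0 -> small s ->
  drec (join_prism c s) (enum 'I_n.+1) = c (rep_simplex n (types s)) - c s.
Proof.
move=> dc ss.
have := drec_prism (@ldup n) (@rdup n) (fun y => c (join_face s n y)) (enum 'I_n.+1).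
rewrite [X in _ + X](_ : _ = 0) ?addr0 => [->|].
  have E (f : 'I_n.+1 -> 'I_(n + n.+1).+1) :
      join_face s n (map f (enum 'I_n.+1)) = face (join_simplex s) f.
    by apply: eq_face => j; rewrite (nth_map ord0) ?size_enum_ord // nth_ord_enum.
  by rewrite !E face_ldup // face_rdup.
apply: prism_eq0 => y /size_mixed; rewrite size_enum_ord => sy.
rewrite -(delta_drec (h := join_face s)) ?dc // => i.
exact: join_face_face.
Qed.

Lemma join_prism_face n (c : cochain R X A n.+1) (s : singular R X n.+1) (i : 'I_n.+2) : small s ->
  join_prism c (face s (lift i)) (enum 'I_n.+1) =
  join_prism c s (take i (enum 'I_n.+2) ++ drop i.+1 (enum 'I_n.+2)).
Proof.
move=> ss; rewrite -(map_nth_lift ord0) ?size_enum_ord //.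
rewrite (eq_map (fun j => nth_ord_enum _ (lift i j))).
rewrite /join_prism (prism_map (f := @ldup n) (g := @rdup n) (q := dup_lift i)); last 2 first.
- by move=> j; rewrite /dup_lift split_ldup.
- by move=> j; rewrite /dup_lift split_rdup.
apply: eq_prism => y /size_mixed; rewrite size_enum_ord => sy; congr (c _).
rewrite /join_face -join_simplex_face // face_face; apply: eq_face => j /=.
by rewrite (nth_map ord0) ?sy.
Qed.

(** The prism inside the join of [s] with the simplex of its sectors is a homotopy natural in faces.
    The resulting [e] is a coboundary on all simplices, though the equation holds only on small
    ones. *)
Lemma small_homotopy n (c : cochain R X A n) : delta c = 0 ->
  exists2 e : cochain R X A n, coboundaries e &
    forall s, small s -> c s = pull_types (eval_rep c) n s + e s.
Proof.
move=> dc.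
have E s : small s -> c s = pull_types (eval_rep c) n s - drec (join_prism c s) (enum 'I_n.+1).
  by move=> ss; rewrite drec_join_prism // /pull_types /eval_rep size_types eqxx; ring.
case: n c dc E => [|n] c dc E.
  (* In degree 0 the homotopy term is the prism over the empty tuple, which is 0. *)
  exists 0 => // s ss; rewrite E //.
  rewrite (_ : enum 'I_1 = [:: ord0]) /join_prism /=; first by rewrite subrr oppr0.
  by apply: (inj_map val_inj); rewrite val_enum_ord.
exists (- delta (fun s => join_prism c s (enum 'I_n.+1))).
  by exists (- (fun s => join_prism c s (enum 'I_n.+1))); rewrite ?raddfN.
move=> s ss; rewrite E //; congr (_ - _).
rewrite drecE size_enum_ord; apply: eq_bigr => i _.
by rewrite join_prism_face.
Qed.
End Homotopy.
End Comparison.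
Arguments pull_types {R m K A} f n s.

(** * The two halves of the theorem *)

Definition lift2 (x : 'F_2) : int := (x != 0)%:Z.

Lemma lift2K x : (lift2 x)%:~R = x :> 'F_2.
Proof. by rewrite [RHS]F2_bool. Qed.

Lemma F2_half (k : int) : k%:~R = 0 :> 'F_2 -> k = 2 * (k %/ 2)%Z.
Proof. by move=> /eqP; rewrite F2_int => /divzK; rewrite mulrC. Qed.

Notation sq1 := (@steenrod_sq _ _ 1 _).

Section Assembly.
Variables (R : realType) (m : nat) (K : {set {set 'I_m}}).
Hypothesis Ksc : simplicial_complex K.
Local Notation X := (moment_angle R K).
Local Notation Kf := (is_face K).
Let Km : monotone Kf := is_face_monotone Ksc.

Lemma small_face n (s : singular R X n.+1) (i : 'I_n.+2) : small s -> small (face s (lift i)).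
Proof. by move=> ss; rewrite face_reparam; exact: small_reparam. Qed.

Lemma eq_delta_small (A : nzRingType) n (c d : cochain R X A n) s :
  (forall t, small t -> c t = d t) -> small s -> delta c s = delta d s.
Proof. by move=> cd ss; apply: eq_bigr => i _; rewrite cd //; apply: small_face. Qed.

Lemma deltaD_app (A : nzRingType) n (c d : cochain R X A n) s :
  delta (c + d) s = delta c s + delta d s.
Proof. by rewrite raddfD. Qed.

Lemma deltaB_app (A : nzRingType) n (c d : cochain R X A n) s :
  delta (c - d) s = delta c s - delta d s.
Proof. by rewrite raddfB. Qed.

(* [a] is the integral Bockstein of [c]; [b] is a combinatorial model of [c] with
   Bockstein [a']. *)
Lemma bockstein_model n (c : cochain R X 'F_2 n) (a : cochain R X int n.+1)
    (b a' : seq (option bool) -> int) (e : cochain R X int n) :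
  delta (lift01 c) = (fun s => 2 * a s) -> delta e = 0 ->
  (forall k, size k = m -> Kf (twos k) -> wdeg k = n.+1 -> dM b k = 2 * a' k) ->
  (forall s, small s -> c s = (Psi b (types s))%:~R + (e s)%:~R) ->
  exists v : cochain R X int n, forall s, small s ->
    a s = Psi a' (types s) + delta v s.
Proof.
move=> da de db cE.
pose v : cochain R X int n := fun s => ((lift01 c s - Psi b (types s) - e s) %/ 2)%Z.
exists v => s ss.
have vE t : small t -> lift01 c t = Psi b (types t) + e t + 2 * v t.
  move=> st; rewrite -F2_half; first by ring.
  by rewrite !rmorphB /= lift01K cE //; ring.
apply: (@mulfI _ (2 : int)) => //.
rewrite -[LHS]/((fun s => 2 * a s) s) -da.
rewrite (@eq_delta_small _ _ _ (pull_types (Psi b) n + e + (fun t => 2 * v t))) //; last first.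
rewrite deltaD_app deltaD_app delta_pull_types de addr0 delta_mul2 mulrDr; congr (_ + _).
rewrite /pull_types drec_Psi -PsiZ; apply: (eq_Psi_deg Km); last exact: is_face_types.
by move=> k sk kK; rewrite size_types => -[dk]; apply: db.
Qed.

Lemma small_extend n (e : cochain R X 'F_2 n.+1) :
  (forall s, small s -> e s = 0) -> delta e = 0 ->
  exists2 h : cochain R X 'F_2 n, forall s, small s -> h s = 0 & delta h = e.
Proof.
by apply: small_acyclic; [move=> *; exact: small_reparam|move=> *; exact: small_mesh].
Qed.

(** Lift the primitive and take its integral coboundary; a term lifted in this way adds nothing to
    the Bockstein. *)
Lemma integral_coboundary n (e : cochain R X 'F_2 n) : coboundaries e ->
  exists2 E : cochain R X int n, delta E = 0 & forall s, (E s)%:~R = e s.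
Proof.
case: n e => [|n] e; first by move=> ->; exists 0; rewrite ?raddf0.
move=> [w _ <-]; exists (delta (lift01 w)); first exact: delta_delta.
move=> s; rewrite -[LHS]/((fun s => (delta (lift01 w) s)%:~R : 'F_2) s) -delta_red.
by congr (delta _ s); apply/funext => t; rewrite lift01K.
Qed.

(** On small simplices [c] is a word cochain plus two coboundaries. These lift to integral cocycles,
    so the Bockstein of [c] is that of the words, a word coboundary mod 2 in this range. *)
Lemma steenrod_sq1_coboundary n (c : cochain R X 'F_2 n) : (n <= 7)%N -> delta c = 0 ->
  exists y, delta y = sq1 c.
Proof.
move=> n7 dc; have [a da Esq] := sq1_bockstein dc.
have [e ecob cE] := small_homotopy Ksc dc.
have [E dE Ee] := integral_coboundary ecob.
pose g := eval_rep Ksc c.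
(* With zero in the first slot of the cone, acyclicity says that the cocycle [g] is the image of a
   word cocycle up to coboundary. *)
have [|||b [u [u0 b0 gE]]] := @Psi_quasi_iso 'F_2 m Kf (fun=> 0) g Km.
- by [].
- by move=> k _ _; exact: dM0.
- by move=> x xK; rewrite Psi0 drec_eval_rep // dc; case: ifP.
pose B k := lift2 (b k).
have dB k : size k = m -> Kf (twos k) -> dM B k = 2 * (dM B k %/ 2)%Z.
  move=> sk kK; apply: F2_half; rewrite (dM_rmorph intr).
  by rewrite (eq_dM k (fun k => lift2K (b k))) -b0.
have [|uu [vv Huv]] := dM_bockstein (n := n) Km (is_face_vertex Ksc) n7 (a := fun k => (dM B k %/ 2)%Z) (c := B).
  by move=> k sk kK _; exact: dB.
pose U y := lift2 (u y).
have [||s ss|v Hv] := @bockstein_model n c a B (fun k => (dM B k %/ 2)%Z)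
   (pull_types (drec U) n + E) da.
- rewrite raddfD /= dE addr0 delta_pull_types.
  by apply/funext => s; rewrite /pull_types drec_drec.
- by move=> k sk kK _; exact: dB.
- rewrite cE // {1}/pull_types -/g gE ?is_face_types //.
  have -> : (pull_types (drec U) n + E) s = drec U (types s) + E s by [].
  rewrite rmorphD /= Ee addrA (Psi_rmorph intr) (eq_Psi Km (b' := b)) ?is_face_types //; last first.
    by move=> k _ _; exact: lift2K.
  congr (_ + _ + _); rewrite drecE [in RHS]drecE rmorph_sum; apply: eq_bigr => i _.
  by rewrite rmorphM rmorphXn rmorphN1 /= lift2K.
pose y0 : cochain R X int n := pull_types (Psi uu) n + v.
pose y : cochain R X 'F_2 n := fun s => (y0 s)%:~R.
(* The equation is known only on small simplices; the error vanishes there and is closed, so it is a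
   coboundary. *)
have [||h h0 Eh] := @small_extend n (sq1 c - delta y).
- move=> s ss.
  have -> : (sq1 c - delta y) s = sq1 c s - delta y s by [].
  rewrite Esq /y delta_red -rmorphB /= Hv // deltaD_app delta_pull_types.
  rewrite /pull_types drec_Psi.
  have -> : Psi (fun k => (dM B k %/ 2)%Z) (types s) = Psi (dM uu) (types s) + 2 * Psi vv (types s).
    rewrite -PsiZ -PsiD; apply: (eq_Psi_deg Km); last exact: is_face_types.
    by move=> k sk kK; rewrite size_types => -[dk]; apply: Huv.
  apply/eqP; rewrite F2_int; apply/dvdzP; exists (Psi vv (types s)); ring.
- rewrite raddfB /= delta_delta subr0.
  have zc : c \in @cocycle_pred R X 'F_2 n by rewrite unfold_in /cocycle_pred dc.
  exact: (eqP (sq1_cocycle (exist _ c zc))).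
by exists (h + y); rewrite raddfD /= Eh subrK.
Qed.
End Assembly.

Lemma coh_class0 (R : realType) (X : topologicalType) (A : nzRingType) n :
  coh_class (0 : cocycle R X A n) = 0.
Proof. by rewrite /coh_class piE. Qed.

Lemma Sq1_eq0P (R : realType) (X : topologicalType) n (z : cocycle R X 'F_2 n) :
  Sq1 (coh_class z) = 0 <-> exists y, delta y = sq1 (val z).
Proof.
rewrite Sq1_class -coh_class0; split=> [/coh_classP|[y Ey]].
  by move=> [y _ Ey]; exists y; rewrite Ey subr0.
by apply/coh_classP; exists y => //; rewrite Ey subr0.
Qed.

(** Bits are listed from the last vertex to the first, the order used by [face_of]. *)
Definition bits6 (s : {set 'I_6}) : seq bool :=
  mkseq (fun j => (inord (5 - j) : 'I_6) \in s) 6.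

Definition RP2 : {set {set 'I_6}} := [set s | rp2 (bits6 s)]%SET.

Lemma all2_mkseq (T U : Type) (p : T -> U -> bool) f g k :
  (forall i, p (f i) (g i)) -> all2 p (mkseq f k) (mkseq g k).
Proof. by move=> h; rewrite /mkseq; elim: (iota 0 k) => //= i l ->; rewrite h. Qed.

Lemma RP2_complex : simplicial_complex RP2.
Proof.
split.
- rewrite inE; have -> : bits6 finset.set0 = nseq 6 false; last by vm_compute.
  by rewrite /bits6 /mkseq /= !inE.
- move=> s t; rewrite !inE => sK ts; apply: rp2_monotone sK.
  by apply: all2_mkseq => j; apply/implyP; apply: (fintype.subsetP ts).
move=> i; rewrite inE.
have -> : bits6 [set i]%SET = mkseq (fun j => (5 - j == i)%N) 6.
  by apply: eq_mkseq => j; rewrite inE -val_eqE /= inordK // ltnS leq_subr.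
by case: i => [[|[|[|[|[|[|k]]]]]] i] //; vm_compute.
Qed.

Lemma is_face_RP2 l : size l = 6%N -> is_face RP2 l = rp2 l.
Proof.
move=> sl; rewrite /is_face inE; congr rp2.
apply: (@eq_from_nth _ false); rewrite size_mkseq // => j j6.
rewrite nth_mkseq // inE inordK; last by rewrite ltnS leq_subr.
by congr nth; lia.
Qed.

Section RP2Class.
Variable R : realType.
Let Ksc := RP2_complex.
Local Notation X := (moment_angle R RP2).
Let Kf := is_face RP2.
Let Km : monotone Kf := is_face_monotone Ksc.

Let KfE k : size k = 6%N -> Kf (twos k) = rp2 (twos k).
Proof. by move=> sk; apply: is_face_RP2; rewrite size_map. Qed.

Let b2 k : 'F_2 := (rp2_cochain k)%:~R.
Let c0 : cochain R X 'F_2 8 := pull_types (Psi b2) 8.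

Let dc0_small (s : singular R X 9) : small s -> delta c0 s = 0.
Proof.
move=> ss; rewrite /c0 delta_pull_types /pull_types drec_Psi -(Psi0 'F_2 (types s)).
apply: (eq_Psi Km); last exact: is_face_types.
move=> k sk; rewrite KfE // => kK.
by rewrite -(dM_rmorph intr) rp2_bocksteinE // rmorphM /= (_ : 2%:~R = 0 :> 'F_2) ?mul0r //; apply/eqP.
Qed.

(** If the square were a coboundary, evaluation on representative simplices would make the image of
    [rp2_bockstein] under [Psi] a coboundary of tuples. [Psi] is injective on cohomology, which
    contradicts [rp2_bockstein_neq]. *)
Lemma RP2_class : exists2 c : cochain R X 'F_2 8, delta c = 0 &
  forall y, delta y <> sq1 c.
Proof.
(* [c0] is closed only on small simplices; [h] repairs this without changing its values there. *)
have [|h h0 Eh] := small_extend dc0_small; first exact: delta_delta.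
exists (c0 - h); first by rewrite raddfB /= Eh subrr.
move=> y Ey; set c := c0 - h in Ey.
have dc : delta c = 0 by rewrite raddfB /= Eh subrr.
have [a da Esq] := sq1_bockstein dc.
have [|||v Hv] := @bockstein_model R 6 RP2 Ksc 8 c a rp2_cochain rp2_bockstein 0 da.
- by rewrite raddf0.
- by move=> k sk; rewrite -/(Kf _) KfE // => kK _; apply: rp2_bocksteinE.
- move=> s ss; rewrite addr0.
  have -> : c s = c0 s - h s by [].
  by rewrite h0 // subr0 (Psi_rmorph intr).
pose yy : cochain R X 'F_2 8 := y - (fun s => (v s)%:~R).
have Hyy s : small s -> (Psi rp2_bockstein (types s))%:~R = delta yy s :> 'F_2.
  move=> ss; rewrite deltaB_app delta_red Ey Esq Hv // rmorphD /=; ring.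
pose b9 k : 'F_2 := (rp2_bockstein9 k)%:~R.
have [|k sk kK|x xK|u [_ [_ Hu _]]] := @Psi_quasi_iso 'F_2 6 Kf b9 (eval_rep Ksc yy) Km.
- by [].
- by apply: rp2_bockstein9_cocycle; rewrite -?KfE.
- rewrite drec_eval_rep //; case: eqVneq => sx.
    rewrite -Hyy; last exact: small_simplex_of.
    rewrite types_rep_simplex // (Psi_rmorph intr); apply: (eq_Psi_deg Km) => // k sk kK.
    by rewrite sx /b9 /rp2_bockstein9 => -[->].
  rewrite -(Psi0 'F_2 x); apply: (eq_Psi_deg Km) => // k sk kK dk.
  by rewrite /b9 /rp2_bockstein9; case: eqP => // d9; rewrite -dk d9 eqxx in sx.
apply: (@rp2_bockstein_neq u) => k sk kK dk.
by rewrite -Hu ?KfE // /b9 /rp2_bockstein9 dk.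
Qed.
End RP2Class.

Theorem corollary4p3p4 (R : realType) :
  (forall (m : nat) (K : {set {set 'I_m}}), simplicial_complex K ->
     forall (n : nat) (x : cohomology R (moment_angle R K) 'F_2 n),
       (n <= 7)%N -> Sq1 x = 0) /\
  (exists (m : nat) (K : {set {set 'I_m}}), simplicial_complex K /\
     exists x : cohomology R (moment_angle R K) 'F_2 8, Sq1 x <> 0).
Proof.
split=> [m K Ksc n x n7|].
  rewrite -(coh_reprK x); apply/Sq1_eq0P.
  apply: (steenrod_sq1_coboundary Ksc n7); exact: (eqP (valP (coh_repr x))).
exists 6%N, RP2; split; first exact: RP2_complex.
have [c dc nc] := RP2_class R.
have zc : c \in @cocycle_pred R (moment_angle R RP2) 'F_2 8 by rewrite unfold_in /cocycle_pred dc.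
exists (coh_class (exist _ c zc)) => /Sq1_eq0P[y Ey].
exact: (nc y Ey).
Qed.
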